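(* Let $u^N(t,\frac xN)$ be the solution on $[0,T]\times\frac1N\mathbb T_N^n$ of $$\partial_t u^N=\Delta^N\varphi(u^N)+Kf(u^N),$$ satisfying $u_-\le u^N(t,\frac xN)\le u_+$ for all $t\in[0,T]$, $x\in\mathbb T^n_N$, and assume that $\sup_N\|u^N(0)\|_{C^2_N}\le C_0<\infty$. Let $\sigma\in(0,1)$ be the Nash exponent. Then there is $C=C(n,c_\pm,T,\sigma,\|f\|_\infty,\|\varphi''\|_\infty,u_\pm)$ (independent of $N$, $K$, $C_0$) such that $$|\tilde u^N|_{1+\sigma}\le C(K+C_0+1)^{1+\frac1\sigma}.$$ In particular, for every $|e|=1$, $t\in[0,T]$, $x\in\mathbb T^n_N$, $$|\nabla_e^Nu^N(t,\tfrac xN)|\le C(K+C_0+1)^{\frac1\sigma},$$ and the $\sigma$-Hölder seminorm of $\nabla^N_eu^N$ is bounded uniformly in $t\ge0$: $$[\nabla^N_e\tilde u^N]_\sigma\le C(K+C_0+1)^{1+\frac1\sigma}.$$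
   Context: Lattice notation. $N\in\mathbb N$, $T>0$ fixed, $\mathbb T^n=\mathbb R^n/\mathbb Z^n$, $\mathbb T_N^n=(\mathbb Z/N\mathbb Z)^n$; functions on $\frac1N\mathbb T^n_N\subset\mathbb T^n$ are written $u(\frac xN)$. For $e\in\mathbb Z^n$, $|e|=1$: $\nabla_e^Nu(\frac xN)=N(u(\frac{x+e}N)-u(\frac xN))$. ''$e>0$'' means that the nonzero component of $e$ is $1$. $\Delta^Nu(\frac xN)=N^2\sum_{|e|=1}(u(\frac{x+e}N)-u(\frac xN))$. Discrete norm: $\|u\|_{C^k_N}=\sum_{i=0}^k\sum_{e_1,\dots,e_i}\max_{x}|\nabla^N_{e_1}\cdots\nabla^N_{e_i}u(\frac xN)|$ (sum over unit vectors $|e_j|=1$). Quasilinear setting. $\varphi\in C^5(\mathbb R)$ strictly increasing, $f\in C^1(\mathbb R)$ with $u f(u)<0$ for $|u|$ large, $K>0$. $u_-<u_+$ are constants; $c_-=\min_{[u_-,u_+]}\varphi'$, $c_+=\max_{[u_-,u_+]}\varphi'$, with $c_->0$. For a function $h$ on $\mathbb R$, $\|h\|_\infty=\sup_{[u_-,u_+]}|h|$. Nash exponent. $\sigma\in(0,1)$ denotes a fixed exponent for which there is $C=C(n,c_\pm)$ such that for every $N$, every $a(t)=\{a_{x,e}(t)\}_{x\in\mathbb Z^n,|e|=1}$ continuous in $t$ with $a_{x,e}=a_{x+e,-e}$ and $c_-\le a_{x,e}\le c_+$, and every bounded $u_0$ on $\frac1N\mathbb Z^n$, the bounded solution of $\partial_tu(t,\frac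 xN)=N^2\sum_{|e|=1}a_{x,e}(t)\{u(t,\frac{x+e}N)-u(t,\frac xN)\}$ on $\frac1N\mathbb Z^n$ with $u(0)=u_0$ satisfies $|u(t,\frac xN)-u(s,\frac yN)|\le C\|u_0\|_\infty\big(\frac{|t-s|^{1/2}\vee|\frac xN-\frac yN|}{(t\wedge s)^{1/2}}\big)^\sigma$ for all $t,s>0$, $x,y\in\mathbb Z^n$. Such an exponent exists by the Nash continuity estimate. Norms. $\Omega=[0,T]\times\mathbb T^n$. For $X=(t,z)$, $Y=(s,y)\in\Omega$: $|X-Y|=\max\{|t-s|^{1/2},|z-y|\}$ with $|z-y|$ the Euclidean distance on the torus. For $F$ on $\Omega$, $\nabla^N_eF(t,z)=N(F(t,z+\frac eN)-F(t,z))$, and $|\nabla^NF(X)-\nabla^NF(Y)|=\max_{|e|=1,e>0}|\nabla^N_eF(X)-\nabla_e^NF(Y)|$. The polylinear interpolation in space of a function $u$ on $[0,T]\times\frac1N\mathbb T_N^n$ is $\tilde u(t,z)=\sum_{v\in\{0,1\}^n}\prod_{i=1}^n\vartheta(v_i,z_i)\,u(t,\frac{[Nz]+v}N)$, where $\vartheta(1,b)=\{Nb\}$, $\vartheta(0,b)=1-\{Nb\}$ and $[\cdot],\{\cdot\}$ are (componentwise) integer and fractional parts. Unweighted (semi)norms, $\alpha\in(0,1)$: $[F]_\alpha=\sup_{X\neq Y\in\Omega}\frac{|F(X)-F(Y)|}{|X-Y|^\alpha}$, $[F]_{1+\alpha}=\sup_{X\neq Y\in\Omega}\frac{|\nabla^NF(X)-\nabla^NF(Y)|}{|X-Y|^\alpha}$,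 $\langle F\rangle_{1+\alpha}=\sup_{(t,z)\ne(s,z)\in\Omega}\frac{|F(t,z)-F(s,z)|}{|t-s|^{(1+\alpha)/2}}$, $|F|_0=\sup_\Omega|F|$, and $|F|_{1+\alpha}=[F]_{1+\alpha}+\langle F\rangle_{1+\alpha}+|F|_0$. *)

(* Defs.v *)
From mathcomp Require Import all_boot all_order all_algebra.
From mathcomp Require Import all_classical all_reals all_analysis.
Set Implicit Arguments.
Unset Strict Implicit.
Unset Printing Implicit Defensive.
Import Order.TTheory GRing.Theory Num.Theory.
Import numFieldNormedType.Exports.
Local Open Scope classical_set_scope.
Local Open Scope ring_scope.

(* Conventions.  A function on the discrete torus (Z/NZ)^n (resp. on the torus
   R^n/Z^n) is a function on Z^n = 'rV[int]_n that is N-periodic in every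
   coordinate (resp. a function on 'rV[R]_n that is 1-periodic).  The value
   u(x/N) is written [u x]. *)

(* The 2n vectors e in Z^n with |e| = 1: (i, false) stands for the i-th basis
   vector (the case e > 0) and (i, true) for its opposite. *)
Notation dir n := ('I_n * bool)%type.

Definition dvec (n : nat) (e : dir n) : 'rV[int]_n :=
  (-1) ^+ e.2 *: delta_mx 0 e.1.

Definition dirN (n : nat) (e : dir n) : dir n := (e.1, ~~ e.2).

Definition lattice_periodic (R : realType) (n N : nat) (u : 'rV[int]_n -> R) :=
  forall x k : 'rV[int]_n, u (x + N%:Z *: k) = u x.

Definition lgrad (R : realType) (n N : nat) (e : dir n) (u : 'rV[int]_n -> R) :
    'rV[int]_n -> R :=
  fun x => N%:R * (u (x + dvec e) - u x).

Definition llap (R : realType) (n N : nat) (u : 'rV[int]_n -> R) :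
    'rV[int]_n -> R :=
  fun x => N%:R ^+ 2 * \sum_(e : dir n) (u (x + dvec e) - u x).

(* max of |u| over (Z/NZ)^n, computed on the representatives {0, ..., N-1}^n *)
Definition lmax (R : realType) (n N : nat) (u : 'rV[int]_n -> R) : R :=
  \big[Num.max/0]_(x : {ffun 'I_n -> 'I_N}) `|u (\row_i (x i : nat)%:Z)|.

Definition normCkN (R : realType) (n N k : nat) (u : 'rV[int]_n -> R) : R :=
  \sum_(i < k.+1) \sum_(es : i.-tuple (dir n)) lmax N (foldr (lgrad N) u es).

(* Classical solution of d/dt u(t, x) = G(t, x) on the time interval J:
   continuous on J and differentiable in its interior. *)
Definition solves_on (R : realType) (n : nat) (J : set R)
    (u G : R -> 'rV[int]_n -> R) :=
  forall x : 'rV[int]_n,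
    {within J, continuous (fun t => u t x)} /\
    forall t : R, J° t -> is_derive t 1 (fun s => u s x) (G t x).

Definition enorm (R : realType) (n : nat) (z : 'rV[R]_n) : R :=
  Num.sqrt (\sum_(i < n) z 0 i ^+ 2).

Definition latpt (R : realType) (n N : nat) (x : 'rV[int]_n) : 'rV[R]_n :=
  N%:R^-1 *: map_mx intr x.

Definition nash_coeff (R : realType) (n : nat) (cm cp : R)
    (a : R -> 'rV[int]_n -> dir n -> R) :=
  [/\ forall x e, {within `[0, +oo[, continuous (fun t => a t x e)},
      forall t x e, 0 <= t -> a t x e = a t (x + dvec e) (dirN e) &
      forall t x e, 0 <= t -> cm <= a t x e <= cp].

Definition nash_exponent (R : realType) (n : nat) (cm cp sigma : R) :=
  0 < sigma < 1 /\
  exists C : R,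
    forall (N : nat) (a : R -> 'rV[int]_n -> dir n -> R)
           (u : R -> 'rV[int]_n -> R),
      (0 < N)%N ->
      nash_coeff cm cp a ->
      (exists M : R, forall x, `|u 0 x| <= M) ->
      (exists M : R, forall t x, 0 <= t -> `|u t x| <= M) ->
      solves_on `[0, +oo[ u (fun t x =>
        N%:R ^+ 2 * \sum_(e : dir n) a t x e * (u t (x + dvec e) - u t x)) ->
      forall (t s : R) (x y : 'rV[int]_n), 0 < t -> 0 < s ->
        `|u t x - u s y| <=
          C * sup (range (fun w => `|u 0 w|)) *
          (Num.max (Num.sqrt `|t - s|) (enorm (latpt R N x - latpt R N y)) /
             Num.sqrt (Num.min t s)) `^ sigma.

Section ParabolicNorms.
Variables (R : realType) (n : nat).
Implicit Types (F : R -> 'rV[R]_n -> R) (X Y : R * 'rV[R]_n).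

(* [0, T] x T^n, each point of the torus being given by its representative in
   [0, 1)^n *)
Definition Omega (T : R) : set (R * 'rV[R]_n) :=
  [set X : R * 'rV[R]_n | 0 <= X.1 <= T /\ forall i, 0 <= X.2 0 i < 1].

Definition torus_dist (z y : 'rV[R]_n) : R :=
  inf (range (fun k : 'rV[int]_n => enorm (z - y + map_mx intr k))).

Definition pdist X Y : R :=
  Num.max (Num.sqrt `|X.1 - Y.1|) (torus_dist X.2 Y.2).

Definition grad (N : nat) (e : dir n) F : R -> 'rV[R]_n -> R :=
  fun t z => N%:R * (F t (z + latpt R N (dvec e)) - F t z).

Definition grad_diff (N : nat) F X Y : R :=
  \big[Num.max/0]_(i < n)
    `|grad N (i, false) F X.1 X.2 - grad N (i, false) F Y.1 Y.2|.

(* In order: [F]_alpha, [F]_{1+alpha}, <F>_{1+alpha}, |F|_0, |F|_{1+alpha}.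
   They take values in \bar R, so that a bound on them entails finiteness. *)
Definition holder (T alpha : R) F : \bar R :=
  ereal_sup [set r | exists X Y, [/\ Omega T X, Omega T Y, X <> Y &
    r = (`|F X.1 X.2 - F Y.1 Y.2| / pdist X Y `^ alpha)%:E]].

Definition holder1 (T : R) (N : nat) (alpha : R) F : \bar R :=
  ereal_sup [set r | exists X Y, [/\ Omega T X, Omega T Y, X <> Y &
    r = (grad_diff N F X Y / pdist X Y `^ alpha)%:E]].

Definition time_holder1 (T alpha : R) F : \bar R :=
  ereal_sup [set r | exists t s z,
    [/\ Omega T (t, z), Omega T (s, z), t <> s &
    r = (`|F t z - F s z| / `|t - s| `^ ((1 + alpha) / 2))%:E]].

Definition norm0 (T : R) F : \bar R :=
  ereal_sup [set (`|F X.1 X.2|)%:E | X in Omega T].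

Definition par_norm1 (T : R) (N : nat) (alpha : R) F : \bar R :=
  (holder1 T N alpha F + time_holder1 T alpha F + norm0 T F)%E.

Definition theta (N : nat) (v : bool) (b : R) : R :=
  let frac := N%:R * b - (Num.floor (N%:R * b))%:~R in
  if v then frac else 1 - frac.

Definition interp (N : nat) (u : R -> 'rV[int]_n -> R) : R -> 'rV[R]_n -> R :=
  fun t z => \sum_(v : {ffun 'I_n -> bool})
    (\prod_(i < n) theta N (v i) (z 0 i)) *
    u t (\row_i (Num.floor (N%:R * z 0 i) + (v i : nat)%:Z)).

End ParabolicNorms.

Definition Ck (R : realType) (k : nat) (g : R -> R) :=
  (forall (j : nat) (x : R), (j < k)%N -> derivable (derive1n j g) x 1) /\
  continuous (derive1n k g).

Definition is_min (R : realType) (A : set R) (m : R) := A m /\ lbound A m.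
Definition is_max (R : realType) (A : set R) (m : R) := A m /\ ubound A m.

Definition supnorm (R : realType) (a b : R) (h : R -> R) : R :=
  sup [set `|h v| | v in `[a, b]].

(* Main.v *)
(* Write M = K + C0 + 1.  The divided differences of phi along u put the
   equation in divergence form with coefficients in [c-, c+], and Duhamel's
   formula for the backward transition densities carries the Nash estimate over
   to equations with a source; u is prolonged by u(0) to t < 0, so that the
   estimate holds up to t = 0.  This gives |u(X) - u(Y)| <= C M |X - Y|^sigma.

   Next, the coefficient phi'(u) is frozen at a point and the frozen heat
   semigroup is applied.  Its gradients obey weighted bounds, obtained by
   iterating Bernstein's inequality, so that over a time h
     |grad u| <= C (C0 + h^(-1/2) + (M sup |grad u| + K) h^(sigma/2)),
   and h of order M^(-2/sigma) gives |grad u| <= C M^(1/sigma).  The source term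
   is now bounded by C M^(1 + 1/sigma), and comparing the frozen representations
   at two points gives the Hölder bounds for grad u and for u in time.

   Polylinear interpolation commutes with lattice translations, hence with
   discrete gradients, and preserves Hölder bounds up to a factor. *)

Require Import Defs.
From mathcomp Require Import all_boot all_order all_algebra.
From mathcomp Require Import all_classical all_reals all_analysis.
From mathcomp Require Import ring lra.
Set Implicit Arguments.
Unset Strict Implicit.
Unset Printing Implicit Defensive.
Import Order.TTheory GRing.Theory Num.Theory.
Import numFieldNormedType.Exports.
Local Open Scope classical_set_scope.
Local Open Scope ring_scope.

(** * Calculus and linear systems *)

(** No constant may depend on [N]. The estimates are therefore proved on an abstract finite abelian
    group, where only the number of directions and a bound [Cq] for the Laplacian of a squared
    distance [q] enter. Gaussian bounds for the heat kernel are avoided: its spread is known only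
    through the mean [heat t q 0 <= Cq * t], which by concavity controls every Hölder weight.
    Parabolic scaling stops at the time [eta = N^-2], hence the sums [t + eta]. Prolonging [u] to
    [t < 0] creates the source [- flap (phi \o u 0)]. By the chain rule it contains the square of
    the initial gradient, naively of size [M^2], which would ruin the linear dependence on [M] of
    the Hölder constant and so the final exponent. Interpolating between the bounds on [u 0] and on
    its Laplacian gives the square a bound linear in [M]. After freezing, [k] differences of the
    source at elapsed time [r] have size [r^((sigma-1-k)/2)], integrable at [0] for [k <= 1] but not
    for [k = 2]. To compare gradients at distance [rho], times are thus split at [r = rho^2]: two
    frozen representations below it, a single one with an additional difference above it. *)

Section Calculus.
Variable R : realType.
Implicit Types (f g h k : R -> R) (a b t : R).

Lemma is_derive_addf f g t df dg : is_derive t 1 f df -> is_derive t 1 g dg ->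
  is_derive t 1 (fun s => f s + g s) (df + dg).
Proof. by move=> *; exact: is_deriveD. Qed.

Lemma is_derive_oppf f t df : is_derive t 1 f df ->
  is_derive t 1 (fun s => - f s) (- df).
Proof. by move=> *; exact: is_deriveN. Qed.

Lemma is_derive_subf f g t df dg : is_derive t 1 f df -> is_derive t 1 g dg ->
  is_derive t 1 (fun s => f s - g s) (df - dg).
Proof. by move=> *; exact: is_deriveB. Qed.

Lemma is_derive_mulf f g t df dg : is_derive t 1 f df -> is_derive t 1 g dg ->
  is_derive t 1 (fun s => f s * g s) (df * g t + f t * dg).
Proof.
move=> Df Dg; have D := is_deriveM Df Dg.
by apply: (is_derive_eq D); rewrite addrC; congr (_ + _); rewrite mulrC.
Qed.

Lemma is_derive_cstf (c t : R) : is_derive t 1 (fun=> c : R) (0 : R).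
Proof. exact: is_derive_cst. Qed.

Lemma is_derive_cmulf (c : R) f t df : is_derive t 1 f df ->
  is_derive t 1 (fun s => c * f s) (c * df).
Proof.
move=> Df; have D := is_derive_mulf (is_derive_cstf c t) Df.
by apply: (is_derive_eq D); rewrite mul0r add0r.
Qed.

Lemma is_derive_sumf (I : Type) (r : seq I) (P : pred I) (f df : I -> R -> R) t :
  (forall i, is_derive t 1 (f i) (df i t)) ->
  is_derive t 1 (fun s => \sum_(i <- r | P i) f i s)
    (\sum_(i <- r | P i) df i t).
Proof.
move=> D; elim: r => [|i r IH].
  rewrite big_nil (_ : (fun _ => _) = (fun=> 0)); first exact: is_derive_cstf.
  by apply/funext => s; rewrite big_nil.
rewrite big_cons (_ : (fun _ => _) =
  (fun s => if P i then f i s + \sum_(j <- r | P j) f j s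
    else \sum_(j <- r | P j) f j s)); last by apply/funext => s; rewrite big_cons.
by case: (P i) => //; exact: is_derive_addf.
Qed.

Lemma is_derive_affine (c t0 t : R) : is_derive t 1 (fun s => c * s + t0) c.
Proof.
have := is_derive_addf (is_derive_cmulf c (is_derive_id t (1:R)))
  (is_derive_cstf t0 t).
by rewrite addr0 mulr1.
Qed.

Lemma is_derive_compf f g t df dg : is_derive (g t) 1 f df ->
  is_derive t 1 g dg -> is_derive t 1 (fun s => f (g s)) (df * dg).
Proof. by move=> Df Dg; exact: is_derive1_comp. Qed.

Lemma is_derive_comp_affine f (c t0 t df : R) : is_derive (c * t + t0) 1 f df ->
  is_derive t 1 (fun s => f (c * s + t0)) (c * df).
Proof.
by move=> D; rewrite mulrC; apply: is_derive_compf => //; exact: is_derive_affine.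
Qed.

Lemma is_derive_continuous f t df : is_derive t 1 f df -> {for t, continuous f}.
Proof.
by move=> D; apply/differentiable_continuous/derivable1_diffP/ex_derive.
Qed.

Lemma continuous_sumf (T : topologicalType) (I : Type) (r : seq I) (P : pred I)
    (f : I -> T -> R) (x : T) :
  (forall i, {for x, continuous (f i)}) ->
  {for x, continuous (fun s => \sum_(i <- r | P i) f i s)}.
Proof.
move=> D; elim: r => [|i r IH].
  rewrite (_ : (fun _ => _) = (fun=> 0)); first exact: cst_continuous.
  by apply/funext => s; rewrite big_nil.
rewrite (_ : (fun _ => _) =
  (fun s => if P i then f i s + \sum_(j <- r | P j) f j s
    else \sum_(j <- r | P j) f j s)); last by apply/funext => s; rewrite big_cons.
by case: (P i) => //; apply: continuousD; [exact: D|exact: IH].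
Qed.

(** The mean value theorem for [k - h]. Duhamel integrals are never formed: the derivative of the
    quantity to be bounded is compared with that of an explicit [k]. *)
Lemma le_increment h k (dh dk : R -> R) a b : a <= b ->
  {within `[a, b], continuous h} -> {within `[a, b], continuous k} ->
  (forall t, a < t < b -> is_derive t 1 h (dh t)) ->
  (forall t, a < t < b -> is_derive t 1 k (dk t)) ->
  (forall t, a < t < b -> dh t <= dk t) ->
  h b - h a <= k b - k a.
Proof.
move=> ab ch ck Dh Dk le.
have [->|ab'] := eqVneq b a; first by rewrite !subrr.
have [|||c cab E] := @MVT R (fun t => k t - h t) (fun t => dk t - dh t) a b.
- by rewrite lt_neqAle eq_sym ab'.
- by move=> x xab; apply: is_derive_subf; [exact: Dk|exact: Dh].
- by move=> x; apply: cvgB; [exact: ck|exact: ch].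
suff : 0 <= (k b - h b) - (k a - h a) by lra.
by rewrite E mulr_ge0 ?subr_ge0// le.
Qed.

Lemma dominated_increment h k (dh dk : R -> R) a b : a <= b ->
  {within `[a, b], continuous h} -> {within `[a, b], continuous k} ->
  (forall t, a < t < b -> is_derive t 1 h (dh t)) ->
  (forall t, a < t < b -> is_derive t 1 k (dk t)) ->
  (forall t, a < t < b -> `|dh t| <= dk t) ->
  `|h b - h a| <= k b - k a.
Proof.
move=> ab ch ck Dh Dk le; rewrite ler_norml; apply/andP; split; last first.
  by apply: (le_increment ab ch ck Dh Dk) => t /le; exact: le_trans (ler_norm _).
suff : - h b - - h a <= k b - k a by lra.
apply: (@le_increment (fun t => - h t) k (fun t => - dh t) dk a b ab _ ck _ Dk).
- by move=> x; apply: cvgN; exact: ch.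
- by move=> t /Dh; exact: is_derive_oppf.
- by move=> t /le; apply: le_trans; rewrite -normrN ler_norm.
Qed.

Lemma within_continuous_powR (p a b : R) : 0 < p -> 0 <= a ->
  {within `[a, b], continuous (fun t : R => t `^ p)}.
Proof.
move=> p0 a0; have [ba|ab|<-] := ltgtP b a; last 2 first.
- have ct (t : R) : 0 < t -> {for t, continuous (fun t : R => t `^ p)}.
    by move=> t0; apply: is_derive_continuous; exact: is_derive1_powR.
  apply/(continuous_within_itvP _ ab); split.
  + by move=> t; rewrite in_itv/= => /andP[/(le_lt_trans a0)+ _]; exact: ct.
  + have [->|a1] := eqVneq a 0; first by rewrite powR0 ?gt_eqF//; exact: powR_cvg0.
    by apply: cvg_at_right_filter; apply: ct; rewrite lt_neqAle eq_sym a1.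
  + by apply: cvg_at_left_filter; apply: ct; exact: le_lt_trans ab.
- by rewrite set_itv1; exact: continuous_subspace1.
- by rewrite set_itv_ge -?ltNge//; exact: continuous_subspace0.
Qed.

(** Meant for [a = 0] and [p < 1]: the derivative may blow up at the endpoint, where continuity
    alone is required. *)
Lemma powR_increment h (dh : R -> R) (B p a b : R) : 0 <= a -> a <= b -> 0 < p -> 0 <= B ->
  {within `[a, b], continuous h} ->
  (forall t, a < t < b -> is_derive t 1 h (dh t)) ->
  (forall t, a < t < b -> `|dh t| <= B * t `^ (p - 1)) ->
  `|h b - h a| <= B / p * b `^ p.
Proof.
move=> a0 ab p0 B0 ch Dh le.
have : p * (B / p) = B by rewrite mulrCA divff ?mulr1// gt_eqF.
have : 0 <= B / p by rewrite divr_ge0// ltW.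
move: (B / p) => c c0 pc.
apply: (@le_trans _ _ (c * b `^ p - c * a `^ p)); last first.
  by rewrite gerBl mulr_ge0 ?powR_ge0.
apply: (@dominated_increment h (fun t => c * t `^ p) dh
    (fun t => B * t `^ (p - 1)) _ _ ab ch _ Dh _ le).
- by move=> x; apply: cvgM; [exact: cvg_cst|exact: within_continuous_powR].
- move=> t /andP[/(le_lt_trans a0) t0 _].
  apply: (is_derive_eq (is_derive_cmulf _ (is_derive1_powR p t0))).
  by rewrite -pc mulrCA mulrA.
Qed.

(** Counterpart for a singularity that is not integrable at [0]: the bound depends on the lower
    endpoint only, uniformly in [b]. *)
Lemma powRN_increment h (dh : R -> R) (B p a b : R) : 0 < a -> a <= b -> 0 < p -> 0 <= B ->
  {within `[a, b], continuous h} ->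
  (forall t, a < t < b -> is_derive t 1 h (dh t)) ->
  (forall t, a < t < b -> `|dh t| <= B * t `^ (- p - 1)) ->
  `|h b - h a| <= B / p * a `^ (- p).
Proof.
move=> a0 ab p0 B0 ch Dh le.
have : p * (B / p) = B by rewrite mulrCA divff ?mulr1// gt_eqF.
have : 0 <= B / p by rewrite divr_ge0// ltW.
move: (B / p) => c c0 pc.
apply: (@le_trans _ _ (- c * b `^ (- p) - - c * a `^ (- p))); last first.
  by rewrite !mulNr opprK gerDr oppr_le0 mulr_ge0 ?powR_ge0.
have D (t : R) : 0 < t ->
    is_derive t 1 (fun t : R => - c * t `^ (- p)) (B * t `^ (- p - 1)).
  move=> t0; apply: (is_derive_eq (is_derive_cmulf _ (is_derive1_powR _ t0))).
  by rewrite mulrA mulrNN -pc [c * p]mulrC.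
apply: (@dominated_increment h (fun t => - c * t `^ (- p)) dh
    (fun t => B * t `^ (- p - 1)) _ _ ab ch _ Dh _ le).
- apply: continuous_in_subspaceT => t; rewrite inE/= in_itv/= => /andP[at_ _].
  exact: is_derive_continuous (D _ (lt_le_trans a0 at_)).
- by move=> t /andP[at_ _]; apply: D; exact: lt_trans at_.
Qed.

End Calculus.

Section Clamp.
Variable R : realType.

(** Composition with it prolongs a function on [[a, b]] by its end values, which keeps both its
    continuity and its range. *)
Definition clamp (a b t : R) : R := Num.max a (Num.min t b).

Lemma clamp_itv (a b t : R) : a <= b -> a <= clamp a b t <= b.
Proof. by move=> ab; rewrite /clamp le_max lexx/= ge_max ab ge_min lexx orbT. Qed.

Lemma clamp_id (a b t : R) : a <= t <= b -> clamp a b t = t.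
Proof. by move=> /andP[at_ tb]; rewrite /clamp min_l// max_r. Qed.

Lemma continuous_clamp (a b : R) : continuous (clamp a b).
Proof.
rewrite /clamp => t; apply: (continuous_max (f := fun=> a) (g := fun t => Num.min t b)).
  exact: cst_continuous.
by apply: (continuous_min (f := id) (g := fun=> b)); [exact: cvg_id|exact: cst_continuous].
Qed.

Lemma continuous_comp_within (A : set R) (f c : R -> R) :
  {within A, continuous f} -> continuous c -> (forall t, A (c t)) ->
  continuous (fun t => f (c t)).
Proof.
move=> /subspace_continuousP cf cc Ac t.
move=> P /(cf _ (Ac t)) H; have := cc t _ H; apply: (@filterS _ (nbhs t)) => s /=; apply; exact: Ac.
Qed.

Lemma continuous_comp_clamp (a b : R) (f : R -> R) : a <= b ->
  {within `[a, b], continuous f} -> continuous (fun t => f (clamp a b t)).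
Proof.
move=> ab cf; apply: continuous_comp_within cf (@continuous_clamp a b) _ => t.
by rewrite /= in_itv/= clamp_itv.
Qed.

Notation mu := (@lebesgue_measure R).

(** The primitive is set to [0] for [t <= 0]: it is continuous on the whole line but may have a
    corner at [0]. For this reason derivatives are asserted for [t > 0] only, here and in what is
    built on it. *)
Lemma primitive_exists (f : R -> R) : continuous f ->
  exists F : R -> R, [/\ forall t : R, t <= 0 -> F t = 0, continuous F &
    forall t : R, 0 < t -> is_derive t 1 F (f t)].
Proof.
move=> cf; pose F (x : R) : R := (\int[mu]_(t in `[0%R, x]) f t)%R.
have cI (b : R) : mu.-integrable `[0, b] (EFin \o f).
  apply: continuous_compact_integrable; first exact: segment_compact.
  exact: continuous_subspaceT.
have F0 : F 0 = 0 by rewrite /F set_itv1 Rintegral_set1.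
have DF (t : R) : 0 < t -> is_derive t 1 F (f t).
  move=> t0; have tt1 : t < t + 1 by rewrite ltrDl.
  have [DF E] := @continuous_FTC1_closed R f 0 t (t + 1) tt1 (cI _) t0 (cf t).
  by split; [exact: DF|rewrite -derive1E E].
have Fm (t : R) : t <= 0 -> F t = 0.
  rewrite le_eqVlt => /predU1P[->//|t0].
  by rewrite /F set_itv_ge ?Rintegral_set0// -ltNge.
exists F; split => // t; have [t0|t0] := ltP t 1; last first.
  by apply: is_derive_continuous; apply: DF; rewrite (lt_le_trans _ t0).
have cF : {within `[0, 1], continuous F}.
  exact: (@parameterized_integral_continuous R 0 1 f ler01 (cI 1)).
have E : F (clamp 0 1 t) = F t.
  rewrite /clamp min_l ?(ltW t0)//; have [//|t1] := leP 0 t.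
  by rewrite F0 Fm// ltW.
have : {for t, continuous (fun t => F (clamp 0 1 t))}.
  exact: (continuous_comp_clamp ler01 cF).
rewrite /prop_for /continuous_at E; apply: cvg_trans.
apply: near_eq_cvg; near=> s.
have s1 : s <= 1 by apply: ltW; near: s; exact: lt_nbhsl.
rewrite /clamp min_l//; have [//|t1] := leP 0 s.
by rewrite F0 Fm// ltW.
Unshelve. all: by end_near. Qed.

(** The intervals with ends [w k] and [v k] are nested. The limit is the supremum of the left ends,
    and the error is at most the radius of the interval. *)
Lemma geometric_limit (u : nat -> R) (B : R) :
  (forall k, `|u k.+1 - u k| <= B * 2^-1 ^+ k) ->
  exists l, forall k, `|l - u k| <= 2 * B * 2^-1 ^+ k.
Proof.
move=> le; pose w k := u k - 2 * B * 2^-1 ^+ k; pose v k := u k + 2 * B * 2^-1 ^+ k.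
have wS k : w k <= w k.+1.
  by have := le k; rewrite ler_norml /w exprS => /andP[]; lra.
have vS k : v k.+1 <= v k.
  by have := le k; rewrite ler_norml /v exprS => /andP[]; lra.
have wv0 k : w k <= v k.
  have : 0 <= B * 2^-1 ^+ k by apply: le_trans (le k).
  by rewrite /w /v; lra.
have wD k j : w k <= w (k + j)%N.
  by elim: j => [|j IH]; [rewrite addn0|rewrite addnS (le_trans IH)].
have vD k j : v (k + j)%N <= v k.
  by elim: j => [|j IH]; [rewrite addn0|rewrite addnS (le_trans _ IH)].
have wv j k : w j <= v k.
  by rewrite (le_trans (wD j k))// (le_trans (wv0 _))// addnC vD.
exists (sup (range w)) => k; rewrite ler_distl; apply/andP; split.
  apply: ub_le_sup; last by exists k.
  by exists (v 0%N) => _ [j _ <-].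
by apply: ge_sup; [exists (w 0%N), 0%N|move=> _ [j _ <-]; exact: wv].
Qed.

Lemma continuous_approx (f : R -> R) (t : R) :
  (forall e, 0 < e -> exists g : R -> R, {for t, continuous g} /\
    \forall s \near t, `|f s - g s| <= e) -> {for t, continuous f}.
Proof.
move=> H; apply/cvgrPdist_le => e e0.
have [|g [/cvgrPdist_le cg fg]] := H (e / 3); first by rewrite divr_gt0.
have ft := nbhs_singleton fg.
near=> s; have -> : f t - f s = (f t - g t) + (g t - g s) - (f s - g s) by ring.
have -> : e = e / 3 + e / 3 + e / 3 by field.
apply: (le_trans (ler_normB _ _)); apply: lerD; last by near: s.
apply: (le_trans (ler_normD _ _)); apply: lerD => //.
by near: s; apply: cg; rewrite divr_gt0.
Unshelve. all: by end_near. Qed.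

(* Picard iteration, contracting for the weight [expR (- lam * `|t|)] *)
Lemma linear_ode (I : finType) (A : R -> I -> I -> R) (L : R) (y0 : I -> R) :
  0 <= L -> (forall i j, continuous (fun t => A t i j)) ->
  (forall t i j, `|A t i j| <= L) ->
  exists y : R -> I -> R, [/\ forall i, y 0 i = y0 i,
    forall i, continuous (y^~ i) &
    forall (t : R) i, 0 < t -> is_derive t 1 (y^~ i) (\sum_j A t i j * y t j)].
Proof.
move=> L0 cA bA.
pose m : R := #|I|%:R; have m0 : 0 <= m by exact: ler0n.
(* As [m * L <= lam / 2], one Picard step halves the weighted distance. *)
pose lam := 2 * (m * L) + 1.
have lam0 : 0 < lam by rewrite /lam ltr_wpDl// !mulr_ge0.
pose Y := \sum_i `|y0 i|.
have Y0 : 0 <= Y by apply: sumr_ge0 => i _.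
have sumA (z : I -> R) (t B : R) (i : I) : (forall j, `|z j| <= B) ->
    `|\sum_j A t i j * z j| <= m * L * B.
  move=> zB; apply: (le_trans (ler_norm_sum _ _ _)).
  apply: (@le_trans _ _ (\sum_(j : I) L * B)).
    by apply: ler_sum => j _; rewrite normrM ler_pM.
  by rewrite sumr_const -mulrA mulr_natl.
have cAz (z : R -> I -> R) i : (forall j, continuous (z^~ j)) ->
    continuous (fun t => \sum_j A t i j * z t j).
  by move=> cz t; apply: continuous_sumf => j; apply: continuousM; [exact: cA|exact: cz].
(* Iteration needs a total map, so the continuity of [z] is a premise under the existential; a
   discontinuous [z] is sent to itself. *)
have stepP (z : R -> I -> R) : exists z' : R -> I -> R,
    (forall j, continuous (z^~ j)) ->
    [/\ forall (t : R) i, t <= 0 -> z' t i = y0 i, forall i, continuous (z'^~ i) &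
     forall (t : R) i, 0 < t -> is_derive t 1 (z'^~ i) (\sum_j A t i j * z t j)].
  have [cz|ncz] := pselect (forall j, continuous (z^~ j)); last by exists z.
  have F i := cid (primitive_exists (cAz z i cz)).
  exists (fun t i => y0 i + projT1 (F i) t) => _; split.
  - by move=> t i t0; have [F0 _ _] := projT2 (F i); rewrite F0// addr0.
  - move=> i t; have [_ cF _] := projT2 (F i).
    by apply: continuousD; [exact: cst_continuous|exact: cF].
  - move=> t i t0; have [_ _ dF] := projT2 (F i).
    by have := is_derive_addf (is_derive_cstf (y0 i) t) (dF t t0); rewrite add0r.
pose step z := projT1 (cid (stepP z)).
have stepE z := projT2 (cid (stepP z)).
pose y_ k := iter k step (fun _ i => y0 i).
have cy k : forall i, continuous (y_ k ^~ i).
  elim: k => [|k IH] i; first by move=> t; exact: cst_continuous.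
  by have [_ c _] := stepE (y_ k) IH; exact: c.
have yS k : [/\ forall (t : R) i, t <= 0 -> y_ k.+1 t i = y0 i,
    forall i, continuous (y_ k.+1 ^~ i) &
    forall (t : R) i, 0 < t ->
      is_derive t 1 (y_ k.+1 ^~ i) (\sum_j A t i j * y_ k t j)].
  exact: stepE (y_ k) (cy k).
have y0E k (t : R) i : t <= 0 -> y_ k t i = y0 i.
  by case: k => [//|k] t0; have [-> //] := yS k.
pose E (t : R) := expR (lam * `|t|).
have E1 (t : R) : 1 <= E t by rewrite /E -expR0 ler_expR mulr_ge0// ltW.
have incr (g : R -> R) (dg : R -> R) (B t : R) : continuous g -> 0 <= B -> 0 < t ->
    (forall s : R, 0 < s -> is_derive s 1 g (dg s)) ->
    (forall s : R, 0 < s -> `|dg s| <= lam * B * expR (lam * s)) ->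
    `|g t - g 0| <= B * E t.
  move=> cg B0 t0 Dg le.
  have De (s : R) : is_derive s 1 (fun s => B * expR (lam * s + 0)) (lam * B * expR (lam * s)).
    have := is_derive_cmulf B (@is_derive_comp_affine R expR lam 0 s _ (is_derive_expR _)).
    by rewrite addr0 mulrA [B * lam]mulrC.
  have := @dominated_increment R g (fun s => B * expR (lam * s + 0)) dg
    (fun s => lam * B * expR (lam * s)) 0 t (ltW t0) (continuous_subspaceT cg).
  rewrite mulr0 addr0 addr0 expR0 mulr1 /E (gtr0_norm t0) => H.
  apply: (le_trans (H _ _ _ _)); last by rewrite gerBl.
  - by apply: continuous_subspaceT => s; exact: is_derive_continuous (De s).
  - by move=> s /andP[s0 _]; exact: Dg.
  - by move=> s /andP[s0 _]; exact: le.
have ydiff k : forall (t : R) i, `|y_ k.+1 t i - y_ k t i| <= Y * E t * 2^-1 ^+ k.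
  have yY j : `|y0 j| <= Y by rewrite /Y (bigD1 j)//= lerDl sumr_ge0.
  elim: k => [|k IH] t i.
    rewrite expr0 mulr1; have [t0|t0] := leP t 0.
      by rewrite !y0E// subrr normr0 mulr_ge0// (le_trans _ (E1 t)).
    have [z1 z2 z3] := yS 0%N.
    have -> : y_ 1%N t i - y_ 0%N t i = y_ 1%N t i - y_ 1%N 0 i by rewrite (z1 0).
    apply: (incr (fun s => y_ 1%N s i) (fun s => \sum_j A s i j * y0 j) Y t (z2 i) Y0 t0).
    move=> s s0 /=; apply: (le_trans (sumA _ _ Y _ _)); first by [].
    apply: (@le_trans _ _ (lam * Y)).
      by rewrite ler_wpM2r// /lam; have mL : 0 <= m * L := mulr_ge0 m0 L0; lra.
    by rewrite ler_peMr ?mulr_ge0 ?(ltW lam0)// -expR0 ler_expR mulr_ge0 ?ltW.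
  have [t0|t0] := leP t 0.
    by rewrite !y0E// subrr normr0 !mulr_ge0 ?exprn_ge0// (le_trans _ (E1 t)).
  have [z1 z2 z3] := yS k; have [w1 w2 w3] := yS k.+1.
  have -> : y_ k.+2 t i - y_ k.+1 t i =
      (y_ k.+2 t i - y_ k.+1 t i) - (y_ k.+2 0 i - y_ k.+1 0 i).
    by rewrite !(y0E _ 0)// subrr subr0.
  rewrite mulrAC; apply: (incr (fun s => y_ k.+2 s i - y_ k.+1 s i)
    (fun s => \sum_j A s i j * (y_ k.+1 s j - y_ k s j))) t0 _ _.
  - by move=> s; apply: continuousB; [exact: w2|exact: z2].
  - by rewrite mulr_ge0// exprn_ge0.
  - move=> s s0; apply: is_derive_eq (is_derive_subf (w3 s i s0) (z3 s i s0)) _.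
    by rewrite -sumrB; apply: eq_bigr => j _; rewrite mulrBr.
  - move=> s s0; apply: (le_trans (sumA _ _ _ _ (IH s))).
    rewrite /E (gtr0_norm s0) exprS.
    have -> : lam * (Y * (2^-1 * 2^-1 ^+ k)) * expR (lam * s) =
      (lam / 2) * (Y * expR (lam * s) * 2^-1 ^+ k) by ring.
    rewrite ler_wpM2r ?mulr_ge0 ?expR_ge0 ?exprn_ge0//.
    by rewrite /lam; lra.
have lim t i := cid (geometric_limit (fun k => ydiff k t i)).
pose y t i := projT1 (lim t i).
have ylim t i k : `|y t i - y_ k t i| <= 2 * (Y * E t) * 2^-1 ^+ k by exact: (projT2 (lim t i)).
have small (B e : R) : 0 < e -> exists k, B * 2^-1 ^+ k <= e.
  move=> e0; exists (Num.bound (B / e)).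
  rewrite exprVn ler_pdivrMr ?exprn_gt0// mulrC -ler_pdivrMr//.
  by apply: ltW; exact: upper_nthrootP.
have zero (x B : R) : (forall k, `|x| <= B * 2^-1 ^+ k) -> x = 0.
  move=> H; apply/eqP; rewrite -normr_le0; apply/ler_addgt0Pl => e e0.
  by rewrite addr0; have [k] := small B e e0; exact: le_trans.
have cyl i : continuous (y^~ i).
  move=> t; apply: continuous_approx => e e0.
  have [k ke] := small (2 * (Y * E (`|t| + 1))) e e0.
  exists (y_ k ^~ i); split; first exact: cy.
  near=> s; apply: (le_trans (ylim s i k)); apply: le_trans ke.
  rewrite ler_wpM2r ?exprn_ge0// ler_wpM2l// ler_wpM2l// ler_expR ler_wpM2l ?(ltW lam0)//.
  rewrite [leRHS]ger0_norm ?addr_ge0//.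
  rewrite -[s](subrK t) (le_trans (ler_normD _ _))// addrC lerD2l.
  by rewrite distrC; near: s; exists 1 => //= r /ltW.
have yE0 (t : R) i : t <= 0 -> y t i = y0 i.
  move=> t0; apply/eqP; rewrite -subr_eq0; apply/eqP.
  by apply: (zero _ (2 * (Y * E t))) => k; rewrite -(y0E k t i t0).
(* The limit [y] is so far only continuous. Its Picard image [z] is differentiable, and [z = y]
   because both lie within a geometric error of [y_ k.+1] for every [k]. *)
have [z1 z2 z3] := projT2 (cid (stepP y)) cyl; set z := projT1 _ in z1 z2 z3.
have zy (t : R) i : 0 < t -> y t i = z t i.
  move=> t0; apply/eqP; rewrite -subr_eq0; apply/eqP.
  apply: (zero _ (2 * (Y * E t))) => k.
  rewrite -(subrK (y_ k.+1 t i) (y t i)) -addrA.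
  rewrite (le_trans (ler_normD _ _))//.
  have [w1 w2 w3] := yS k.
  have : `|y_ k.+1 t i - z t i| <= (Y * 2^-1 ^+ k) * E t.
    have -> : y_ k.+1 t i - z t i =
        (y_ k.+1 t i - z t i) - (y_ k.+1 0 i - z 0 i).
      by rewrite (z1 0)// (y0E _ 0)// subrr subr0.
    apply: (incr (fun s => y_ k.+1 s i - z s i)
      (fun s => \sum_j A s i j * (y_ k s j - y s j))) t0 _ _.
    - by move=> s; apply: continuousB; [exact: w2|exact: z2].
    - by rewrite mulr_ge0// exprn_ge0.
    - move=> s s0; apply: is_derive_eq (is_derive_subf (w3 s i s0) (z3 s i s0)) _.
      by rewrite -sumrB; apply: eq_bigr => j _; rewrite mulrBr.
    - move=> s s0; apply: (le_trans (sumA _ s (2 * (Y * E s) * 2^-1 ^+ k) _ _)).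
        by move=> j; rewrite distrC.
      rewrite /E (gtr0_norm s0).
      have -> : lam * (Y * 2^-1 ^+ k) * expR (lam * s) =
        lam * (Y * expR (lam * s) * 2^-1 ^+ k) by ring.
      rewrite -!mulrA [_ * (2 * _)]mulrCA mulrA (mulrA m) mulrA.
      rewrite ler_wpM2r ?mulr_ge0 ?expR_ge0 ?exprn_ge0//.
      by rewrite /lam; lra.
  have := ylim t i k.+1; rewrite exprS; lra.
exists y; split => // [i|t i t0]; first exact: yE0.
have -> : y^~ i = z^~ i.
  by apply/funext => s; have [s0|s0] := leP s 0; [rewrite yE0// z1|exact: zy].
apply: is_derive_eq (z3 t i t0) _.
done.
Unshelve. all: by end_near. Qed.

End Clamp.

(** * A parabolic maximum principle on a finite weighted graph *)

Section MaximumPrinciple.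
Variables (R : realType) (G D : finType) (nb : G -> D -> G).

(* At an interior positive maximum of [(t2 - t) * v] the time derivative
   [- v + (t2 - t) * dv] is negative. *)
Lemma maximum_principle (a : R -> G -> D -> R) (v dv : R -> G -> R) :
  (forall x, continuous (v^~ x)) ->
  (forall (t : R) x, 0 < t -> is_derive t 1 (v^~ x) (dv t x)) ->
  (forall (t : R) x, 0 < t -> dv t x <= \sum_e a t x e * (v t (nb x e) - v t x)) ->
  (forall (t : R) x e, 0 < t -> 0 <= a t x e) ->
  (forall x, v 0 x <= 0) ->
  forall (t : R) x, 0 <= t -> v t x <= 0.
Proof.
move=> cv Dv le a0 v0 t1 x1; rewrite le_eqVlt => /predU1P[<-//|t10].
rewrite leNgt; apply/negP => v1.
(* The factor [t2 - t] vanishes at the right end and [v] is nonpositive at [0], so a positive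
   maximum over [[0, t2]] is interior. *)
pose t2 := t1 + 1; have t20 : 0 < t2 by rewrite addr_gt0.
pose w x t := (t2 - t) * v t x.
have Dw x (t : R) : 0 < t -> is_derive t 1 (w x) (- v t x + (t2 - t) * dv t x).
  move=> t0; have D1 : is_derive t 1 (fun s => t2 - s) (- 1).
    apply: is_derive_eq (is_derive_subf (is_derive_cstf t2 t) (is_derive_id t (1 : R))) _.
    by rewrite sub0r.
  apply: is_derive_eq (is_derive_mulf D1 (Dv t x t0)) _.
  by rewrite mulN1r.
have cw x : {within `[0, t2], continuous (w x)}.
  rewrite /w; apply: continuous_subspaceT => t; apply: cvgM; last exact: cv.
  by apply: cvgB; [exact: cvg_cst|exact: cvg_id].
have mx x := cid2 (EVT_max (ltW t20) (cw x)).
pose c x := projT1 (mx x).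
have c02 x : 0 <= c x <= t2.
  by have := s2valP (mx x); rewrite in_itv/=.
have cmax x t : 0 <= t <= t2 -> w x t <= w x (c x).
  by move=> t02; apply: (s2valP' (mx x)); rewrite in_itv/=.
have [y _ ymax] := @arg_maxP _ R G x1 xpredT (fun x => w x (c x)) isT.
set t := c y in ymax.
have wm x s : 0 <= s <= t2 -> w x s <= w y t.
  by move=> s02; exact: le_trans (cmax x s s02) (ymax x isT).
have wpos : 0 < w y t.
  apply: lt_le_trans (wm x1 t1 _); last by rewrite (ltW t10)/= lerDl.
  by rewrite /w /t2 addrAC subrr add0r mul1r.
have /andP[t0 tt2] : 0 < t < t2.
  have /andP[c0 c2] := c02 y; rewrite !lt_neqAle c0 c2 !andbT; apply/andP; split.
    apply: contraTneq wpos => <-; rewrite -leNgt /w subr0.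
    by rewrite mulr_ge0_le0// ltW.
  by apply: contraTneq wpos => ->; rewrite /w subrr mul0r ltxx.
have vy : 0 < v t y by move: wpos; rewrite /w pmulr_rgt0// subr_gt0.
have Dm : is_derive t 1 (w y) 0.
  apply: (@derive1_at_max R (w y) 0 t2 t (ltW t20)).
  - by move=> s; rewrite in_itv/= => /andP[s0 _]; exact: (ex_derive (is_derive := Dw y s s0)).
  - by rewrite in_itv/= t0.
  - by move=> s; rewrite in_itv/= => /andP[s0 s2]; apply: wm; rewrite !ltW.
have E : - v t y + (t2 - t) * dv t y = 0.
  by rewrite -(derive_val (is_derive := Dw y t t0)) (derive_val (is_derive := Dm)).
have dv0 : dv t y <= 0.
  apply: (le_trans (le t y t0)); apply: sumr_le0 => e _.
  apply: mulr_ge0_le0; first exact: a0.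
  rewrite subr_le0 -(@ler_pM2l _ (t2 - t)) ?subr_gt0//.
  by apply: wm; rewrite !ltW.
have : (t2 - t) * dv t y <= 0 by rewrite mulr_ge0_le0// subr_ge0 ltW.
by move: E vy; lra.
Qed.

End MaximumPrinciple.

(** * The heat semigroup on a finite group *)

Section Differences.
Variables (R : realType) (G : finZmodType) (D : finType) (o : D -> D) (d : D -> G) (N : R).
Implicit Types (g h : G -> R) (e : D) (es : seq D) (x y : G).

Definition fdiff e g : G -> R := fun x => N * (g (x + d e) - g x).

Definition flap g : G -> R := fun x => N ^+ 2 * \sum_e (g (x + d e) - g x).

Definition fdiffs es g : G -> R := foldr fdiff g es.

Hypotheses (oK : involutive o) (dN : forall e, d (o e) = - d e).

(** Translation by [d e] followed by the exchange of [e] with [o e] carries one side to the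
    other. *)
Lemma flap_by_parts g h : \sum_y flap g y * h y = \sum_y g y * flap h y.
Proof.
rewrite /flap.
under eq_bigr do rewrite mulrAC -mulrA mulr_sumr.
under [RHS]eq_bigr do rewrite mulrCA mulr_sumr.
rewrite -!mulr_sumr; congr (_ * _).
under eq_bigr do under eq_bigr do rewrite mulrBr.
under [RHS]eq_bigr do under eq_bigr do rewrite mulrBr.
under eq_bigr do rewrite sumrB.
under [RHS]eq_bigr do rewrite sumrB.
rewrite !sumrB; congr (_ - _); last first.
  by apply: eq_bigr => y _; apply: eq_bigr => e _; rewrite mulrC.
rewrite exchange_big/= [RHS]exchange_big/= [RHS](reindex_inj (inv_inj oK))/=.
apply: eq_bigr => e _; rewrite [RHS](reindex_inj (addrI (d e)))/=.
by apply: eq_bigr => y _; rewrite dN addrAC subrr add0r mulrC addrC.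
Qed.

(** The sum of squares is the carré du champ of the Laplacian, the gain that Bernstein's inequality
    exploits. *)
Lemma flap_sqr g x : flap (fun y => g y ^+ 2) x =
  2 * g x * flap g x + \sum_e fdiff e g x ^+ 2.
Proof.
rewrite /flap /fdiff mulrCA !mulr_sumr -big_split/=.
by apply: eq_bigr => e _; ring.
Qed.

(** [fdiff (o e) (fdiff e g)] is minus a centred second difference, and each pair of opposite
    directions is counted twice. In this divergence form one difference can stay on the datum while
    the other falls on the semigroup. *)
Lemma flapE g x : flap g x = - 2^-1 * \sum_e fdiff (o e) (fdiff e g) x.
Proof.
rewrite /flap /fdiff.
have -> : \sum_e (g (x + d e) - g x) =
   2^-1 * (\sum_e (g (x + d e) - g x) + \sum_e (g (x + d (o e)) - g x)).
  rewrite [X in _ + X](reindex_inj (inv_inj oK))/=.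
  under [X in _ + X]eq_bigr do rewrite oK.
  by field.
rewrite -big_split/= mulrCA mulNr -mulrN -sumrN; congr (_ * _).
rewrite mulr_sumr; apply: eq_bigr => e _.
by rewrite dN subrK; ring.
Qed.

Lemma fdiffC e e' g : fdiff e (fdiff e' g) = fdiff e' (fdiff e g).
Proof. by apply/funext => x; rewrite /fdiff (addrAC x); ring. Qed.

Lemma fdiff_flap e g : fdiff e (flap g) = flap (fdiff e g).
Proof.
apply/funext => x; rewrite /fdiff /flap -(mulrBr (N ^+ 2)) (mulrCA N); congr (_ * _).
rewrite -sumrB mulr_sumr; apply: eq_bigr => e' _; rewrite (addrAC x); ring.
Qed.

Lemma fdiffs_fdiff es e g : fdiffs es (fdiff e g) = fdiff e (fdiffs es g).
Proof. by elim: es => //= e' es ->; rewrite fdiffC. Qed.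

Lemma fdiffs_flap es g : fdiffs es (flap g) = flap (fdiffs es g).
Proof. by elim: es => //= e' es ->; rewrite fdiff_flap. Qed.

Lemma fdiff_lin e a b g h x :
  fdiff e (fun y => a * g y + b * h y) x = a * fdiff e g x + b * fdiff e h x.
Proof. by rewrite /fdiff; ring. Qed.

Lemma flap_lin a b g h x :
  flap (fun y => a * g y + b * h y) x = a * flap g x + b * flap h x.
Proof.
rewrite /flap (mulrCA a) (mulrCA b) -mulrDr; congr (_ * _); rewrite !mulr_sumr -big_split/=.
by apply: eq_bigr => e _; ring.
Qed.

Lemma fdiffs_lin es a b g h x :
  fdiffs es (fun y => a * g y + b * h y) x = a * fdiffs es g x + b * fdiffs es h x.
Proof.
elim: es x => [//|e es IH] x /=.
by rewrite -/(fdiffs _ _) /fdiff !IH; ring.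
Qed.

End Differences.

Section HeatKernel.
Variables (R : realType) (G : finZmodType) (D : finType) (o : D -> D) (d : D -> G) (N : R).
Hypotheses (oK : involutive o) (dN : forall e, d (o e) = - d e).
Implicit Types (g h : G -> R) (e : D) (es : seq D) (x y : G) (t s : R).
Local Notation fdiff := (fdiff d N).
Local Notation fdiffs := (fdiffs d N).
Local Notation flap := (flap d N).

Lemma heat_kernel_exists : exists p : R -> G -> R,
  [/\ forall x, p 0 x = (x == 0)%:R, forall x, continuous (p^~ x) &
   forall t x, 0 < t -> is_derive t 1 (p^~ x) (flap (p t) x)].
Proof.
pose A (t : R) x y : R := N ^+ 2 * \sum_e ((y == x + d e)%:R - (y == x)%:R).
have [|//||p [p0 cp Dp]] := @linear_ode R G A
    (N ^+ 2 * \sum_(e : D) 2) (fun x => (x == 0)%:R).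
- by rewrite mulr_ge0 ?sqr_ge0 ?sumr_ge0.
- by move=> i j t; exact: cst_continuous.
- move=> t i j; rewrite /A normrM ger0_norm ?sqr_ge0// ler_wpM2l ?sqr_ge0//.
  apply: (le_trans (ler_norm_sum _ _ _)); apply: ler_sum => e _.
  by rewrite (le_trans (ler_normB _ _))// !normr_nat; case: eqP; case: eqP => /=; lra.
exists p; split => // t x t0; apply: is_derive_eq (Dp t x t0) _.
rewrite /A; under eq_bigr do rewrite -mulrA mulr_suml.
rewrite -mulr_sumr /flap exchange_big/=; congr (_ * _); apply: eq_bigr => e _.
under eq_bigr do rewrite mulrBl.
rewrite sumrB; congr (_ - _).
  by rewrite (bigD1 (x + d e))//= eqxx mul1r big1 ?addr0// => y /negPf ->; rewrite mul0r.
by rewrite (bigD1 x)//= eqxx mul1r big1 ?addr0// => y /negPf ->; rewrite mul0r.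
Qed.

Definition heat_kernel : R -> G -> R := projT1 (cid heat_kernel_exists).
Local Notation p := heat_kernel.

Lemma heat_kernel0 x : p 0 x = (x == 0)%:R.
Proof. by have [+ _ _] := projT2 (cid heat_kernel_exists); apply. Qed.

Lemma continuous_heat_kernel x : continuous (p^~ x).
Proof. by have [_ + _] := projT2 (cid heat_kernel_exists); apply. Qed.

Lemma is_derive_heat_kernel t x : 0 < t -> is_derive t 1 (p^~ x) (flap (p t) x).
Proof. by have [_ _ +] := projT2 (cid heat_kernel_exists); apply. Qed.

Lemma heat_kernel_ge0 t x : 0 <= t -> 0 <= p t x.
Proof.
move=> t0; rewrite -oppr_le0.
apply: (@maximum_principle R G D (fun x e => x + d e) (fun _ _ _ => N ^+ 2)
  (fun t x => - p t x) (fun t x => - flap (p t) x)) => //.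
- by move=> y s; apply: continuousN; exact: continuous_heat_kernel.
- by move=> s y s0; apply: is_derive_oppf; exact: is_derive_heat_kernel.
- move=> s y s0; rewrite -mulr_sumr /flap -mulrN -sumrN.
  by rewrite ler_wpM2l ?sqr_ge0// ler_sum// => e _; lra.
- by move=> s y e _; rewrite sqr_ge0.
- by move=> y; rewrite heat_kernel0 oppr_le0.
Qed.

Lemma sum_heat_kernel t : 0 <= t -> \sum_y p t y = 1.
Proof.
move=> t0; have <- : \sum_y p 0 y = 1.
  under eq_bigr do rewrite heat_kernel0.
  by rewrite (bigD1 0)//= eqxx big1 ?addr0// => y /negPf ->.
apply/eqP; rewrite -subr_eq0 -normr_le0 -[leRHS](subrr 0).
apply: (@dominated_increment R (fun t => \sum_y p t y) (fun=> 0)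
  (fun t => \sum_y flap (p t) y) (fun=> 0) _ _ t0).
- by apply: continuous_subspaceT => s; apply: continuous_sumf => y; exact: continuous_heat_kernel.
- by apply: continuous_subspaceT => s; exact: cst_continuous.
- move=> s /andP[s0 _]; apply: (is_derive_sumf _ _ (df := fun y s => flap (p s) y)) => y.
  exact: is_derive_heat_kernel.
- move=> s _; rewrite normr_le0.
  under eq_bigr do rewrite -[flap _ _]mulr1.
  rewrite (flap_by_parts N oK dN) big1// => y _.
  by rewrite /flap big1 ?mulr0// => e _; rewrite subrr.
Qed.

(** The sum [x + y] needs no reflection of [y]: the Laplacian is symmetric, and [flap_by_parts]
    moves it from the kernel to [g]. *)
Definition heat t g : G -> R := fun x => \sum_y p t y * g (x + y).

End HeatKernel.

Section HeatSemigroup.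
Variables (R : realType) (G : finZmodType) (D : finType) (o : D -> D) (d : D -> G) (N : R).
Hypotheses (oK : involutive o) (dN : forall e, d (o e) = - d e).
Implicit Types (g h : G -> R) (e : D) (es : seq D) (x y : G) (t s : R).
Local Notation fdiff := (fdiff d N).
Local Notation fdiffs := (fdiffs d N).
Local Notation flap := (flap d N).
Local Notation p := (heat_kernel d N).
Local Notation heat := (heat d N).

Lemma heat0 g : heat 0 g = g.
Proof.
apply/funext => x; rewrite /heat (bigD1 0)//= heat_kernel0 eqxx mul1r addr0.
by rewrite big1 ?addr0// => y /negPf y0; rewrite heat_kernel0 y0 mul0r.
Qed.

Lemma heat_lin t a b g h x :
  heat t (fun y => a * g y + b * h y) x = a * heat t g x + b * heat t h x.
Proof.
rewrite /heat !mulr_sumr -big_split/=; apply: eq_bigr => y _; ring.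
Qed.

Lemma heat_cst t (c : R) x : 0 <= t -> heat t (fun=> c) x = c.
Proof.
by move=> t0; rewrite /heat -mulr_suml (sum_heat_kernel N oK dN)// mul1r.
Qed.

Lemma heat_le t g h x : 0 <= t -> (forall y, g y <= h y) -> heat t g x <= heat t h x.
Proof.
move=> t0 gh; rewrite /heat; apply: ler_sum => y _.
by rewrite ler_wpM2l// heat_kernel_ge0.
Qed.

Lemma heat_norm t g x : 0 <= t -> `|heat t g x| <= heat t (fun y => `|g y|) x.
Proof.
move=> t0; rewrite /heat (le_trans (ler_norm_sum _ _ _))//.
by apply: ler_sum => y _; rewrite normrM ger0_norm// heat_kernel_ge0.
Qed.

Lemma heat_bound t g x (B : R) : 0 <= t -> (forall y, `|g y| <= B) -> `|heat t g x| <= B.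
Proof.
move=> t0 gB; rewrite -(heat_cst B x t0).
by rewrite (le_trans (heat_norm _ _ _))// heat_le.
Qed.

Lemma fdiff_heat e t g : fdiff e (heat t g) = heat t (fdiff e g).
Proof.
apply/funext => x; rewrite /heat /fdiff -sumrB mulr_sumr; apply: eq_bigr => y _.
by rewrite addrAC; ring.
Qed.

Lemma fdiffs_heat es t g : fdiffs es (heat t g) = heat t (fdiffs es g).
Proof. by elim: es => //= e es ->; rewrite fdiff_heat. Qed.

Lemma flap_heat t g : flap (heat t g) = heat t (flap g).
Proof.
apply/funext => x; rewrite /heat /flap.
under eq_bigr do rewrite -sumrB.
rewrite exchange_big/= mulr_sumr; apply: eq_bigr => y _.
rewrite mulrCA; congr (_ * _); rewrite mulr_sumr; apply: eq_bigr => e _.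
by rewrite addrAC; ring.
Qed.

Lemma heat_shift t g x z : heat t (fun y => g (z + y)) x = heat t g (z + x).
Proof. by rewrite /heat; apply: eq_bigr => y _; rewrite addrA. Qed.

(** Clock and datum move together. This one formula yields Duhamel's principle, the semigroup law
    and Bernstein's inequality. *)
Lemma is_derive_heat (tau : R -> R) (dtau : R) (v : R -> G -> R) (dv : G -> R) s x :
  0 < tau s -> is_derive s 1 tau dtau -> (forall y, is_derive s 1 (v^~ y) (dv y)) ->
  is_derive s 1 (fun s => heat (tau s) (v s) x)
    (heat (tau s) (fun y => dtau * flap (v s) y + dv y) x).
Proof.
move=> t0 Dt Dv; rewrite /heat.
have D1 y : is_derive s 1 (fun s => p (tau s) y * v s (x + y))
   (flap (p (tau s)) y * dtau * v s (x + y) + p (tau s) y * dv (x + y)).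
  exact: (is_derive_mulf (is_derive_compf (is_derive_heat_kernel d N y t0) Dt) (Dv _)).
have H := is_derive_sumf (index_enum G) xpredT (t := s)
  (f := fun y s => p (tau s) y * v s (x + y))
  (df := fun y _ => flap (p (tau s)) y * dtau * v s (x + y) + p (tau s) y * dv (x + y)) D1.
apply: is_derive_eq H _; rewrite big_split/=.
under [RHS]eq_bigr do rewrite mulrDr.
rewrite [RHS]big_split/=; congr (_ + _).
under eq_bigr do rewrite mulrAC mulrC.
under [RHS]eq_bigr do rewrite mulrCA.
rewrite -!mulr_sumr; congr (_ * _).
rewrite (flap_by_parts N oK dN); apply: eq_bigr => y _; congr (_ * _).
by rewrite /flap; congr (_ * _); apply: eq_bigr => e _; rewrite addrA.
Qed.

Lemma continuous_heat (tau : R -> R) (v : R -> G -> R) x :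
  continuous tau -> (forall y, continuous (v^~ y)) ->
  continuous (fun s => heat (tau s) (v s) x).
Proof.
move=> ct cv s; apply: continuous_sumf => y; apply: cvgM; last exact: cv.
have c1 : {for tau s, continuous (p^~ y)} by exact: continuous_heat_kernel.
exact: (continuous_comp (ct s) c1).
Qed.

Lemma is_derive_heat_time t g x : 0 < t ->
  is_derive t 1 (fun s => heat s g x) (heat t (flap g) x).
Proof.
move=> t0; have H := @is_derive_heat id 1 (fun _ => g) (fun=> 0) t x t0
  (is_derive_id _ _) (fun y => is_derive_cstf _ _).
apply: is_derive_eq H _; congr (heat _ _ _); apply/funext => y.
by rewrite mul1r addr0.
Qed.

(** [heat (s - r) (heat (t + r) g) x] has derivative [0] in [r]; the two sides are its values at
    [r = 0] and [r = s]. *)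
Lemma heatD s t g x : 0 <= s -> 0 <= t -> heat s (heat t g) x = heat (s + t) g x.
Proof.
move=> s0 t0.
have cs : continuous (fun r : R => s - r).
  by move=> r; apply: cvgB; [exact: cvg_cst|exact: cvg_id].
have ct : continuous (fun r : R => t + r).
  by move=> r; apply: cvgD; [exact: cvg_cst|exact: cvg_id].
have : `|heat (s - s) (heat (t + s) g) x - heat (s - 0) (heat (t + 0) g) x| <= 0 - 0 :> R.
  apply: (@dominated_increment R (fun r => heat (s - r) (heat (t + r) g) x) (fun=> 0)
     (fun=> 0) (fun=> 0) 0 s s0) => [||r /andP[r0 rs]|r _].
  - apply: continuous_subspaceT; apply: (@continuous_heat _ (fun r y => heat (t + r) g y)) => // y.
    by apply: (@continuous_heat _ (fun _ => g)) => // z; exact: cst_continuous.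
  - by apply: continuous_subspaceT => ?; exact: cst_continuous.
  - have sr : 0 < s - r by rewrite subr_gt0.
    have tr : 0 < t + r by rewrite ltr_wpDl.
    have Dt : is_derive r 1 (fun r => t + r) 1.
      by have := is_derive_addf (is_derive_cstf t r) (is_derive_id r (1 : R)); rewrite add0r.
    have Ds : is_derive r 1 (fun r => s - r) (-1).
      by have := is_derive_subf (is_derive_cstf s r) (is_derive_id r (1 : R)); rewrite sub0r.
    have Dv y : is_derive r 1 (fun r => heat (t + r) g y) (heat (t + r) (flap g) y).
      by have := is_derive_compf (is_derive_heat_time g y tr) Dt; rewrite mulr1.
    have H := @is_derive_heat (fun r => s - r) (- 1) (fun r => heat (t + r) g) _ r x sr Ds Dv.
    apply: is_derive_eq H _.
    rewrite -[RHS](heat_cst 0 x (ltW sr)); congr (heat _ _ _); apply/funext => y.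
    by rewrite flap_heat mulN1r addNr.
  - by rewrite normr0.
by rewrite !subrr subr0 addr0 normr_le0 subr_eq0 heat0 (addrC t) => /eqP.
Qed.

(* Bernstein: the heat operator maps [r |grad P_r g|^2 + (P_r g)^2] to a
   nonpositive function. *)
Lemma heat_bernstein e t g x : 0 <= t ->
  t * fdiff e (heat t g) x ^+ 2 <= heat t (fun y => g y ^+ 2) x.
Proof.
move=> t0; rewrite fdiff_heat.
pose v r y := r * heat r (fdiff e g) y ^+ 2 + heat r g y ^+ 2.
have cid' : continuous (fun r : R => r) by move=> ?; exact: cvg_id.
have ch h y : continuous (fun r => heat r h y).
  by apply: (@continuous_heat id (fun _ => h)) => // z; exact: cst_continuous.
have : heat (t - t) (v t) x - heat (t - 0) (v 0) x <= 0 - 0 :> R.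
  apply: (@le_increment R (fun r => heat (t - r) (v r) x) (fun=> 0)
   (fun r => heat (t - r) (fun y => - flap (v r) y +
    (heat r (fdiff e g) y ^+ 2 + r * (2 * heat r (fdiff e g) y * flap (heat r (fdiff e g)) y)
      + 2 * heat r g y * flap (heat r g) y)) x)
   (fun=> 0) 0 t t0) => [||r /andP[r0 rt]|r /andP[r0 rt]].
  - apply: continuous_subspaceT; apply: (@continuous_heat _ v) => [r|y r].
      by apply: cvgB; [exact: cvg_cst|exact: cvg_id].
    rewrite /v; apply: cvgD; last by apply: cvgM; exact: ch.
    by apply: cvgM; [exact: cvg_id|apply: cvgM; exact: ch].
  - by apply: continuous_subspaceT => ?; exact: cst_continuous.
  - have tr : 0 < t - r by rewrite subr_gt0.
    have Ds : is_derive r 1 (fun r => t - r) (-1).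
      by have := is_derive_subf (is_derive_cstf t r) (is_derive_id r (1 : R)); rewrite sub0r.
    have Dh h y : is_derive r 1 (fun r => heat r h y) (flap (heat r h) y).
      by rewrite flap_heat; exact: is_derive_heat_time.
    have Dsq h y : is_derive r 1 (fun r => heat r h y ^+ 2) (2 * heat r h y * flap (heat r h) y).
      by apply: is_derive_eq (is_derive_mulf (Dh h y) (Dh h y)) _; ring.
    have Dv y : is_derive r 1 (v^~ y) (heat r (fdiff e g) y ^+ 2
        + r * (2 * heat r (fdiff e g) y * flap (heat r (fdiff e g)) y)
        + 2 * heat r g y * flap (heat r g) y).
      have H := is_derive_addf (is_derive_mulf (is_derive_id r (1 : R)) (Dsq (fdiff e g) y)) (Dsq g y).
      by apply: is_derive_eq H _; rewrite mul1r.
    have H := @is_derive_heat (fun r => t - r) (- 1) v _ r x tr Ds Dv.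
    apply: is_derive_eq H _.
    by congr (heat _ _ _); apply/funext => y; rewrite mulN1r.
  - rewrite -(heat_cst 0 x (_ : 0 <= t - r)) ?subr_ge0 ?(ltW rt)//.
    apply: heat_le => [|y]; first by rewrite subr_ge0 ltW.
    have -> : flap (v r) y = r * flap (fun y => heat r (fdiff e g) y ^+ 2) y
        + 1 * flap (fun y => heat r g y ^+ 2) y.
      rewrite -flap_lin; congr (flap _ y).
      by apply/funext => z; rewrite /v mul1r.
    rewrite !flap_sqr.
    (* Differentiating the factor [r] leaves one squared difference, absorbed by the squared
       gradient that [flap_sqr] produces for [heat r g]. *)
    have : heat r (fdiff e g) y ^+ 2 <= \sum_e' fdiff e' (heat r g) y ^+ 2.
      by rewrite (bigD1 e)//= fdiff_heat lerDl sumr_ge0// => i _; rewrite sqr_ge0.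
    have : 0 <= r * \sum_e' fdiff e' (heat r (fdiff e g)) y ^+ 2.
      by rewrite mulr_ge0 ?(ltW r0)// sumr_ge0// => i _; rewrite sqr_ge0.
    lra.
rewrite !subr0 subrr heat0 subr_le0 {1}/v => H.
apply: le_trans (le_trans H _); first by rewrite lerDl sqr_ge0.
by apply: heat_le => // y; rewrite /v mul0r add0r heat0.
Qed.

End HeatSemigroup.

(** * Gradient bounds for the heat semigroup on data of Hölder growth *)

Section WeightedHeat.
Variables (R : realType) (G : finZmodType) (D : finType) (o : D -> D) (d : D -> G) (N : R).
Hypotheses (oK : involutive o) (dN : forall e, d (o e) = - d e) (N0 : 0 < N).
Implicit Types (g h : G -> R) (e : D) (es : seq D) (x y : G) (t s : R).
Local Notation fdiff := (fdiff d N).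
Local Notation fdiffs := (fdiffs d N).
Local Notation flap := (flap d N).
Local Notation p := (heat_kernel d N).
Local Notation heat := (heat d N).

(** Each difference uses one Bernstein step on its own time slice of length [t]; the slices are
    joined by the semigroup law, whence the total time. *)
Lemma heat_fdiffs es t g x : 0 <= t ->
  t ^+ size es * fdiffs es (heat ((size es)%:R * t) g) x ^+ 2
    <= heat ((size es)%:R * t) (fun y => g y ^+ 2) x.
Proof.
move=> t0; elim: es x => [|e es IH] x /=; first by rewrite mul0r !heat0 mul1r.
set k := size es.
have kt0 : 0 <= k%:R * t by rewrite mulr_ge0.
have -> : k.+1%:R * t = t + k%:R * t by rewrite -natr1 mulrDl mul1r addrC.
rewrite -/(fdiffs _ _) fdiffs_heat.
rewrite (_ : heat (t + k%:R * t) _ = heat t (heat (k%:R * t) (fdiffs es g))); last first.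
  by apply/funext => y; rewrite (heatD _ oK dN).
rewrite (_ : heat (t + k%:R * t) _ x = heat t (heat (k%:R * t) (fun y => g y ^+ 2)) x); last first.
  by rewrite (heatD _ oK dN).
rewrite exprSr -mulrA.
apply: (@le_trans _ _ (t ^+ k * heat t (fun y => heat (k%:R * t) (fdiffs es g) y ^+ 2) x)).
  by rewrite ler_wpM2l ?exprn_ge0// (heat_bernstein N oK dN).
have -> : t ^+ k * heat t (fun y => heat (k%:R * t) (fdiffs es g) y ^+ 2) x =
    heat t (fun y => t ^+ k * heat (k%:R * t) (fdiffs es g) y ^+ 2) x.
  by rewrite /heat mulr_sumr; apply: eq_bigr => y _; rewrite mulrCA.
by apply: heat_le => // y; rewrite -fdiffs_heat; exact: IH.
Qed.

Variables (q : G -> R) (Cq : R).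
Hypotheses (q_ge0 : forall x, 0 <= q x) (q0 : q 0 = 0).
Hypothesis qD : forall x y, q (x + y) <= 2 * (q x + q y).
Hypothesis q_step : forall e, q (d e) <= N ^- 2.
Hypotheses (Cq0 : 0 <= Cq) (flap_q : forall x, flap q x <= Cq).

Local Notation eta := (N ^- 2).

(** The time derivative is a mean of [flap q]. With [q] a squared distance this is the second moment
    of the kernel. *)
Lemma heat_q t : 0 <= t -> heat t q 0 <= Cq * t.
Proof.
move=> t0.
have : heat t q 0 - heat 0 q 0 <= Cq * t - Cq * 0.
  apply: (@le_increment R (fun t => heat t q 0) (fun t => Cq * t)
    (fun t => heat t (flap q) 0) (fun=> Cq) _ _ t0) => [|| s /andP[s0 _]|s _|s /andP[s0 _]].
  - apply: continuous_subspaceT; apply: (@continuous_heat _ _ _ _ _ id (fun _ => q)) => [y|z y].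
      exact: cvg_id.
    exact: cst_continuous.
  - by apply: continuous_subspaceT => y; apply: cvgM; [exact: cvg_cst|exact: cvg_id].
  - exact: is_derive_heat_time.
  - by apply: is_derive_eq (is_derive_cmulf Cq (is_derive_id s (1 : R))) _; rewrite mulr1.
  - by rewrite -[leRHS](heat_cst N oK dN Cq (0 : G) (ltW s0)) heat_le// ltW.
by rewrite heat0 q0 mulr0 !subr0.
Qed.

(** From [(1 + v)^s <= 1 + v]: a Hölder weight is replaced by an affine function of [q], whose mean
    is bounded by [heat_q]. *)
Lemma powR_weight (rho s w : R) : 0 < rho -> 0 <= w -> 0 <= s <= 1 ->
  (rho + w) `^ s <= rho `^ s * (1 + w / rho).
Proof.
move=> r0 w0 /andP[s0 s1].
have wr : 0 <= w / rho by rewrite divr_ge0// ltW.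
have -> : rho + w = rho * (1 + w / rho) by field; rewrite gt_eqF.
rewrite powRM ?(ltW r0) ?addr_ge0// ler_wpM2l ?powR_ge0//.
by apply: ler1_powR => //; rewrite lerDl.
Qed.

Lemma heat_weight t g x z (A rho s : R) : 0 <= t -> 0 <= A -> 0 < rho -> 0 <= s <= 1 ->
  (forall y, `|g y| <= A * (rho + q (y - x)) `^ s) ->
  `|heat t g z| <= A * rho `^ s * (1 + 2 * (q (z - x) + Cq * t) / rho).
Proof.
move=> t0 A0 r0 s01 gA.
apply: (le_trans (heat_norm _ _ _ _ t0)).
pose w := A * rho `^ s; have w0 : 0 <= w by rewrite mulr_ge0// powR_ge0.
pose b := w * (2 / rho); have b0 : 0 <= b by rewrite mulr_ge0// divr_ge0// ltW.
apply: (@le_trans _ _ (heat t (fun y => w * (1 + 2 * q (z - x) / rho) * 1 +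
    b * q (- z + y)) z)).
  apply: heat_le => // y; apply: (le_trans (gA y)).
  apply: (@le_trans _ _ (A * (rho `^ s * (1 + q (y - x) / rho)))).
    by rewrite ler_wpM2l// powR_weight.
  have -> : w * (1 + 2 * q (z - x) / rho) * 1 + b * q (- z + y) =
      A * (rho `^ s * (1 + 2 * (q (z - x) + q (- z + y)) / rho)) by rewrite /b /w; ring.
  rewrite ler_wpM2l// ler_wpM2l ?powR_ge0// lerD2l ler_wpM2r ?invr_ge0 ?(ltW r0)//.
  by rewrite (_ : y - x = (z - x) + (- z + y)) ?qD// addrACA subrr add0r addrC.
rewrite heat_lin (heat_cst N oK dN)// heat_shift addNr.
have -> : A * rho `^ s * (1 + 2 * (q (z - x) + Cq * t) / rho) =
    w * (1 + 2 * q (z - x) / rho) * 1 + b * (Cq * t) by rewrite /b /w; ring.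
by rewrite lerD2l ler_wpM2l// heat_q.
Qed.

(** Each difference costs a factor [2 * N] and enlarges the region seen. Its radius grows by the
    factor 4 since [qD] gives [2 * (4 ^+ k * eta + eta) <= 4 ^+ k.+1 * eta]. *)
Lemma fdiffs_local es x h (B : R) :
  (forall z, q (z - x) <= 4 ^+ size es * eta -> `|h z| <= B) ->
  `|fdiffs es h x| <= (2 * N) ^+ size es * B.
Proof.
elim: es x => [|e es IH] x /= hB; first by rewrite expr0 mul1r hB// subrr q0 mulr_ge0 ?invr_ge0 ?exprn_ge0// ltW.
have eta0 : 0 < eta by rewrite invr_gt0 exprn_gt0.
have e4 : 1 <= 4 ^+ size es :> R by rewrite exprn_ege1//; lra.
have H x' : q (x' - x) <= eta -> `|fdiffs es h x'| <= (2 * N) ^+ size es * B.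
  move=> x'x; apply: IH => z zx'; apply: hB.
  rewrite (_ : z - x = (z - x') + (x' - x)); last by rewrite addrA subrK.
  apply: (le_trans (qD _ _)); rewrite exprS -mulrA.
  have : eta <= 4 ^+ size es * eta by rewrite ler_peMl// ltW.
  by move: zx' x'x; lra.
rewrite /fdiff normrM gtr0_norm// exprS -!mulrA mulrCA ler_pM2l//.
apply: (le_trans (ler_normB _ _)).
have h1 : `|fdiffs es h (x + d e)| <= (2 * N) ^+ size es * B.
  by apply: H; rewrite addrAC subrr add0r.
have h2 : `|fdiffs es h x| <= (2 * N) ^+ size es * B.
  by apply: H; rewrite subrr q0 ltW.
by rewrite -/(fdiffs es) ; lra.
Qed.

(** The first summand serves the times [t > eta] and the second the times [t <= eta]. *)
Definition grad_cst (k : nat) : R :=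
  (2 * k%:R) ^+ k * (1 + 2 * Cq) + 4 ^+ k * (1 + 2 * (4 ^+ k + Cq)).

Lemma grad_cst_ge0 k : 0 <= grad_cst k.
Proof. by rewrite addr_ge0// mulr_ge0 ?exprn_ge0// ?mulr_ge0// addr_ge0// ?mulr_ge0// ?addr_ge0 ?exprn_ge0. Qed.

(* For [t >= eta] this is the iterated Bernstein inequality; for shorter times
   each difference quotient costs a factor [2 N]. *)
Lemma heat_grad_weight es t g x (A s : R) : 0 <= t -> 0 <= A -> 0 <= s <= 1 ->
  (0 < size es)%N ->
  (forall y, `|g y| <= A * (t + eta + q (y - x)) `^ (s / 2)) ->
  `|fdiffs es (heat t g) x| <=
     grad_cst (size es) * A * (t + eta) `^ ((s - (size es)%:R) / 2).
Proof.
move=> t0 A0 /andP[s0 s1] es0 gA.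
set k := size es in es0 *.
have eta0 : 0 < eta by rewrite invr_gt0 exprn_gt0.
pose rho := t + eta; have r0 : 0 < rho by rewrite ltr_wpDl.
have k1 : 1 <= k%:R :> R by rewrite ler1n.
have -> : (t + eta) `^ ((s - k%:R) / 2) = rho `^ (s / 2) * (rho `^ (- 2^-1)) ^+ k.
  rewrite -(powR_mulrn k) ?powR_ge0// -powRrM -powRD ?(gt_eqF r0) ?implybT//.
  by congr (_ `^ _); field.
set S := rho `^ (s / 2); have S0 : 0 <= S by exact: powR_ge0.
set Q := rho `^ (- 2^-1); have Q0 : 0 < Q by exact: powR_gt0.
have QQ : Q ^+ 2 = rho^-1.
  rewrite -(powR_mulrn 2) ?powR_ge0// -powRrM (_ : - 2^-1 * 2%:R = -1); last by field.
  by rewrite powR_inv1// ltW.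
have [teta|etat] := leP t eta.
  apply: (@le_trans _ _ ((2 * N) ^+ k * (A * S * (1 + 2 * (4 ^+ k + Cq))))).
    apply: fdiffs_local => z zx.
    apply: (le_trans (@heat_weight t g x z A rho (s / 2) t0 A0 r0 _ gA)); first by lra.
    rewrite ler_wpM2l ?mulr_ge0// lerD2l -!mulrA ler_wpM2l// ler_pdivrMr// mulrDl.
    apply: lerD; last by rewrite ler_wpM2l// /rho lerDl ltW.
    by rewrite (le_trans zx)// ler_wpM2l ?exprn_ge0// /rho lerDr.
  (* Here [rho <= 2 * eta], so [N] is comparable with [rho^(-1/2)] and the crude factors [2 * N]
     have the right size. *)
  have NQ : 2 * N <= 4 * Q.
    rewrite -ler_sqr ?nnegrE ?mulr_ge0 ?(ltW N0) ?(ltW Q0)// !exprMn QQ.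
    have re : rho <= 2 * eta by rewrite /rho; lra.
    have -> : N ^+ 2 = eta^-1 by rewrite invrK.
    have : eta^-1 <= 2 * rho^-1.
      by rewrite ler_pdivlMr// mulrC ler_pdivrMr.
    have : 0 <= rho^-1 by rewrite invr_ge0 ltW.
    lra.
  apply: (@le_trans _ _ ((4 * Q) ^+ k * (A * S * (1 + 2 * (4 ^+ k + Cq))))).
    rewrite ler_wpM2r ?mulr_ge0 ?addr_ge0 ?mulr_ge0 ?addr_ge0 ?exprn_ge0//.
    by rewrite lerXn2r ?nnegrE ?mulr_ge0// ltW.
  have -> : (4 * Q) ^+ k * (A * S * (1 + 2 * (4 ^+ k + Cq))) =
      (4 ^+ k * (1 + 2 * (4 ^+ k + Cq))) * A * (S * Q ^+ k) by rewrite exprMn; ring.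
  rewrite ler_wpM2r ?mulr_ge0 ?exprn_ge0 ?(ltW Q0)// ler_wpM2r// /grad_cst lerDr.
  by rewrite mulr_ge0 ?exprn_ge0 ?mulr_ge0 ?addr_ge0 ?mulr_ge0 ?(ltW k0).
have t1 : 0 < t by exact: lt_trans etat.
have rt : rho <= 2 * t by rewrite /rho; lra.
pose r := t / k%:R.
have k0 : 0 < k%:R :> R by rewrite ltr0n.
have rr : 0 < r by rewrite divr_gt0.
have kr : k%:R * r = t by rewrite /r mulrC divfK// gt_eqF.
have := heat_fdiffs es g x (ltW rr); rewrite -/k kr => HB.
(* Squaring [g] doubles the exponent of its weight to [s], still at most [1], so that [heat_weight]
   applies. *)
have H2 : heat t (fun y => g y ^+ 2) x <= (A * S) ^+ 2 * (1 + 2 * Cq).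
  apply: (le_trans (ler_norm _)).
  have SS : rho `^ s = S ^+ 2.
    by rewrite -(powR_mulrn 2) ?powR_ge0// -powRrM; congr (_ `^ _); field.
  have := @heat_weight t (fun y => g y ^+ 2) x x (A ^+ 2) rho s t0 (sqr_ge0 _) r0.
  rewrite s0 s1 subrr q0 add0r SS exprMn => /(_ isT) H.
  apply: (le_trans (H _)) => [y|].
    rewrite normrX (_ : _ `^ s = ((rho + q (y - x)) `^ (s / 2)) ^+ 2).
      by rewrite -exprMn lerXn2r ?nnegrE ?mulr_ge0 ?powR_ge0//; exact: gA.
    by rewrite -(powR_mulrn 2) ?powR_ge0// -powRrM; congr (_ `^ _); field.
  rewrite ler_wpM2l ?mulr_ge0 ?sqr_ge0// lerD2l -mulrA ler_wpM2l// ler_pdivrMr//.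
  by rewrite ler_wpM2l// /rho lerDl ltW.
have rQ : 1 <= r * (2 * k%:R * Q ^+ 2).
  have -> : r * (2 * k%:R * Q ^+ 2) = 2 * t / rho by rewrite QQ -kr; ring.
  by rewrite ler_pdivlMr// mul1r.
pose b := (2 * k%:R) ^+ k * Q ^+ k.
have b0 : 0 <= b by rewrite mulr_ge0 ?exprn_ge0 ?mulr_ge0 ?(ltW Q0) ?(ltW k0).
have rQk : 1 <= r ^+ k * b ^+ 2.
  rewrite /b -exprMn -exprM mulnC exprM -exprMn exprn_ege1// exprMn.
  have -> : r * ((2 * k%:R) ^+ 2 * Q ^+ 2) = (r * (2 * k%:R * Q ^+ 2)) * (2 * k%:R) by ring.
  by rewrite (le_trans rQ)// ler_peMr ?(le_trans _ rQ)//; lra.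
set F := fdiffs es (heat t g) x in HB *.
have FF : `|F| <= A * S * (1 + 2 * Cq) * b.
  have C1 : 1 <= 1 + 2 * Cq by rewrite lerDl mulr_ge0.
  have AS0 : 0 <= A * S by rewrite mulr_ge0.
  have X0 : 0 <= A * S * (1 + 2 * Cq) * b.
    by rewrite mulr_ge0// mulr_ge0// (le_trans ler01).
  rewrite -ler_sqr ?nnegrE// real_normK ?num_real//.
  apply: (@le_trans _ _ ((r ^+ k * b ^+ 2) * F ^+ 2)); first by rewrite ler_peMl ?sqr_ge0.
  rewrite mulrAC [leRHS]exprMn ler_wpM2r ?sqr_ge0// (le_trans HB)// (le_trans H2)//.
  by rewrite [leRHS]exprMn ler_wpM2l ?sqr_ge0// expr2 ler_peMr// (le_trans ler01).
apply: (le_trans FF).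
have -> : A * S * (1 + 2 * Cq) * b = ((2 * k%:R) ^+ k * (1 + 2 * Cq)) * A * (S * Q ^+ k).
  by rewrite /b; ring.
rewrite ler_wpM2r ?mulr_ge0 ?exprn_ge0 ?(ltW Q0)// ler_wpM2r// /grad_cst lerDl.
by rewrite mulr_ge0 ?exprn_ge0// addr_ge0 ?mulr_ge0// addr_ge0 ?exprn_ge0.
Qed.

Definition grad_cst_near (cm : R) (k : nat) : R := 3 * grad_cst k * (1 + cm^-1) ^+ k.+1.

(** In the applications [c] is a frozen coefficient and [x] the freezing point. Recentring the
    weight at [z] turns [r] into [3 * r], and passing from [r] to the clock [c * r] costs
    [1 + cm^-1], as [1 <= (1 + cm^-1) * c]. *)
Lemma heat_grad_weight_near es (cm c r s A : R) g x z : 0 < cm -> cm <= c -> 0 <= r ->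
  0 <= A -> 0 <= s <= 1 -> (0 < size es)%N -> q (z - x) <= r ->
  (forall y, `|g y| <= A * (r + eta + q (y - x)) `^ (s / 2)) ->
  `|fdiffs es (heat (c * r) g) z| <=
     grad_cst_near cm (size es) * A * (r + eta) `^ ((s - (size es)%:R) / 2).
Proof.
move=> cm0 cmc r0 A0 /andP[s0 s1] es0 zx gA.
have eta0 : 0 < eta by rewrite invr_gt0 exprn_gt0.
pose ka := 1 + cm^-1.
have ka1 : 1 <= ka by rewrite /ka lerDl invr_ge0 ltW.
have cka : 1 <= ka * c.
  rewrite /ka mulrDl mul1r (le_trans _ (_ : cm^-1 * c <= _))//.
    by rewrite mulrC ler_pdivlMr// mul1r.
  by rewrite lerDr (le_trans (ltW cm0)).
have rc : r <= ka * (c * r) by rewrite mulrA ler_peMl.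
have c0 : 0 < c by exact: lt_le_trans cmc.
have ka0 : 0 < ka by exact: lt_le_trans ka1.
have k3 : 1 <= 3 * ka by lra.
have gA' y : `|g y| <= (3 * ka * A) * (c * r + eta + q (y - z)) `^ (s / 2).
  apply: (le_trans (gA y)); rewrite [3 * ka * A]mulrC -mulrA ler_wpM2l//.
  apply: (@le_trans _ _ ((3 * ka * (c * r + eta + q (y - z))) `^ (s / 2))).
    apply: ge0_ler_powR; rewrite ?nnegrE.
    - by rewrite divr_ge0.
    - by rewrite !addr_ge0// ltW.
    - by rewrite mulr_ge0 ?mulr_ge0 ?(ltW ka0)// !addr_ge0 ?mulr_ge0// ltW.
    have : q (y - x) <= 2 * (q (y - z) + q (z - x)).
      by rewrite (le_trans _ (qD _ _))// addrA subrK.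
    have : q (y - z) <= ka * q (y - z) by rewrite ler_peMl.
    have : eta <= ka * eta by rewrite ler_peMl// ltW.
    by have := q_ge0 (y - z); lra.
  rewrite powRM ?mulr_ge0 ?(ltW ka0)//; last by rewrite !addr_ge0 ?mulr_ge0// ltW.
  by rewrite ler_wpM2r ?powR_ge0// ler1_powR//; lra.
have := @heat_grad_weight es (c * r) g z (3 * ka * A) s.
move=> /(_ _ _ _ es0 gA') H; apply: (le_trans (H _ _ _)) => {H}.
- by rewrite mulr_ge0// ltW.
- by rewrite !mulr_ge0// ltW.
- by rewrite s0.
set k := size es in es0 *.
have -> : grad_cst_near cm k * A * (r + eta) `^ ((s - k%:R) / 2) =
    grad_cst k * (3 * ka * A) * (ka ^+ k * (r + eta) `^ ((s - k%:R) / 2)).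
  by rewrite /grad_cst_near -/ka exprS; ring.
rewrite ler_wpM2l ?mulr_ge0 ?grad_cst_ge0 ?(ltW ka0)//.
have k1 : 1 <= k%:R :> R by rewrite ler1n.
pose b := (k%:R - s) / 2; have b0 : 0 <= b by rewrite divr_ge0// subr_ge0; lra.
have -> : (s - k%:R) / 2 = - b by rewrite /b; ring.
have re0 : 0 < r + eta by rewrite ltr_wpDl.
have cre0 : 0 < c * r + eta by rewrite ltr_wpDl// mulr_ge0// ltW.
rewrite !powRN -ler_pdivrMl ?exprn_gt0//.
rewrite -invfM lef_pV2 ?posrE ?mulr_gt0 ?exprn_gt0 ?powR_gt0//.
apply: (@le_trans _ _ ((ka * (c * r + eta)) `^ b)).
  apply: (ge0_ler_powR b0); rewrite ?nnegrE ?(ltW re0) ?mulr_ge0 ?(ltW cre0) ?(ltW ka0)//.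
  have : eta <= ka * eta by rewrite ler_peMl// ltW.
  by rewrite mulrDr; lra.
rewrite powRM ?(ltW ka0) ?(ltW cre0)// ler_wpM2r ?powR_ge0//.
rewrite -(powR_mulrn k) ?(ltW ka0)// ler_powR// /b.
by rewrite ler_pdivrMr//; lra.
Qed.

End WeightedHeat.

(** * Schauder estimates by freezing the coefficient *)

Section Schauder.
Variables (R : realType) (G : finZmodType) (D : finType) (o : D -> D) (d : D -> G) (N : R).
Hypotheses (oK : involutive o) (dN : forall e, d (o e) = - d e) (N1 : 1 <= N).
Implicit Types (g h : G -> R) (e : D) (es : seq D) (x y : G) (t s : R).
Local Notation fdiff := (fdiff d N).
Local Notation fdiffs := (fdiffs d N).
Local Notation flap := (flap d N).
Local Notation heat := (heat d N).
Variables (q : G -> R) (Cq : R).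
Hypotheses (q_ge0 : forall x, 0 <= q x) (q0 : q 0 = 0).
Hypothesis qD : forall x y, q (x + y) <= 2 * (q x + q y).
Hypothesis q_step : forall e (j : nat), q (d e *+ j) <= (j%:R / N) ^+ 2.
Hypotheses (Cq0 : 0 <= Cq) (flap_q : forall x, flap q x <= Cq).
Local Notation eta := (N ^- 2).

Let N0 : 0 < N. Proof. exact: lt_le_trans N1. Qed.
Let q_step1 e : q (d e) <= eta.
Proof. by have := q_step e 1; rewrite mulr1n mul1r exprVn. Qed.

Lemma is_derive_fdiffs es (v : R -> G -> R) (dv : G -> R) s x :
  (forall y, is_derive s 1 (v^~ y) (dv y)) ->
  is_derive s 1 (fun s => fdiffs es (v s) x) (fdiffs es dv x).
Proof.
move=> Dv; elim: es x => [//|e es IH] x.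
exact: (is_derive_cmulf N (is_derive_subf (IH (x + d e)) (IH x))).
Qed.

Lemma continuous_fdiffs es (v : R -> G -> R) x :
  (forall y, continuous (v^~ y)) -> continuous (fun s => fdiffs es (v s) x).
Proof.
move=> cv; elim: es x => [//|e es IH] x s.
by apply: cvgM; [exact: cvg_cst|apply: cvgB; exact: IH].
Qed.

Lemma telescope_fdiff e h x (j : nat) (B : R) :
  (forall i, (i < j)%N -> `|fdiff e h (x + d e *+ i)| <= B) ->
  `|h (x + d e *+ j) - h x| <= j%:R / N * B.
Proof.
elim: j => [|j IH] hB; first by rewrite mulr0n addr0 subrr normr0 !mul0r.
have -> : h (x + d e *+ j.+1) - h x = N^-1 * fdiff e h (x + d e *+ j)
   + (h (x + d e *+ j) - h x).
  rewrite /fdiff mulrA mulVf ?gt_eqF// mul1r mulrSr addrA; ring.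
apply: (le_trans (ler_normD _ _)).
have := IH (fun i ij => hB i (ltnW ij)).
have : `|N^-1 * fdiff e h (x + d e *+ j)| <= N^-1 * B.
  by rewrite normrM gtr0_norm ?invr_gt0// ler_wpM2l ?invr_ge0 ?(ltW N0)// hB.
by rewrite -[j.+1%:R]natr1 !mulrDl mul1r; lra.
Qed.

Variables (T um up cm L sigma H Kf : R).
Hypotheses (cm0 : 0 < cm) (sigma01 : 0 < sigma < 1).
Hypotheses (L0 : 0 <= L) (H0 : 0 <= H) (Kf0 : 0 <= Kf).
Variables (phi dphi : R -> R) (u b : R -> G -> R).
Local Notation I v := (um <= v <= up).
Hypothesis dphi_ge : forall v, I v -> cm <= dphi v.
Hypothesis dphi_lip : forall v w, I v -> I w -> `|dphi v - dphi w| <= L * `|v - w|.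
Hypothesis phi_taylor : forall v w z, I v -> I w -> I z ->
  `|phi w - phi v - dphi z * (w - v)| <= L * (`|v - z| + `|w - z|) * `|w - v|.
Hypothesis uI : forall t x, 0 <= t <= T -> I (u t x).
Hypothesis cu : forall x, continuous (u^~ x).
Hypothesis Du : forall t x, 0 < t < T ->
  is_derive t 1 (u^~ x) (flap (fun y => phi (u t y)) x + b t x).
Hypothesis bK : forall t x, 0 <= t <= T -> `|b t x| <= Kf.
Hypothesis u_holder : forall t s x y, 0 <= t <= T -> 0 <= s <= T ->
  `|u t x - u s y| <= H * (`|t - s| + q (x - y)) `^ (sigma / 2).

(* With the coefficient frozen to [a], [heat (a * r) (u (t - r))] has the
   [r]-derivative [- heat (a * r) (frozen_source a (t - r))]. *)
Definition frozen_source (a t : R) : G -> R :=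
  fun y => flap (fun y => phi (u t y) - a * u t y) y + b t y.

Definition frozen (a t0 r : R) : G -> R := heat (a * r) (u (t0 - r)).

Lemma is_derive_frozen es a t0 r x : 0 < a -> 0 < r < t0 -> t0 <= T ->
  is_derive r 1 (fun r => fdiffs es (frozen a t0 r) x)
    (- fdiffs es (heat (a * r) (frozen_source a (t0 - r))) x).
Proof.
move=> a0 /andP[r0 rt] tT.
have Ds : is_derive r 1 (fun r => t0 - r) (-1).
  by have := is_derive_subf (is_derive_cstf t0 r) (is_derive_id r (1 : R)); rewrite sub0r.
have Da : is_derive r 1 (fun r => a * r) a.
  by have := is_derive_cmulf a (is_derive_id r (1 : R)); rewrite mulr1.
have tr : 0 < t0 - r < T.
  by rewrite subr_gt0 rt (lt_le_trans _ tT)// gtrBl.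
have Dv y := is_derive_compf (g := fun r => t0 - r) (Du y tr) Ds.
have ar : 0 < a * r by rewrite mulr_gt0.
have Dh y := @is_derive_heat R G D o d N oK dN _ _ (fun r => u (t0 - r)) _ r y ar Da Dv.
apply: is_derive_eq (is_derive_fdiffs es x Dh) _.
have -> : - fdiffs es (heat (a * r) (frozen_source a (t0 - r))) x =
  -1 * fdiffs es (heat (a * r) (frozen_source a (t0 - r))) x
  + 0 * fdiffs es (heat (a * r) (frozen_source a (t0 - r))) x by ring.
rewrite -fdiffs_lin; congr (fdiffs es _ x); apply/funext => y.
rewrite -heat_lin; congr (heat _ _ y); apply/funext => z.
rewrite /frozen_source.
have -> : flap (fun y => phi (u (t0 - r) y) - a * u (t0 - r) y) z =
   1 * flap (fun y => phi (u (t0 - r) y)) z + - a * flap (u (t0 - r)) z.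
  by rewrite -flap_lin; congr (flap _ z); apply/funext => z'; ring.
by ring.
Qed.

Lemma continuous_frozen es a t0 x :
  continuous (fun r => fdiffs es (frozen a t0 r) x).
Proof.
apply: (@continuous_fdiffs es (frozen a t0)) => y.
apply: (@continuous_heat _ _ _ _ _ (fun r => a * r) (fun r => u (t0 - r))) => [r|z r].
  by apply: cvgM; [exact: cvg_cst|exact: cvg_id].
have c1 : {for r, continuous (fun r : R => t0 - r)}.
  by apply: cvgB; [exact: cvg_cst|exact: cvg_id].
have c2 : {for t0 - r, continuous (u^~ z)} by exact: cu.
exact: (continuous_comp c1 c2).
Qed.

(** The first term comes from the divergence, with one difference more than the [k] given ones, the
    others from [b]. The last [2] covers [k = 0], where [b] is bounded by the maximum principle
    because the gradient bounds require a difference. *)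
Definition source_cst (k : nat) : R :=
  2 * #|D|%:R * grad_cst_near Cq cm k.+1 + 2 * grad_cst_near Cq cm k + 2.

Variable Gd : R.
Hypothesis u_grad : forall t e x, 0 <= t <= T -> `|fdiff e (u t) x| <= Gd.

Hypothesis Gd0 : 0 <= Gd.

Lemma perturbation_bound t0 x0 r e y : 0 <= r <= t0 -> t0 <= T ->
  `|fdiff e (fun y => phi (u (t0 - r) y) - dphi (u t0 x0) * u (t0 - r) y) y|
    <= 3 * H * L * Gd * (r + eta + q (y - x0)) `^ (sigma / 2).
Proof.
move=> /andP[r0 rt] tT.
have t00 : 0 <= t0 <= T by rewrite (le_trans r0 rt).
have tr : 0 <= t0 - r <= T by rewrite subr_ge0 rt (le_trans _ tT)// gerBl.
set v := u (t0 - r).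
set a := dphi _.
have -> : fdiff e (fun y => phi (v y) - a * v y) y =
    N * (phi (v (y + d e)) - phi (v y) - a * (v (y + d e) - v y)) by rewrite /fdiff; ring.
rewrite normrM (gtr0_norm N0).
have P := phi_taylor (uI y tr) (uI (y + d e) tr) (uI x0 t00).
have Gv : N * `|v (y + d e) - v y| <= Gd.
  by have := u_grad e y tr; rewrite /fdiff normrM (gtr0_norm N0).
have sg0 : 0 <= sigma / 2 by case/andP: sigma01 => s0 _; rewrite divr_ge0// ltW.
have eta0 : 0 < eta by rewrite invr_gt0 exprn_gt0.
set W := (r + eta + q (y - x0)) `^ (sigma / 2).
have B1 : `|v y - u t0 x0| <= H * W.
  apply: (le_trans (u_holder y x0 tr t00)); rewrite ler_wpM2l//.
  rewrite (_ : `|t0 - r - t0| = r); last by rewrite addrAC subrr add0r normrN ger0_norm.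
  apply: (ge0_ler_powR sg0); rewrite ?nnegrE ?addr_ge0// ?(ltW eta0)//.
  by rewrite lerD2r lerDl ltW.
have B2 : `|v (y + d e) - u t0 x0| <= 2 * H * W.
  apply: (le_trans (u_holder (y + d e) x0 tr t00)); rewrite (mulrC 2) -mulrA ler_wpM2l//.
  rewrite (_ : `|t0 - r - t0| = r); last by rewrite addrAC subrr add0r normrN ger0_norm.
  apply: (@le_trans _ _ ((2 * (r + eta + q (y - x0))) `^ (sigma / 2))).
    apply: (ge0_ler_powR sg0); rewrite ?nnegrE ?mulr_ge0 ?addr_ge0// ?(ltW eta0)//.
    have := qD (y - x0) (d e); have := q_step1 e.
    by rewrite (addrAC y); lra.
  rewrite powRM ?addr_ge0 ?(ltW eta0)// ler_wpM2r ?powR_ge0// ler1_powR//; first lra.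
  by case/andP: sigma01; lra.
apply: (@le_trans _ _ (N * (L * (`|v y - u t0 x0| + `|v (y + d e) - u t0 x0|) * `|v (y + d e) - v y|))).
  by rewrite ler_wpM2l// ltW.
rewrite mulrCA.
have -> : 3 * H * L * Gd * W = (L * (3 * H * W)) * Gd by ring.
apply: ler_pM => //; first by rewrite mulr_ge0// addr_ge0.
- by rewrite mulr_ge0// ltW.
- by rewrite ler_wpM2l//; lra.
Qed.

(** By [flapE] one difference of the Laplacian falls on the semigroup, at the price [r^(-1/2)], and
    the other on the perturbation, whose weight is worth [r^(sigma/2)]. Evaluation at points [z]
    other than [x0] serves the comparison of two points under one frozen coefficient. *)
Lemma source_bound es t0 x0 r z : 0 < r <= t0 -> r <= 1 -> t0 <= T ->
  q (z - x0) <= r ->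
  `|fdiffs es (heat (dphi (u t0 x0) * r) (frozen_source (dphi (u t0 x0)) (t0 - r))) z|
   <= source_cst (size es) * (H * L * Gd + Kf) * r `^ ((sigma - 1 - (size es)%:R) / 2).
Proof.
move=> /andP[r0 rt] r1 tT zx.
have t00 : 0 <= t0 <= T by rewrite (le_trans (ltW r0) rt).
have tr : 0 <= t0 - r <= T by rewrite subr_ge0 rt (le_trans _ tT)// gerBl ltW.
have eta0 : 0 < eta by rewrite invr_gt0 exprn_gt0.
have eta1 : eta <= 1 by rewrite invf_le1 ?exprn_gt0// exprn_ege1.
have /andP[s0 s1] := sigma01.
set a := dphi (u t0 x0); have ca : cm <= a by exact/dphi_ge/uI.
have a0 : 0 < a by exact: lt_le_trans ca.
set k := size es.
pose B := H * L * Gd + Kf.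
have HLG0 : 0 <= H * L * Gd by rewrite !mulr_ge0.
have B0 : 0 <= B by rewrite addr_ge0.
set ex := (sigma - 1 - k%:R) / 2.
have k0 : 0 <= k%:R :> R by [].
have ex0 : 0 <= - ex by rewrite /ex; lra.
set W := r `^ ex; have W0 : 0 <= W by exact: powR_ge0.
pose rho := r + eta; have rho0 : 0 < rho by rewrite addr_gt0.
have rhoW : rho `^ ex <= W.
  rewrite /W -[ex]opprK !(powRN _ (- ex)) lef_pV2 ?posrE ?powR_gt0//.
  by rewrite (ge0_ler_powR ex0) ?nnegrE ?ltW// /rho ltrDl.
have gc0 j : 0 <= grad_cst_near Cq cm j.
  by rewrite !mulr_ge0 ?grad_cst_ge0// exprn_ge0// addr_ge0// invr_ge0 ltW.
pose w := fun y => phi (u (t0 - r) y) - a * u (t0 - r) y.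
have E1 : fdiffs es (heat (a * r) (frozen_source a (t0 - r))) z =
    - 2^-1 * \sum_e fdiffs (o e :: es) (heat (a * r) (fdiff e w)) z
    + fdiffs es (heat (a * r) (b (t0 - r))) z.
  have -> : \sum_e fdiffs (o e :: es) (heat (a * r) (fdiff e w)) z =
      \sum_e fdiff (o e) (fdiff e (fdiffs es (heat (a * r) w))) z.
    apply: eq_bigr => e _ /=; congr (fdiff _ _ z).
    by rewrite -fdiff_heat -/(fdiffs _ _) fdiffs_fdiff.
  rewrite -(flapE N oK dN) -fdiffs_flap flap_heat.
  rewrite -[X in _ = X + _]mul1r -[X in _ = _ + X]mul1r -fdiffs_lin.
  congr (fdiffs es _ z); apply/funext => y; rewrite -heat_lin.
  by congr (heat _ _ y); apply/funext => y'; rewrite /frozen_source !mul1r.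
have H1 e : `|fdiffs (o e :: es) (heat (a * r) (fdiff e w)) z| <=
     grad_cst_near Cq cm k.+1 * (3 * B) * W.
  have A0 : 0 <= 3 * H * L * Gd by rewrite !mulr_ge0.
  have s01 : 0 <= sigma <= 1 by rewrite !ltW.
  have := @heat_grad_weight_near R G D o d N oK dN N0 q Cq q_ge0 q0 qD q_step1 Cq0 flap_q
    (o e :: es) cm a r sigma (3 * H * L * Gd) (fdiff e w) x0 z cm0 ca (ltW r0) A0 s01 isT zx.
  move=> P; apply: (le_trans (P _)) => [y|].
    by apply: perturbation_bound => //; rewrite ltW.
  rewrite /= -/k (_ : (sigma - k.+1%:R) / 2 = ex); last by rewrite /ex -natr1; ring.
  apply: ler_pM; [by rewrite mulr_ge0|exact: powR_ge0| |exact: rhoW].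
  by rewrite ler_wpM2l// /B; have := Kf0; lra.
(* The term [b] has a weaker singularity than the divergence term; since [rho <= 2], which uses
   [r <= 1], it fits under the same power of [r]. *)
have rhoK : rho `^ (- (k%:R / 2)) <= 2 * W.
  have -> : - (k%:R / 2) = ex + (1 - sigma) / 2 by rewrite /ex; field.
  rewrite powRD ?(gt_eqF rho0) ?implybT// mulrC ler_pM ?powR_ge0//.
  apply: (@le_trans _ _ (2 `^ ((1 - sigma) / 2))).
    by apply: ge0_ler_powR; rewrite ?nnegrE ?(ltW rho0)//; [lra|rewrite /rho; lra].
  by apply: ler1_powR; lra.
have H2 : `|fdiffs es (heat (a * r) (b (t0 - r))) z| <=
    (2 * grad_cst_near Cq cm k + 2) * B * W.
  have [k0'|kpos] := posnP k.
    rewrite (size0nil k0') /=.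
    have ar0 : 0 <= a * r by rewrite mulr_ge0 ?ltW.
    apply: (le_trans (@heat_bound R G D o d N oK dN _ _ _ Kf ar0 _)) => [y|].
      exact: bK.
    have : 1 <= 2 * W by move: rhoK; rewrite k0' mul0r oppr0 powRr0.
    have : 0 <= grad_cst_near Cq cm k * (B * W) by rewrite mulr_ge0// mulr_ge0.
    have KB : Kf <= B by rewrite /B lerDr.
    move=> gW W1; apply: (@le_trans _ _ (B * (2 * W))); last by lra.
    by rewrite -[leLHS]mulr1 ler_pM.
  have z01 : 0 <= (0 : R) <= 1 by rewrite lexx ler01.
  have := @heat_grad_weight_near R G D o d N oK dN N0 q Cq q_ge0 q0 qD q_step1 Cq0 flap_q
    es cm a r 0 Kf (b (t0 - r)) x0 z cm0 ca (ltW r0) Kf0 z01 kpos zx.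
  move=> P; apply: (le_trans (P _)) => [y|].
    by rewrite mul0r powRr0 mulr1; exact: bK.
  rewrite -/k sub0r mulNr; apply: (@le_trans _ _ (grad_cst_near Cq cm k * B * (2 * W))).
    apply: ler_pM; [by rewrite mulr_ge0|exact: powR_ge0| |exact: rhoK].
    by rewrite ler_wpM2l// /B; have := Kf0; lra.
  have : 0 <= B * W by rewrite mulr_ge0.
  lra.
rewrite E1 (le_trans (ler_normD _ _))//.
have H3 : `|- 2^-1 * \sum_e fdiffs (o e :: es) (heat (a * r) (fdiff e w)) z| <=
   2 * #|D|%:R * grad_cst_near Cq cm k.+1 * B * W.
  rewrite normrM normrN (@ger0_norm _ (2^-1)) ?invr_ge0//.
  apply: (@le_trans _ _ (2^-1 * \sum_(e : D) (grad_cst_near Cq cm k.+1 * (3 * B) * W))).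
    rewrite ler_wpM2l ?invr_ge0// (le_trans (ler_norm_sum _ _ _))//.
    by apply: ler_sum => e _; exact: H1.
  rewrite sumr_const -mulr_natl.
  have : 0 <= #|D|%:R * (grad_cst_near Cq cm k.+1 * B * W) by rewrite mulr_ge0// mulr_ge0// mulr_ge0.
  lra.
have := lerD H3 H2; rewrite /source_cst -/k -/B; lra.
Qed.

Lemma frozen0 a t0 : frozen a t0 0 = u t0.
Proof. by rewrite /frozen mulr0 heat0 subr0. Qed.

Local Notation B := (H * L * Gd + Kf).

Let B0 : 0 <= B. Proof. by rewrite addr_ge0// !mulr_ge0. Qed.

Lemma grad_cst_near_ge0 k : 0 <= grad_cst_near Cq cm k.
Proof. by rewrite !mulr_ge0 ?grad_cst_ge0// exprn_ge0// addr_ge0// invr_ge0 ltW. Qed.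

Lemma source_cst_ge0 k : 0 <= source_cst k.
Proof. by rewrite /source_cst !addr_ge0 // mulr_ge0 ?grad_cst_near_ge0 // mulr_ge0. Qed.

(** With at most one difference the exponent in [source_bound] is greater than [-1], so the bound
    can be integrated from [r = 0], where [frozen] equals [u t0]. *)
Lemma frozen_increment es t0 x0 (tau : R) : (size es <= 1)%N ->
  0 <= tau <= t0 -> tau <= 1 -> t0 <= T ->
  `|fdiffs es (frozen (dphi (u t0 x0)) t0 tau) x0 - fdiffs es (u t0) x0|
    <= source_cst (size es) * B / ((sigma + 1 - (size es)%:R) / 2)
       * tau `^ ((sigma + 1 - (size es)%:R) / 2).
Proof.
move=> es1 /andP[tau0 taut] tau1 tT; have /andP[s0 s1] := sigma01.
have t00 : 0 <= t0 <= T by rewrite (le_trans tau0 taut).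
set a := dphi _; have ca : cm <= a by exact/dphi_ge/uI.
have a0 : 0 < a by exact: lt_le_trans ca.
have k1 : (size es)%:R <= 1 :> R by rewrite (ler_nat _ _ 1).
rewrite -[in X in _ - X](frozen0 a t0).
apply: (@powR_increment R (fun r => fdiffs es (frozen a t0 r) x0)
  (fun r => - fdiffs es (heat (a * r) (frozen_source a (t0 - r))) x0)
  (source_cst (size es) * B)) => //.
- by apply: divr_gt0 => //; lra.
- by rewrite mulr_ge0// source_cst_ge0.
- by apply: continuous_subspaceT; exact: continuous_frozen.
- move=> r /andP[r0 rt]; apply: is_derive_frozen => //.
  by rewrite r0 (lt_le_trans rt).
- move=> r /andP[r0 rt]; rewrite normrN.
  have -> : (sigma + 1 - (size es)%:R) / 2 - 1 = (sigma - 1 - (size es)%:R) / 2 by field.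
  apply: source_bound => //.
  + by rewrite r0 (le_trans (ltW rt)).
  + by rewrite (le_trans (ltW rt)).
  + by rewrite subrr q0 ltW.
Qed.

Variables (C0 U : R).
Hypotheses (u0_grad : forall e x, `|fdiff e (u 0) x| <= C0)
  (u0_hess : forall e e' x, `|fdiff e (fdiff e' (u 0)) x| <= C0).
Hypothesis u_bound : forall t x, 0 <= t <= T -> `|u t x| <= U.
Hypotheses (C00 : 0 <= C0) (U0 : 0 <= U).

Lemma heat_grad_bound e (a r A : R) g x : cm <= a -> 0 < r -> 0 <= A ->
  (forall y, `|g y| <= A) ->
  `|fdiff e (heat (a * r) g) x| <= grad_cst_near Cq cm 1 * A * r `^ (- 2^-1).
Proof.
move=> ca r0 A0 gA.
have eta0 : 0 < eta by rewrite invr_gt0 exprn_gt0.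
have z01 : 0 <= (0 : R) <= 1 by rewrite lexx ler01.
have xx : q (x - x) <= r by rewrite subrr q0 ltW.
have := @heat_grad_weight_near R G D o d N oK dN N0 q Cq q_ge0 q0 qD q_step1 Cq0 flap_q
    [:: e] cm a r 0 A g x x cm0 ca (ltW r0) A0 z01 isT xx.
move=> P; apply: (le_trans (P _)) => [y|].
  by rewrite mul0r powRr0 mulr1.
have gA0 := mulr_ge0 (grad_cst_near_ge0 1) A0.
rewrite ler_wpM2l//= sub0r mulN1r !powRN.
rewrite lef_pV2 ?posrE ?powR_gt0 ?addr_gt0//.
by apply: ge0_ler_powR; rewrite ?nnegrE ?addr_ge0 ?ltW// ltrDl.
Qed.

Lemma grad_estimate t0 e x (h : R) : 0 <= t0 <= T -> 0 < h <= 1 ->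
  `|fdiff e (u t0) x| <= C0 + grad_cst_near Cq cm 1 * U * h `^ (- 2^-1)
     + source_cst 1 * B / (sigma / 2) * h `^ (sigma / 2).
Proof.
move=> t00 /andP[h0 h1]; have /andP[t0_ge0 tT] := t00; have /andP[s0 s1] := sigma01.
set a := dphi (u t0 x); have ca : cm <= a by exact/dphi_ge/uI.
(* When less than [h] of the past is available, one goes back to time [0] and uses the initial
   gradient in place of the smoothing of the semigroup. *)
pose tau := Num.min h t0.
have tau0 : 0 <= tau <= t0 by rewrite le_min (ltW h0) t0_ge0 ge_min lexx orbT.
have tauh : tau <= h by rewrite ge_min lexx.
have := @frozen_increment [:: e] t0 x tau isT tau0 (le_trans tauh h1) tT.
rewrite /= (_ : (sigma + 1 - 1) / 2 = sigma / 2); last by rewrite addrK.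
rewrite -/a distrC => F.
have F1 : source_cst 1 * B / (sigma / 2) * tau `^ (sigma / 2) <=
    source_cst 1 * B / (sigma / 2) * h `^ (sigma / 2).
  have sB0 := mulr_ge0 (source_cst_ge0 1) B0.
  rewrite ler_wpM2l ?divr_ge0 ?(ltW s0)//.
  by apply: ge0_ler_powR; rewrite ?nnegrE ?divr_ge0 ?(ltW s0) ?(ltW h0)//; case/andP: tau0.
have F2 : `|fdiff e (frozen a t0 tau) x| <= C0 + grad_cst_near Cq cm 1 * U * h `^ (- 2^-1).
  have gU : 0 <= grad_cst_near Cq cm 1 * U * h `^ (- 2^-1).
    by rewrite mulr_ge0 ?powR_ge0// (mulr_ge0 (grad_cst_near_ge0 1)).
  rewrite /tau; have [ht|th] := leP h t0.
    apply: (@le_trans _ _ (grad_cst_near Cq cm 1 * U * h `^ (- 2^-1))); last by rewrite lerDr.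
    apply: heat_grad_bound => // y; apply: u_bound.
    by rewrite subr_ge0 ht (le_trans _ tT)// gerBl ltW.
  apply: (@le_trans _ _ C0); last by rewrite lerDl.
  rewrite /frozen subrr fdiff_heat (@heat_bound R G D o d N oK dN)//.
  by rewrite mulr_ge0// (le_trans (ltW cm0)).
have -> : fdiff e (u t0) x = (fdiff e (u t0) x - fdiff e (frozen a t0 tau) x) +
    fdiff e (frozen a t0 tau) x by rewrite subrK.
apply: (le_trans (ler_normD _ _)); lra.
Qed.

Definition heat_time_cst : R := #|D|%:R / 2 * grad_cst Cq 2.

(** Two frozen coefficients run the same semigroup up to different times. The difference is governed
    by the Laplacian of [heat t g], of size [A / t] by the gradient bound with two differences and
    trivial weight. *)
Lemma heat_time_diff g x (A th0 th1 th2 : R) : 0 < th0 -> th0 <= th1 <= th2 -> 0 <= A ->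
  (forall y, `|g y| <= A) ->
  `|heat th2 g x - heat th1 g x| <= heat_time_cst * A / th0 * (th2 - th1).
Proof.
move=> t0 /andP[t01 t12] A0 gA.
have eta0 : 0 < eta by rewrite invr_gt0 exprn_gt0.
rewrite mulrBr.
have t1 : 0 < th1 by exact: lt_le_trans t01.
apply: (@dominated_increment R (fun t => heat t g x)
  (fun t => heat_time_cst * A / th0 * t) (fun t => heat t (flap g) x)
  (fun=> heat_time_cst * A / th0) th1 th2 t12) => [||t /andP[tt1 _]|t _|t /andP[tt1 _]].
- apply: continuous_subspaceT; apply: (@continuous_heat _ _ _ _ _ id (fun _ => g)) => [y|z y].
    exact: cvg_id.
  exact: cst_continuous.
- by apply: continuous_subspaceT => y; apply: cvgM; [exact: cvg_cst|exact: cvg_id].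
- by apply: is_derive_heat_time => //; exact: lt_trans tt1.
- by apply: is_derive_eq (is_derive_cmulf _ (is_derive_id t (1 : R))) _; rewrite mulr1.
have t_0 : 0 < t by exact: lt_trans tt1.
rewrite -flap_heat (flapE N oK dN) normrM normrN (@ger0_norm _ 2^-1) ?invr_ge0//.
rewrite /heat_time_cst.
have -> : #|D|%:R / 2 * grad_cst Cq 2 * A / th0 =
    2^-1 * \sum_(e : D) (grad_cst Cq 2 * A / th0).
  by rewrite sumr_const -mulr_natl; ring.
rewrite ler_wpM2l ?invr_ge0// (le_trans (ler_norm_sum _ _ _))//.
apply: ler_sum => e _.
have z01 : 0 <= (0 : R) <= 1 by rewrite lexx ler01.
have := @heat_grad_weight R G D o d N oK dN N0 q Cq q_ge0 q0 qD q_step1 Cq0 flap_q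
    [:: o e; e] t g x A 0 (ltW t_0) A0 z01 isT.
move=> P; apply: (le_trans (P _)) => [y|]; first by rewrite mul0r powRr0 mulr1.
have gA0 := mulr_ge0 (grad_cst_ge0 Cq0 2) A0.
rewrite ler_wpM2l//= (_ : (0 - 2) / 2 = - 1); last by field.
have tn0 : 0 < t + eta by rewrite addr_gt0.
rewrite powR_inv1 ?(ltW tn0)//.
rewrite lef_pV2 ?posrE//.
by rewrite (le_trans t01)// (le_trans (ltW tt1))// lerDl ltW.
Qed.

(** Up to the parabolic time [rho ^+ 2] each point keeps its own coefficient. There [a'] is
    exchanged for [a], and what remains is the space increment of a single frozen function. *)
Lemma space_increment t e e' x (j : nat) (h : R) : 0 <= t <= T -> 0 < h <= 1 ->
  (0 < j)%N -> (j%:R / N) ^+ 2 <= h ->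
  `|fdiff e (u t) (x + d e' *+ j) - fdiff e (u t) x| <=
    (2 * (source_cst 1 * B / (sigma / 2)) + heat_time_cst * Gd / cm * (L * H)
      + source_cst 2 * B / ((1 - sigma) / 2)) * (j%:R / N) `^ sigma
    + (grad_cst_near Cq cm 1 * Gd * h `^ (- 2^-1) + C0) * (j%:R / N).
Proof.
move=> t0T /andP[h0 h1] j0 jh.
have /andP[t0 tT] := t0T; have /andP[s0 s1] := sigma01.
pose rho := j%:R / N; rewrite -/rho in jh *.
have rho0 : 0 < rho by rewrite divr_gt0// ltr0n.
set x' := x + d e' *+ j.
have xx' : q (x' - x) <= rho ^+ 2 by rewrite /x' addrAC subrr add0r q_step.
set a := dphi (u t x); have ca : cm <= a by exact/dphi_ge/uI.
set a' := dphi (u t x'); have ca' : cm <= a' by exact/dphi_ge/uI.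
have rho2 : 0 < rho ^+ 2 by rewrite exprn_gt0.
have powrho p : (rho ^+ 2) `^ (p / 2) = rho `^ p.
  by rewrite -(powR_mulrn 2) ?(ltW rho0)// -powRrM; congr (_ `^ _); field.
pose tau := Num.min (rho ^+ 2) t.
have tau0 : 0 <= tau <= t by rewrite le_min (ltW rho2) t0 ge_min lexx orbT.
have taur : tau <= rho ^+ 2 by rewrite ge_min lexx.
have tau1 : tau <= 1 by rewrite (le_trans taur)// (le_trans jh).
pose X1 := source_cst 1 * B / (sigma / 2) * rho `^ sigma.
have sB0 := mulr_ge0 (source_cst_ge0 1) B0.
have near_part y : `|fdiff e (frozen (dphi (u t y)) t tau) y - fdiff e (u t) y| <= X1.
  have := @frozen_increment [:: e] t y tau isT tau0 tau1 tT.
  rewrite /= (_ : (sigma + 1 - 1) / 2 = sigma / 2); last by rewrite addrK.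
  move=> P; apply: (le_trans P); rewrite /X1 -powrho.
  rewrite ler_wpM2l ?divr_ge0 ?(ltW s0)//.
  by apply: ge0_ler_powR; rewrite ?nnegrE ?divr_ge0 ?(ltW s0) ?(ltW rho2)//; case/andP: tau0.
have aa' : `|a' - a| <= L * H * rho `^ sigma.
  apply: (le_trans (dphi_lip (uI x' t0T) (uI x t0T))).
  rewrite -mulrA ler_wpM2l//; apply: (le_trans (u_holder x' x t0T t0T)).
  rewrite subrr normr0 add0r ler_wpM2l// -powrho.
  by apply: ge0_ler_powR; rewrite ?nnegrE ?divr_ge0 ?(ltW s0) ?(ltW rho2).
(* The clocks [a' * tau] and [a * tau] differ by a fraction of order [rho^sigma], so the factor
   [tau] cancels against the [1 / (cm * tau)] of [heat_time_diff]. *)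
have change : `|fdiff e (frozen a' t tau) x' - fdiff e (frozen a t tau) x'| <=
    heat_time_cst * Gd / cm * (L * H) * rho `^ sigma.
  have taug : 0 <= t - tau <= T.
    by case/andP: tau0 => tau00 taut; rewrite subr_ge0 taut (le_trans _ tT)// gerBl.
  have [tau_eq0|tau_neq0] := eqVneq tau 0.
    rewrite /frozen tau_eq0 !mulr0 subrr normr0.
    by rewrite !mulr_ge0 ?powR_ge0 ?invr_ge0 ?(ltW cm0)// grad_cst_ge0.
  have taupos : 0 < tau by rewrite lt_neqAle eq_sym tau_neq0; case/andP: tau0.
  have ht0 : 0 <= heat_time_cst * Gd / cm.
    by rewrite divr_ge0 ?(ltW cm0)// mulr_ge0// mulr_ge0 ?grad_cst_ge0.
  have mono b1 b2 : cm <= b1 <= b2 ->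
      `|heat (b2 * tau) (fdiff e (u (t - tau))) x'
        - heat (b1 * tau) (fdiff e (u (t - tau))) x'| <= heat_time_cst * Gd / cm * (b2 - b1).
    move=> /andP[cb1 b12].
    have ct0 : 0 < cm * tau by rewrite mulr_gt0.
    have b12t : cm * tau <= b1 * tau <= b2 * tau by rewrite !ler_pM2r// cb1.
    apply: (le_trans (@heat_time_diff _ x' Gd _ _ _ ct0 b12t Gd0 (fun y => u_grad e y taug))).
    by rewrite le_eqVlt; apply/orP; left; apply/eqP; field; rewrite !gt_eqF.
  apply: (@le_trans _ _ (heat_time_cst * Gd / cm * `|a' - a|)); last first.
    by rewrite -[leRHS]mulrA ler_wpM2l.
  rewrite /frozen !fdiff_heat; have [aa|aa] := leP a a'.
    by rewrite (@ger0_norm _ (a' - a)) ?subr_ge0// mono// ca.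
  by rewrite distrC (@ltr0_norm _ (a' - a)) ?subr_lt0// opprB mono// ca' ltW.
(* The increment is carried on to the time [tau2]. There it is bounded either by the smoothing over
   time [h] of the already bounded gradient, or by the second differences of the initial datum. *)
have far : `|fdiff e (frozen a t tau) x' - fdiff e (frozen a t tau) x| <=
    source_cst 2 * B / ((1 - sigma) / 2) * rho `^ sigma +
    (grad_cst_near Cq cm 1 * Gd * h `^ (- 2^-1) + C0) * rho.
  have a0 : 0 < a by exact: lt_le_trans ca.
  pose gh := grad_cst_near Cq cm 1 * Gd * h `^ (- 2^-1).
  have gh0 : 0 <= gh by rewrite mulr_ge0 ?powR_ge0// (mulr_ge0 (grad_cst_near_ge0 1)).
  set Z := source_cst 2 * B / ((1 - sigma) / 2) * rho `^ sigma.
  have sc0 : 0 <= Z.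
    rewrite mulr_ge0 ?powR_ge0// divr_ge0//; last by lra.
    exact: mulr_ge0 (source_cst_ge0 2) B0.
  have initial r : r = t ->
      `|fdiff e (frozen a t r) x' - fdiff e (frozen a t r) x| <= rho * C0.
    move=> ->; apply: telescope_fdiff => i _.
    rewrite /frozen subrr !fdiff_heat (@heat_bound R G D o d N oK dN)//.
    by rewrite mulr_ge0// (le_trans (ltW cm0)).
  rewrite -/gh mulrDl; have [rt|tr] := leP (rho ^+ 2) t; last first.
    have -> : tau = t by rewrite /tau min_r// ltW.
    have := initial t erefl.
    have : 0 <= gh * rho by rewrite mulr_ge0// ltW.
    lra.
  have -> : tau = rho ^+ 2 by rewrite /tau min_l.
  pose tau2 := Num.min h t.
  have tau2r : rho ^+ 2 <= tau2 by rewrite le_min jh.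
  have tau2t : tau2 <= t by rewrite ge_min lexx orbT.
  have tau2h : tau2 <= h by rewrite ge_min lexx.
  have E2 : `|fdiff e (frozen a t tau2) x' - fdiff e (frozen a t tau2) x| <= gh * rho + C0 * rho.
    rewrite /tau2; have [ht|th] := leP h t; last first.
      have := initial t erefl.
      have : 0 <= gh * rho by rewrite mulr_ge0// ltW.
      lra.
    apply: (@le_trans _ _ (rho * gh)); last first.
      by rewrite mulrC lerDl mulr_ge0// ltW.
    apply: telescope_fdiff => i _.
    rewrite /frozen fdiff_heat; apply: heat_grad_bound => // y; apply: u_grad.
    by rewrite subr_ge0 ht (le_trans _ tT)// gerBl ltW.
  (* Telescoping from [x] to [x'] gives a factor [rho] and a second difference, of size
     [r^((sigma-3)/2)]. Its integral from [rho ^+ 2] on is of order [rho^(sigma-1)], so the product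
     is of order [rho^sigma]. *)
  have E1 := @powRN_increment R
    (fun r => fdiffs [:: e] (frozen a t r) x' - fdiffs [:: e] (frozen a t r) x)
    (fun r => - fdiffs [:: e] (heat (a * r) (frozen_source a (t - r))) x' -
      - fdiffs [:: e] (heat (a * r) (frozen_source a (t - r))) x)
    (rho * (source_cst 2 * B)) ((1 - sigma) / 2) (rho ^+ 2) tau2 rho2 tau2r.
  have {}E1 := E1 _ _ _ _ _.
  have E3 : `|(fdiff e (frozen a t tau2) x' - fdiff e (frozen a t tau2) x) -
     (fdiff e (frozen a t (rho ^+ 2)) x' - fdiff e (frozen a t (rho ^+ 2)) x)|
     <= Z.
    have -> : Z =
        rho * (source_cst 2 * B) / ((1 - sigma) / 2) * (rho ^+ 2) `^ (- ((1 - sigma) / 2)).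
      rewrite /Z; have -> : - ((1 - sigma) / 2) = (sigma - 1) / 2 by ring.
      rewrite powrho powRB ?(gt_eqF rho0) ?implybT// powRr1 ?(ltW rho0)//.
      field.
      by apply/andP; split; [rewrite gt_eqF|apply/eqP; lra].
    apply: E1.
    - by apply: divr_gt0 => //; lra.
    - by rewrite mulr_ge0 ?(ltW rho0)// (mulr_ge0 (source_cst_ge0 2)).
    - by apply: continuous_subspaceT => r; apply: cvgB; exact: continuous_frozen.
    - move=> r /andP[r1 r2]; apply: is_derive_subf; apply: is_derive_frozen => //.
      + by rewrite (lt_trans rho2 r1) (lt_le_trans r2).
      + by rewrite (lt_trans rho2 r1) (lt_le_trans r2).
    move=> r /andP[r1 r2]; rewrite -opprD normrN -(mulrA rho).
    apply: telescope_fdiff => i ij.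
    have -> : - ((1 - sigma) / 2) - 1 = (sigma - 1 - (size [:: e'; e])%:R) / 2 by rewrite /=; field.
    apply: (@source_bound [:: e'; e]) => //.
    + by rewrite (lt_trans rho2 r1) (le_trans (ltW r2)).
    + by rewrite (le_trans (ltW r2))// (le_trans tau2h).
    (* The intermediate points stay within [rho] of the freezing point [x], and [rho ^+ 2 < r] is
       what [source_bound] asks of them. *)
    rewrite addrAC subrr add0r (le_trans (q_step _ _))// (le_trans _ (ltW r1))//.
    rewrite lerXn2r ?nnegrE ?divr_ge0 ?(ltW N0) ?(ltW rho0)//.
    by rewrite /rho ler_pM2r ?invr_gt0// ler_nat ltnW.
  rewrite -[X in `|X|](subrK (fdiff e (frozen a t tau2) x' - fdiff e (frozen a t tau2) x)).
  rewrite (le_trans (ler_normD _ _))// distrC.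
  by move: E2 E3; lra.
have n1 := near_part x; have n2 := near_part x'.
rewrite -/a in n1; rewrite -/a' in n2.
have -> : fdiff e (u t) x' - fdiff e (u t) x =
  - (fdiff e (frozen a' t tau) x' - fdiff e (u t) x')
  + (fdiff e (frozen a' t tau) x' - fdiff e (frozen a t tau) x')
  + (fdiff e (frozen a t tau) x' - fdiff e (frozen a t tau) x)
  + (fdiff e (frozen a t tau) x - fdiff e (u t) x) by ring.
rewrite -normrN in n2.
apply: (le_trans (ler_normD _ _)).
apply: (le_trans (lerD (ler_normD _ _) (lexx _))).
apply: (le_trans (lerD (lerD (ler_normD _ _) (lexx _)) (lexx _))).
by move: n1 n2 change far; rewrite /X1; lra.
Qed.

Variables (cp A : R).
Hypotheses (dphi_le : forall v, I v -> dphi v <= cp) (A0 : 0 <= A).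
Hypothesis grad_space : forall t e x y, 0 <= t <= T ->
  `|fdiff e (u t) y - fdiff e (u t) x| <= A * q (y - x) `^ (sigma / 2).

Let sg0 : 0 < sigma / 2.
Proof. by case/andP: sigma01 => ? _; rewrite divr_gt0. Qed.

Lemma grad_time_increment s t e x : 0 <= s <= t -> t <= T -> t - s <= 1 ->
  `|fdiff e (u t) x - fdiff e (u s) x| <=
    (source_cst 1 * B / (sigma / 2) + A * (1 + 2 * (Cq * cp))) * (t - s) `^ (sigma / 2).
Proof.
move=> /andP[s0 st] tT ts1; have /andP[sg sg1] := sigma01.
have t00 : 0 <= t <= T by rewrite (le_trans s0 st).
have s00 : 0 <= s <= T by rewrite s0 (le_trans st).
have [->|tns] := eqVneq t s.
  by rewrite !subrr normr0 powR0 ?mulr0// gt_eqF.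
pose tau := t - s; rewrite -/tau in ts1 *.
have tau0 : 0 < tau by rewrite subr_gt0 lt_neqAle eq_sym tns.
have taut : 0 <= tau <= t by rewrite (ltW tau0) gerBl.
set a := dphi (u t x); have ca : cm <= a by exact/dphi_ge/uI.
have a_cp : a <= cp by exact/dphi_le/uI.
have a0 : 0 < a by exact: lt_le_trans ca.
have := @frozen_increment [:: e] t x tau isT taut ts1 tT.
rewrite /= (_ : (sigma + 1 - 1) / 2 = sigma / 2) -/a; last by rewrite addrK.
rewrite /frozen fdiff_heat (_ : t - tau = s); last by rewrite /tau subKr.
set X := heat (a * tau) (fdiff e (u s)) x => F.
have : `|X - fdiff e (u s) x| <= A * (1 + 2 * (Cq * cp)) * tau `^ (sigma / 2).
  have at0 : 0 <= a * tau by rewrite mulr_ge0 ?ltW.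
  have -> : X - fdiff e (u s) x =
      heat (a * tau) (fun y => 1 * fdiff e (u s) y + (- 1) * fdiff e (u s) x) x.
    rewrite (heat_lin d N (a * tau) 1 (- 1) (fdiff e (u s)) (fun=> fdiff e (u s) x)).
    by rewrite (heat_cst N oK dN)// mul1r mulN1r.
  have s01 : 0 <= sigma / 2 <= 1 by rewrite ltW//=; lra.
  have := @heat_weight R G D o d N oK dN q Cq q_ge0 q0 qD flap_q (a * tau)
    (fun y => 1 * fdiff e (u s) y + (- 1) * fdiff e (u s) x) x x A tau (sigma / 2)
    at0 A0 tau0 s01.
  move=> P; apply: (le_trans (P _)) => [y|].
    rewrite mul1r mulN1r (le_trans (grad_space e x y s00))// ler_wpM2l//.
    apply: (ge0_ler_powR (ltW sg0)); rewrite ?nnegrE ?(addr_ge0 (ltW tau0))//.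
    by rewrite lerDr ltW.
  rewrite subrr q0 add0r (_ : 2 * (Cq * (a * tau)) / tau = 2 * (Cq * a)); last first.
    by field; rewrite gt_eqF.
  rewrite mulrAC ler_wpM2r ?powR_ge0// ler_wpM2l// lerD2l ler_wpM2l// ler_wpM2l//.
have -> : fdiff e (u t) x - fdiff e (u s) x =
  - (X - fdiff e (u t) x) + (X - fdiff e (u s) x) by ring.
move=> F2; rewrite (le_trans (ler_normD _ _))// normrN mulrDl.
exact: lerD.
Qed.

Definition time_cst (p : R) : R := #|D|%:R / 2 * grad_cst Cq 1 / p * (1 + cp).

Lemma u_time_increment s t x : 0 <= s <= t -> t <= T -> t - s <= 1 ->
  `|u t x - u s x| <=
    (source_cst 0 * B / ((sigma + 1) / 2) + time_cst ((sigma + 1) / 2) * A)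
     * (t - s) `^ ((sigma + 1) / 2).
Proof.
move=> /andP[s0 st] tT ts1; have /andP[sg sg1] := sigma01.
have t00 : 0 <= t <= T by rewrite (le_trans s0 st).
have s00 : 0 <= s <= T by rewrite s0 (le_trans st).
pose p := (sigma + 1) / 2; rewrite -/p.
have p0 : 0 < p by rewrite divr_gt0// addr_gt0.
have p1 : p <= 1 by rewrite /p; lra.
pose tau := t - s; rewrite -/tau in ts1 *.
have tau0 : 0 <= tau by rewrite subr_ge0.
have taut : 0 <= tau <= t by rewrite tau0 gerBl.
set a := dphi (u t x); have ca : cm <= a by exact/dphi_ge/uI.
have a_cp : a <= cp by exact/dphi_le/uI.
have a0 : 0 < a by exact: lt_le_trans ca.
have := @frozen_increment [::] t x tau isT taut ts1 tT.
rewrite /= subr0 -/a -/p.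
rewrite /frozen (_ : t - tau = s); last by rewrite /tau subKr.
set X := heat (a * tau) (u s) x => F.
have at0 : 0 <= a * tau by rewrite mulr_ge0 ?(ltW a0).
pose c1 := #|D|%:R / 2 * grad_cst Cq 1 * A.
have c10 : 0 <= c1 by rewrite mulr_ge0// mulr_ge0// grad_cst_ge0.
have F1 : `|X - u s x| <= c1 / p * (a * tau) `^ p.
  rewrite -[in X in _ - X](heat0 d N (u s)).
  apply: (@powR_increment R (fun r => heat r (u s) x) (fun r => heat r (flap (u s)) x)
    c1) => //.
  - apply: continuous_subspaceT; apply: (@continuous_heat _ _ _ _ _ id (fun _ => u s)) => [y|z y].
      exact: cvg_id.
    exact: cst_continuous.
  - by move=> r /andP[r0 _]; apply: is_derive_heat_time.
  move=> r /andP[r0 _].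
  have re0 : 0 < r + eta by rewrite addr_gt0// invr_gt0 exprn_gt0.
  rewrite -flap_heat (flapE N oK dN) normrM normrN (@ger0_norm _ 2^-1) ?invr_ge0//.
  have -> : c1 * r `^ (p - 1) = 2^-1 * \sum_(e : D) (grad_cst Cq 1 * A * r `^ (p - 1)).
    by rewrite sumr_const -(mulr_natl _ #|D|) /c1; ring.
  rewrite ler_wpM2l ?invr_ge0// (le_trans (ler_norm_sum _ _ _))//.
  apply: ler_sum => e _; rewrite fdiff_heat.
  (* Subtracting the value at [x] does not change differences but makes the datum small near [x],
     which produces the Hölder weight. *)
  pose g := fun y => 1 * fdiff e (u s) y + (- 1) * fdiff e (u s) x.
  have -> : fdiff (o e) (heat r (fdiff e (u s))) x = fdiffs [:: o e] (heat r g) x.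
    rewrite /= !fdiff_heat; congr (heat _ _ _); apply/funext => y.
    rewrite (fdiff_lin d N (o e) 1 (-1) (fdiff e (u s)) (fun=> fdiff e (u s) x)).
    by rewrite (_ : fdiff (o e) (fun=> fdiff e (u s) x) y = 0) ?mul1r ?mulr0 ?addr0// /fdiff subrr mulr0.
  have s01 : 0 <= sigma <= 1 by rewrite !ltW.
  have := @heat_grad_weight R G D o d N oK dN N0 q Cq q_ge0 q0 qD q_step1 Cq0 flap_q
    [:: o e] r g x A sigma (ltW r0) A0 s01 isT.
  move=> P; apply: (le_trans (P _)) => [y|].
    rewrite /g mul1r mulN1r (le_trans (grad_space e x y s00))// ler_wpM2l//.
    apply: (ge0_ler_powR (ltW sg0)); rewrite ?nnegrE ?(addr_ge0 (ltW re0))//.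
    by rewrite lerDr ltW.
  have gA0 := mulr_ge0 (grad_cst_ge0 Cq0 1) A0.
  rewrite ler_wpM2l//=.
  have -> : p - 1 = - ((1 - sigma) / 2) by rewrite /p; field.
  have -> : (sigma - 1) / 2 = - ((1 - sigma) / 2) by ring.
  have q1 : 0 <= (1 - sigma) / 2 by lra.
  rewrite !(powRN _ ((1 - sigma) / 2)) lef_pV2 ?posrE ?powR_gt0//.
  apply: (ge0_ler_powR q1); rewrite ?nnegrE ?(ltW re0) ?(ltW r0)//.
  by rewrite lerDl invr_ge0 exprn_ge0// ltW.
have F2 : c1 / p * (a * tau) `^ p <= time_cst p * A * tau `^ p.
  rewrite powRM ?(ltW a0)// mulrA ler_wpM2r ?powR_ge0//.
  have -> : time_cst p * A = c1 / p * (1 + cp) by rewrite /time_cst /c1; ring.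
  have c1p : 0 <= c1 / p := divr_ge0 c10 (ltW p0).
  rewrite ler_wpM2l//.
  apply: (@le_trans _ _ ((1 + a) `^ p)).
    by apply: (ge0_ler_powR (ltW p0)); rewrite ?nnegrE ?(addr_ge0 ler01) ?(ltW a0)// lerDr.
  rewrite (@le_trans _ _ (1 + a))// ?lerD2l//.
  by apply: ler1_powR => //; rewrite lerDl ltW.
have -> : u t x - u s x = - (X - u t x) + (X - u s x) by ring.
rewrite (le_trans (ler_normD _ _))// normrN mulrDl.
by apply: lerD => //; exact: le_trans F2.
Qed.

End Schauder.

Section SchauderConstants.
Variables (R : realType) (D : finType) (Cq cm cp L sigma C1 : R) (m : nat).
Local Notation s1 := (source_cst D Cq cm 1).
Local Notation g1 := (grad_cst_near Cq cm 1).

(* The coefficient is frozen on time intervals of length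
   [(scale_cst * M) `^ (- (2 / sigma))]: with this choice the supremum of the
   gradient appears with a factor 1/2 on the right-hand side of its own bound. *)
Definition scale_cst : R := 1 + 4 * s1 * C1 * L / sigma.
(** Collects the terms of [grad_estimate] that are not absorbed, divided by [M^(1/sigma)];
    absorption doubles it. *)
Definition half_grad_cst : R :=
  C1 + g1 * C1 * scale_cst `^ (1 / sigma) + s1 * (2 / sigma) * C1.
(** The bound for [H * L * Gd + Kf] in units of [M^(1 + 1/sigma)], once the gradient bound has been
    inserted for [Gd]. *)
Definition force_cst : R := 2 * C1 * L * half_grad_cst + C1.
Definition step_cst : R :=
  2 * s1 * force_cst * (2 / sigma)
  + heat_time_cst D Cq * (2 * half_grad_cst) / cm * (L * C1)
  + source_cst D Cq cm 2 * force_cst * (2 / (1 - sigma))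
  + 2 * g1 * half_grad_cst * scale_cst + C1 + 4 * half_grad_cst * scale_cst.
Definition space_cst : R := m%:R * step_cst.
Definition grad_time_cst : R :=
  s1 * force_cst * (2 / sigma) + space_cst * (1 + 2 * (Cq * cp)) + 4 * half_grad_cst.
Definition u_time_cst : R :=
  source_cst D Cq cm 0 * force_cst * (2 / (sigma + 1))
  + time_cst D Cq cp ((sigma + 1) / 2) * space_cst + 2 * C1.

End SchauderConstants.

(** * Absorption of the gradient and powers of [M] *)

Section SchauderEstimate.
Variables (R : realType) (G : finZmodType) (D : finType) (o : D -> D) (d : D -> G) (N : R).
Hypotheses (oK : involutive o) (dN : forall e, d (o e) = - d e) (N1 : 1 <= N).
Implicit Types (g h : G -> R) (e : D) (es : seq D) (x y : G) (t s : R).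
Local Notation fdiff := (fdiff d N).
Local Notation flap := (flap d N).
Variables (q : G -> R) (Cq : R) (m : nat).
Hypotheses (q_ge0 : forall x, 0 <= q x) (q0 : q 0 = 0).
Hypothesis qD : forall x y, q (x + y) <= 2 * (q x + q y).
Hypothesis q_step : forall e (j : nat), q (d e *+ j) <= (j%:R / N) ^+ 2.
Hypothesis q_path : forall x, exists s : seq (D * nat), [/\ (size s <= m)%N,
  x = \sum_(p <- s) d p.1 *+ p.2 & all (fun p => (p.2%:R / N) ^+ 2 <= q x) s].
Hypotheses (Cq0 : 0 <= Cq) (flap_q : forall x, flap q x <= Cq).
Variables (T um up cm cp L sigma H Kf C0 U : R).
Hypotheses (cm0 : 0 < cm) (sigma01 : 0 < sigma < 1).
Hypotheses (L0 : 0 <= L) (H0 : 0 <= H) (Kf0 : 0 <= Kf) (C00 : 0 <= C0) (U0 : 0 <= U).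
Variables (phi dphi : R -> R) (u b : R -> G -> R).
Local Notation I v := (um <= v <= up).
Hypothesis dphi_ge : forall v, I v -> cm <= dphi v.
Hypothesis dphi_le : forall v, I v -> dphi v <= cp.
Hypothesis dphi_lip : forall v w, I v -> I w -> `|dphi v - dphi w| <= L * `|v - w|.
Hypothesis phi_taylor : forall v w z, I v -> I w -> I z ->
  `|phi w - phi v - dphi z * (w - v)| <= L * (`|v - z| + `|w - z|) * `|w - v|.
Hypothesis uI : forall t x, 0 <= t <= T -> I (u t x).
Hypothesis cu : forall x, continuous (u^~ x).
Hypothesis Du : forall t x, 0 < t < T ->
  is_derive t 1 (u^~ x) (flap (fun y => phi (u t y)) x + b t x).
Hypothesis bK : forall t x, 0 <= t <= T -> `|b t x| <= Kf.
Hypothesis u_holder : forall t s x y, 0 <= t <= T -> 0 <= s <= T ->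
  `|u t x - u s y| <= H * (`|t - s| + q (x - y)) `^ (sigma / 2).
Hypotheses (u0_grad : forall e x, `|fdiff e (u 0) x| <= C0)
  (u0_hess : forall e e' x, `|fdiff e (fdiff e' (u 0)) x| <= C0).
Hypothesis u_bound : forall t x, 0 <= t <= T -> `|u t x| <= U.
Variables (M C1 : R).
Hypotheses (M1 : 1 <= M) (HM : H <= C1 * M) (KM : Kf <= C1 * M) (CM : C0 <= C1 * M) (UC : U <= C1).
Hypothesis C11 : 1 <= C1.

Local Notation s1 := (source_cst D Cq cm 1).
Local Notation g1 := (grad_cst_near Cq cm 1).
Local Notation C2 := (scale_cst D Cq cm L sigma C1).
Local Notation E1 := (half_grad_cst D Cq cm L sigma C1).
Local Notation E2 := (force_cst D Cq cm L sigma C1).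
Local Notation P := (M `^ (1 / sigma)).
Local Notation Q := (M `^ (1 + 1 / sigma)).
Local Notation h := ((C2 * M) `^ (- (2 / sigma))).

Let N0 : 0 < N. Proof. exact: lt_le_trans N1. Qed.
Let sg0 : 0 < sigma. Proof. by case/andP: sigma01. Qed.
Let C10 : 0 <= C1. Proof. exact: le_trans C11. Qed.
Let M0 : 0 < M. Proof. exact: lt_le_trans M1. Qed.
Let s1_ge0 : 0 <= s1. Proof. exact: source_cst_ge0. Qed.
Let g1_ge0 : 0 <= g1. Proof. exact: grad_cst_near_ge0. Qed.
Let C21 : 1 <= C2.
Proof. by rewrite /scale_cst lerDl divr_ge0 ?(ltW sg0)// (mulr_ge0 _ L0)// (mulr_ge0 _ C10)// (mulr_ge0 _ s1_ge0). Qed.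
Let C20 : 0 < C2. Proof. exact: lt_le_trans C21. Qed.
Let CM1 : 1 <= C2 * M. Proof. by rewrite mulr_ege1. Qed.
Let CM0 : 0 < C2 * M. Proof. exact: mulr_gt0. Qed.
Let P1 : 1 <= P.
Proof. by rewrite -[leLHS](powRr0 M) ler_powR// divr_ge0// ltW. Qed.
Let P0 : 0 <= P. Proof. exact: powR_ge0. Qed.
Let MP : M <= P.
Proof.
rewrite -[leLHS](powRr1 (ltW M0)) ler_powR// ler_pdivlMr// mul1r ltW//.
by case/andP: sigma01.
Qed.
Let QE : Q = M * P.
Proof. by rewrite powRD ?powRr1 ?(ltW M0)// (gt_eqF M0) implybT. Qed.
Let MQ : M <= Q. Proof. by rewrite QE ler_peMr// ltW. Qed.
Let PQ : P <= Q. Proof. by rewrite QE ler_peMl. Qed.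
Let Q0 : 0 <= Q. Proof. exact: powR_ge0. Qed.
Let E10 : 0 <= E1.
Proof.
rewrite /half_grad_cst addr_ge0//; last first.
  by rewrite (mulr_ge0 _ C10)// (mulr_ge0 s1_ge0)// divr_ge0// ltW.
by rewrite addr_ge0// mulr_ge0 ?powR_ge0// (mulr_ge0 g1_ge0 C10).
Qed.
Let E20 : 0 <= E2.
Proof. by rewrite /force_cst addr_ge0// (mulr_ge0 _ E10)// (mulr_ge0 _ L0)// mulr_ge0. Qed.

Let h01 : 0 < h <= 1.
Proof.
rewrite powR_gt0//= powRN invf_le1 ?powR_gt0//.
by rewrite -[leLHS](powRr0 (C2 * M)) ler_powR// divr_ge0// ltW.
Qed.
Let h_half : h `^ (- 2^-1) = C2 `^ (1 / sigma) * P.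
Proof.
rewrite -powRrM -powRM ?(ltW C20) ?(ltW M0)//; congr (_ `^ _); field.
by rewrite gt_eqF.
Qed.
Let h_sigma : h `^ (sigma / 2) = (C2 * M)^-1.
Proof.
rewrite -powRrM -[RHS]powR_inv1 ?(ltW CM0)//; congr (_ `^ _); field.
by rewrite gt_eqF.
Qed.

Lemma grad_le t e x : 0 <= t <= T -> `|fdiff e (u t) x| <= 2 * E1 * P.
Proof.
move=> t0.
pose S := [set r : R | exists t e x, 0 <= t <= T /\ r = `|fdiff e (u t) x|].
have Sx t' e' x' : 0 <= t' <= T -> S `|fdiff e' (u t') x'| by move=> ?; exists t', e', x'.
(* For fixed [N] the supremum is finite. This bound depends on [N] and only legitimates the
   absorption of [sup S / 2]. *)
have Sub : has_ubound S.
  exists (N * (U + U)) => _ [t' [e' [x' [t'0 ->]]]].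
  rewrite /fdiff normrM gtr0_norm// ler_wpM2l ?(ltW N0)//.
  by rewrite (le_trans (ler_normB _ _))// lerD// u_bound.
have Gub t' e' x' : 0 <= t' <= T -> `|fdiff e' (u t') x'| <= sup S.
  by move=> /(Sx _ e' x'); exact: ub_le_sup.
have G0 : 0 <= sup S by apply: le_trans (Gub t e x t0).
suff : sup S <= 2 * E1 * P by apply: le_trans; exact: Gub.
suff : sup S <= E1 * P + sup S / 2 by lra.
apply: ge_sup; first by exists `|fdiff e (u t) x|; exact: Sx.
move=> _ [t' [e' [x' [t'0 ->]]]].
have := grad_estimate oK dN N1 q_ge0 q0 qD q_step Cq0 flap_q cm0 sigma01
  L0 H0 Kf0 dphi_ge phi_taylor uI cu Du bK u_holder Gub G0 u0_grad u_bound C00 U0 e' x' t'0 h01.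
move/le_trans; apply; rewrite h_half h_sigma.
have CMi : 0 <= (C2 * M)^-1 by rewrite invr_ge0 ltW.
have p1 : C0 <= C1 * P by rewrite (le_trans CM)// ler_wpM2l.
have p2 : g1 * U * (C2 `^ (1 / sigma) * P) <= g1 * C1 * C2 `^ (1 / sigma) * P.
  rewrite mulrA ler_wpM2r// ler_wpM2r ?powR_ge0// ler_wpM2l//.
have p3 : s1 * (H * L * sup S) / (sigma / 2) * (C2 * M)^-1 <= sup S / 2.
  have -> : s1 * (H * L * sup S) / (sigma / 2) * (C2 * M)^-1 =
     (4 * s1 * H * L / sigma * (C2 * M)^-1) * (sup S / 2).
    by field; rewrite !gt_eqF.
  rewrite ler_piMl ?divr_ge0// ler_pdivrMr// mul1r.
  rewrite (_ : C2 * M = M + 4 * s1 * C1 * L / sigma * M); last by rewrite /scale_cst; ring.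
  apply: (@le_trans _ _ (4 * s1 * C1 * L / sigma * M)); last by rewrite lerDr ltW.
  have -> : 4 * s1 * H * L / sigma = (4 * s1 * L / sigma) * H by ring.
  have -> : 4 * s1 * C1 * L / sigma * M = (4 * s1 * L / sigma) * (C1 * M) by ring.
  by rewrite ler_wpM2l// divr_ge0 ?(ltW sg0)// (mulr_ge0 _ L0)// (mulr_ge0 _ s1_ge0).
have p4 : s1 * Kf / (sigma / 2) * (C2 * M)^-1 <= s1 * (2 / sigma) * C1 * P.
  have -> : s1 * Kf / (sigma / 2) * (C2 * M)^-1 = s1 * (2 / sigma) * (Kf * (C2 * M)^-1).
    by field; rewrite !gt_eqF.
  rewrite -[leRHS]mulrA ler_wpM2l//.
    by rewrite (mulr_ge0 s1_ge0)// divr_ge0// ltW.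
  rewrite ler_pdivrMr// (le_trans KM)// ler_pM ?(ltW M0)//.
    by rewrite ler_peMr.
  by rewrite ler_peMl// ltW.
have -> : C0 + g1 * U * (C2 `^ (1 / sigma) * P)
    + s1 * (H * L * sup S + Kf) / (sigma / 2) * (C2 * M)^-1 =
  C0 + g1 * U * (C2 `^ (1 / sigma) * P)
    + (s1 * (H * L * sup S) / (sigma / 2) * (C2 * M)^-1
    + s1 * Kf / (sigma / 2) * (C2 * M)^-1) by ring.
have -> : E1 * P + sup S / 2 = C1 * P + g1 * C1 * C2 `^ (1 / sigma) * P +
   (sup S / 2 + s1 * (2 / sigma) * C1 * P) by rewrite /half_grad_cst; ring.
by rewrite !lerD.
Qed.

Let E1P0 : 0 <= 2 * E1 * P.
Proof. by rewrite mulr_ge0// mulr_ge0. Qed.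

Let BQ : H * L * (2 * E1 * P) + Kf <= E2 * Q.
Proof.
have -> : E2 * Q = (C1 * M * L) * (2 * E1 * P) + C1 * Q by rewrite /force_cst QE; ring.
apply: lerD; last by rewrite (le_trans KM)// ler_wpM2l.
by rewrite ler_wpM2r// ler_wpM2r.
Qed.

Let B0 : 0 <= H * L * (2 * E1 * P) + Kf.
Proof. by rewrite addr_ge0// mulr_ge0// mulr_ge0. Qed.

Local Notation A1 := (step_cst D Cq cm L sigma C1).

(** Beyond the scale [h] the gradient bound suffices, since then [rho^sigma >= (C2 * M)^-1]. Below
    it [space_increment] applies, and its linear term is harmless because [rho <= h^(1/2)] gives
    [h^(-1/2) * rho <= C2 * M * rho^sigma]. *)
Lemma grad_step_le t e e' x (j : nat) : 0 <= t <= T ->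
  `|fdiff e (u t) (x + d e' *+ j) - fdiff e (u t) x| <= A1 * Q * (j%:R / N) `^ sigma.
Proof.
move=> t0; have [->|j0] := posnP j.
  by rewrite mulr0n addr0 subrr normr0 mul0r powR0 ?mulr0// gt_eqF.
set rho := j%:R / N.
have rho0 : 0 < rho by rewrite divr_gt0// ltr0n.
have /andP[h0 h1] := h01.
have s10 : 0 < 1 - sigma by case/andP: sigma01 => _; rewrite subr_gt0.
pose a1 := 2 * s1 * E2 * (2 / sigma).
pose a2 := heat_time_cst D Cq * (2 * E1) / cm * (L * C1).
pose a3 := source_cst D Cq cm 2 * E2 * (2 / (1 - sigma)).
pose a4 := 2 * g1 * E1 * C2.
pose a5 := 4 * E1 * C2.
have A1E : A1 = a1 + a2 + a3 + a4 + C1 + a5 by [].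
have ht0 : 0 <= heat_time_cst D Cq.
  by rewrite mulr_ge0// grad_cst_ge0.
have a10 : 0 <= a1 by rewrite mulr_ge0 ?divr_ge0 ?(ltW sg0)// (mulr_ge0 _ E20)// (mulr_ge0 _ s1_ge0).
have a20 : 0 <= a2.
  rewrite mulr_ge0 ?(mulr_ge0 L0 C10)// divr_ge0 ?(ltW cm0)//.
  by rewrite (mulr_ge0 ht0)// mulr_ge0.
have a30 : 0 <= a3.
  by rewrite mulr_ge0 ?divr_ge0 ?(ltW s10)// (mulr_ge0 (source_cst_ge0 _ _ _ _) E20).
have a40 : 0 <= a4 by rewrite mulr_ge0 ?(ltW C20)// (mulr_ge0 _ E10)// (mulr_ge0 _ g1_ge0).
have a50 : 0 <= a5 by rewrite mulr_ge0 ?(ltW C20)// mulr_ge0.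
set W := rho `^ sigma; have W0 : 0 <= W by exact: powR_ge0.
have QW0 : 0 <= Q * W by rewrite mulr_ge0.
have powrho p : (rho ^+ 2) `^ (p / 2) = rho `^ p.
  by rewrite -(powR_mulrn 2) ?(ltW rho0)// -powRrM; congr (_ `^ _); field.
have [rh|hr] := leP (rho ^+ 2) h; last first.
  have hW : (C2 * M)^-1 <= W.
    rewrite -h_sigma /W -powrho; apply: ge0_ler_powR; rewrite ?nnegrE ?exprn_ge0 ?powR_ge0 ?(ltW rho0) ?(ltW hr)//.
    by rewrite divr_ge0// ltW.
  apply: (@le_trans _ _ (2 * (2 * E1 * P))).
    by rewrite (le_trans (ler_normB _ _))// mulrDl mul1r lerD// grad_le.
  apply: (@le_trans _ _ (a5 * Q * W)).
    have -> : a5 * Q * W = (2 * (2 * E1 * P)) * (C2 * M * W) by rewrite /a5 QE; ring.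
    by rewrite ler_peMr ?mulr_ge0// -ler_pdivrMl// mulr1.
  rewrite -!(mulrA _ Q) ler_wpM2r// A1E lerDr.
  by rewrite !addr_ge0.
have Gt := grad_le.
have := space_increment oK dN N1 q_ge0 q0 qD q_step Cq0 flap_q cm0 sigma01
  L0 H0 Kf0 dphi_ge dphi_lip phi_taylor uI cu Du bK
  u_holder Gt E1P0 u0_hess C00 e e' x t0 h01 j0 rh.
move/le_trans; apply; rewrite -/rho -/W.
have rho1 : rho <= 1.
  by rewrite -(ler_pXn2r (n := 2)) ?nnegrE ?(ltW rho0)// expr1n (le_trans rh).
have rW : rho <= W by apply: ger1_powR; rewrite ?rho0// ltW//; case/andP: sigma01.
have hrho : h `^ (- 2^-1) * rho <= C2 * M * W.
  have -> : rho = W * rho `^ (1 - sigma).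
    by rewrite -powRD ?(gt_eqF rho0) ?implybT// addrC subrK powRr1// ltW.
  rewrite mulrCA mulrC ler_wpM2r//.
  apply: (@le_trans _ _ (h `^ (- 2^-1) * h `^ ((1 - sigma) / 2))).
    rewrite ler_wpM2l ?powR_ge0// -powrho.
    by apply: ge0_ler_powR; rewrite ?nnegrE ?exprn_ge0 ?powR_ge0 ?(ltW rho0) ?divr_ge0 ?(ltW s10).
  rewrite -powRD ?(gt_eqF h0) ?implybT// (_ : - 2^-1 + _ = - (sigma / 2)); last by field.
  by rewrite powRN h_sigma invrK.
have p1 : 2 * (s1 * (H * L * (2 * E1 * P) + Kf) / (sigma / 2)) <= a1 * Q.
  have -> : a1 * Q = 2 * s1 * (2 / sigma) * (E2 * Q) by rewrite /a1; ring.
  have -> : 2 * (s1 * (H * L * (2 * E1 * P) + Kf) / (sigma / 2)) =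
      2 * s1 * (2 / sigma) * (H * L * (2 * E1 * P) + Kf) by field; rewrite gt_eqF.
  by rewrite ler_wpM2l// mulr_ge0 ?divr_ge0 ?(ltW sg0)// (mulr_ge0 _ s1_ge0).
have p2 : heat_time_cst D Cq * (2 * E1 * P) / cm * (L * H) <= a2 * Q.
  have -> : a2 * Q = heat_time_cst D Cq * (2 * E1 * P) / cm * L * (C1 * M).
    by rewrite /a2 QE; ring.
  rewrite mulrA ler_wpM2l// (mulr_ge0 _ L0)// divr_ge0 ?(ltW cm0)//.
  exact: (mulr_ge0 ht0 E1P0).
have p3 : source_cst D Cq cm 2 * (H * L * (2 * E1 * P) + Kf) / ((1 - sigma) / 2) <= a3 * Q.
  have -> : a3 * Q = source_cst D Cq cm 2 * (2 / (1 - sigma)) * (E2 * Q) by rewrite /a3; ring.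
  have -> : source_cst D Cq cm 2 * (H * L * (2 * E1 * P) + Kf) / ((1 - sigma) / 2) =
      source_cst D Cq cm 2 * (2 / (1 - sigma)) * (H * L * (2 * E1 * P) + Kf).
    by field; rewrite gt_eqF.
  by rewrite ler_wpM2l// (mulr_ge0 (source_cst_ge0 _ _ _ _))// divr_ge0// ltW.
have p4 : g1 * (2 * E1 * P) * h `^ (- 2^-1) * rho <= a4 * Q * W.
  have -> : a4 * Q * W = g1 * (2 * E1 * P) * (C2 * M * W) by rewrite /a4 QE; ring.
  by rewrite -mulrA ler_wpM2l// (mulr_ge0 g1_ge0 E1P0).
have p5 : C0 * rho <= C1 * Q * W.
  apply: ler_pM => //; first exact: ltW.
  by rewrite (le_trans CM)// ler_wpM2l.
have p6 : 0 <= a5 * Q * W by rewrite mulr_ge0// mulr_ge0.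
have := ler_wpM2r W0 (lerD (lerD p1 p2) p3).
by rewrite A1E; move: p4 p5 p6; lra.
Qed.

Let s1s : 0 < 1 - sigma. Proof. by case/andP: sigma01 => _; rewrite subr_gt0. Qed.

Let A1_ge0 : 0 <= A1.
Proof.
have ht0 : 0 <= heat_time_cst D Cq by rewrite mulr_ge0// grad_cst_ge0.
rewrite /step_cst; apply: addr_ge0; last by rewrite mulr_ge0 ?(ltW C20)// mulr_ge0.
apply: addr_ge0 => //; apply: addr_ge0; last first.
  by rewrite mulr_ge0 ?(ltW C20)// (mulr_ge0 _ E10)// (mulr_ge0 _ g1_ge0).
apply: addr_ge0; last first.
  by rewrite mulr_ge0 ?divr_ge0 ?(ltW s1s)// (mulr_ge0 (source_cst_ge0 _ _ _ _) E20).
apply: addr_ge0.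
  by rewrite mulr_ge0 ?divr_ge0 ?(ltW sg0)// (mulr_ge0 _ E20)// (mulr_ge0 _ s1_ge0).
rewrite mulr_ge0 ?(mulr_ge0 L0 C10)// divr_ge0 ?(ltW cm0)//.
by rewrite (mulr_ge0 ht0)// mulr_ge0.
Qed.

Local Notation A := (space_cst D Cq cm L sigma C1 m * Q).

Let A0 : 0 <= A. Proof. by rewrite mulr_ge0// mulr_ge0. Qed.

(** The points are joined by at most [m] segments along lattice directions, none longer than the
    distance measured by [q]. *)
Lemma grad_space_le t e x y : 0 <= t <= T ->
  `|fdiff e (u t) y - fdiff e (u t) x| <= A * q (y - x) `^ (sigma / 2).
Proof.
move=> t0; have [s [sm ys sq]] := q_path (y - x).
rewrite {1}(_ : y = x + \sum_(p <- s) d p.1 *+ p.2); last by rewrite -ys addrC subrK.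
clear ys; move: (q (y - x)) (q_ge0 (y - x)) sq => Qs Qs0 sq.
set W := Qs `^ (sigma / 2).
have W0 : 0 <= W by exact: powR_ge0.
have AW0 : 0 <= A1 * Q * W by rewrite mulr_ge0// mulr_ge0.
apply: (@le_trans _ _ ((size s)%:R * (A1 * Q * W))); last first.
  rewrite (_ : A * W = m%:R * (A1 * Q * W)); last by rewrite /space_cst; ring.
  by rewrite ler_wpM2r// ler_nat.
elim: s {sm} x sq => [|[e' j] s IH] x /=.
  by rewrite big_nil addr0 subrr normr0 mul0r.
move=> /andP[jq sq]; rewrite big_cons /= addrA.
set z := x + d e' *+ j.
have := IH z sq; have := grad_step_le e e' x j t0; rewrite -/z => H1 H2.
have H3 : `|fdiff e (u t) z - fdiff e (u t) x| <= A1 * Q * W.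
  apply: (le_trans H1); rewrite ler_wpM2l ?mulr_ge0//.
  have jN : 0 <= j%:R / N by rewrite divr_ge0// ltW.
  rewrite (_ : _ `^ sigma = ((j%:R / N) ^+ 2) `^ (sigma / 2)).
    have sg2 : 0 <= sigma / 2 by rewrite divr_ge0// ltW.
    by apply: (ge0_ler_powR sg2) => //; rewrite nnegrE exprn_ge0.
  by rewrite -(powR_mulrn 2)// -powRrM; congr (_ `^ _); field.
have split3 (r1 r2 r3 : R) : r1 - r3 = (r1 - r2) + (r2 - r3) by ring.
rewrite (split3 _ (fdiff e (u t) z)).
apply: (le_trans (ler_normD _ _)).
by rewrite -[(size s).+1%:R]natr1 mulrDl (mul1r (A1 * Q * W)); exact: lerD H2 H3.
Qed.

Lemma grad_time_le s t e x : 0 <= s <= t -> t <= T ->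
  `|fdiff e (u t) x - fdiff e (u s) x| <=
    grad_time_cst D Cq cm cp L sigma C1 m * Q * (t - s) `^ (sigma / 2).
Proof.
move=> st tT; have /andP[s0 s_t] := st.
set W := (t - s) `^ (sigma / 2); have W0 : 0 <= W by exact: powR_ge0.
have cp0 : 0 <= cp.
  have t00 : 0 <= t <= T by rewrite (le_trans s0 s_t).
  by rewrite (le_trans (ltW cm0))// (le_trans (dphi_ge (uI x t00)))// dphi_le// uI.
pose b1 := s1 * E2 * (2 / sigma).
pose b2 := space_cst D Cq cm L sigma C1 m * (1 + 2 * (Cq * cp)).
have b10 : 0 <= b1 by rewrite mulr_ge0 ?divr_ge0 ?(ltW sg0)// (mulr_ge0 s1_ge0).
have b20 : 0 <= b2.
  by rewrite mulr_ge0 ?addr_ge0 ?mulr_ge0// mulr_ge0.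
rewrite /grad_time_cst -/b1 -/b2.
have [ts1|ts1] := leP (t - s) 1; last first.
  have t00 : 0 <= t <= T by rewrite (le_trans s0 s_t).
  have s00 : 0 <= s <= T by rewrite s0 (le_trans s_t).
  have W1 : 1 <= W.
    by rewrite -[leLHS](powRr0 (t - s)) ler_powR ?(ltW ts1)// divr_ge0// ltW.
  apply: (@le_trans _ _ (4 * E1 * Q * W)).
    apply: (@le_trans _ _ (2 * (2 * E1 * P))).
      by rewrite (le_trans (ler_normB _ _))// mulrDl mul1r lerD// grad_le.
    have -> : 2 * (2 * E1 * P) = 4 * E1 * P * 1 by ring.
    by rewrite ler_pM// ?mulr_ge0// ler_wpM2l// mulr_ge0.
  by rewrite ler_wpM2r// ler_wpM2r// lerDr addr_ge0.
have Gt := grad_le.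
have := grad_time_increment oK dN N1 q_ge0 q0 qD q_step Cq0 flap_q cm0 sigma01
  L0 H0 Kf0 dphi_ge phi_taylor uI cu Du bK u_holder Gt E1P0 dphi_le A0 grad_space_le e x st tT ts1.
move/le_trans; apply; rewrite -/W ler_wpM2r//.
have -> : (b1 + b2 + 4 * E1) * Q = s1 * (2 / sigma) * (E2 * Q) + A * (1 + 2 * (Cq * cp)) + 4 * E1 * Q.
  by rewrite /b1 /b2; ring.
have -> : s1 * (H * L * (2 * E1 * P) + Kf) / (sigma / 2) =
   s1 * (2 / sigma) * (H * L * (2 * E1 * P) + Kf) by field; rewrite gt_eqF.
rewrite -[leLHS]addr0; apply: lerD; last by rewrite mulr_ge0// mulr_ge0.
rewrite lerD2r ler_wpM2l// (mulr_ge0 s1_ge0)// divr_ge0// ltW//.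
Qed.

Lemma u_time_le s t x : 0 <= s <= t -> t <= T ->
  `|u t x - u s x| <=
    u_time_cst D Cq cm cp L sigma C1 m * Q * (t - s) `^ ((sigma + 1) / 2).
Proof.
move=> st tT; have /andP[s0 s_t] := st.
have t00 : 0 <= t <= T by rewrite (le_trans s0 s_t).
have s00 : 0 <= s <= T by rewrite s0 (le_trans s_t).
set W := (t - s) `^ ((sigma + 1) / 2); have W0 : 0 <= W by exact: powR_ge0.
have p0 : 0 < sigma + 1 by rewrite addr_gt0.
have cp0 : 0 <= cp.
  by rewrite (le_trans (ltW cm0))// (le_trans (dphi_ge (uI x t00)))// dphi_le// uI.
pose b1 := source_cst D Cq cm 0 * E2 * (2 / (sigma + 1)).
pose b2 := time_cst D Cq cp ((sigma + 1) / 2) * space_cst D Cq cm L sigma C1 m.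
have b10 : 0 <= b1.
  by rewrite mulr_ge0 ?divr_ge0 ?(ltW p0)// (mulr_ge0 (source_cst_ge0 _ _ _ _)).
have b20 : 0 <= b2.
  have p20 : 0 <= (sigma + 1) / 2 by rewrite divr_ge0// ltW.
  have cp1 : 0 <= 1 + cp by rewrite addr_ge0.
  have sp0 : 0 <= space_cst D Cq cm L sigma C1 m by rewrite mulr_ge0.
  apply: (mulr_ge0 _ sp0); apply: (mulr_ge0 _ cp1); apply: (divr_ge0 _ p20).
  by rewrite mulr_ge0 ?grad_cst_ge0.
rewrite /u_time_cst -/b1 -/b2.
have [ts1|ts1] := leP (t - s) 1; last first.
  have W1 : 1 <= W.
    by rewrite -[leLHS](powRr0 (t - s)) ler_powR ?(ltW ts1)// divr_ge0// ltW.
  have Q1 : 1 <= Q by rewrite (le_trans M1).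
  apply: (@le_trans _ _ (2 * C1 * Q * W)).
    apply: (@le_trans _ _ (2 * C1 * 1 * 1)).
      rewrite !mulr1 (le_trans (ler_normB _ _))// mulrDl mul1r.
      by rewrite lerD// (le_trans (u_bound _ _)).
    by rewrite !ler_pM// ?mulr_ge0.
  by rewrite ler_wpM2r// ler_wpM2r// lerDr addr_ge0.
have Gt := grad_le.
have := u_time_increment oK dN N1 q_ge0 q0 qD q_step Cq0 flap_q cm0 sigma01
  L0 H0 Kf0 dphi_ge phi_taylor uI cu Du bK u_holder Gt E1P0 dphi_le A0 grad_space_le x st tT ts1.
move/le_trans; apply; rewrite -/W ler_wpM2r//.
have -> : (b1 + b2 + 2 * C1) * Q = source_cst D Cq cm 0 * (2 / (sigma + 1)) * (E2 * Q)
    + time_cst D Cq cp ((sigma + 1) / 2) * A + 2 * C1 * Q.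
  by rewrite /b1 /b2; ring.
have -> : source_cst D Cq cm 0 * (H * L * (2 * E1 * P) + Kf) / ((sigma + 1) / 2) =
   source_cst D Cq cm 0 * (2 / (sigma + 1)) * (H * L * (2 * E1 * P) + Kf).
  by field; rewrite gt_eqF.
rewrite -[leLHS]addr0; apply: lerD; last by rewrite mulr_ge0// mulr_ge0.
by rewrite lerD2r ler_wpM2l// (mulr_ge0 (source_cst_ge0 _ _ _ _))// divr_ge0// ltW.
Qed.

End SchauderEstimate.

(** * From the Nash exponent to a Hölder bound *)

Section DivergenceForm.
Variables (R : realType) (G : finZmodType) (D : finType) (o : D -> D) (d : D -> G) (N : R).
Implicit Types (e : D) (x y z : G) (t s r : R).

Definition divform (a : R -> G -> D -> R) t (h : G -> R) : G -> R :=
  fun x => N ^+ 2 * \sum_e a t x e * (h (x + d e) - h x).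

Definition solves_divform a (y : R -> G -> R) :=
  (forall x, continuous (y^~ x)) /\
  forall t x, 0 < t -> is_derive t 1 (y^~ x) (divform a t (y t) x).

Variables (a : R -> G -> D -> R) (cm cp : R).
Hypothesis ca : forall x e, continuous (fun t => a t x e).
Hypothesis a_bnd : forall t x e, cm <= a t x e <= cp.
Hypothesis cm0 : 0 < cm.

Let A t x y : R := N ^+ 2 * \sum_e a t x e * ((y == x + d e)%:R - (y == x)%:R).

Lemma divform_matrix t h x : divform a t h x = \sum_y A t x y * h y.
Proof.
rewrite /A; under eq_bigr do rewrite -mulrA mulr_suml.
rewrite -mulr_sumr /divform exchange_big/=; congr (_ * _); apply: eq_bigr => e _.
under eq_bigr do rewrite -mulrA mulrBl.
rewrite -mulr_sumr sumrB; congr (_ * (_ - _)).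
  by rewrite (bigD1 (x + d e))//= eqxx mul1r big1 ?addr0// => y /negPf ->; rewrite mul0r.
by rewrite (bigD1 x)//= eqxx mul1r big1 ?addr0// => y /negPf ->; rewrite mul0r.
Qed.

Let cA x y : continuous (fun t => A t x y).
Proof.
move=> t; apply: cvgM; first exact: cvg_cst.
by apply: continuous_sumf => e; apply: cvgM; [exact: ca|exact: cvg_cst].
Qed.

Let a_norm t x e : `|a t x e| <= cp.
Proof.
have /andP[c1 c2] := a_bnd t x e.
by rewrite ger0_norm// (le_trans (ltW cm0)).
Qed.

Let Abnd : exists2 B : R, 0 <= B & forall t x y, `|A t x y| <= B.
Proof.
exists (N ^+ 2 * \sum_(e : D) `|cp| * 2).
  by rewrite mulr_ge0 ?sqr_ge0// sumr_ge0// => e _; rewrite mulr_ge0.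
move=> t x y; rewrite normrM ger0_norm ?sqr_ge0// ler_wpM2l ?sqr_ge0//.
rewrite (le_trans (ler_norm_sum _ _ _))//; apply: ler_sum => e _.
rewrite normrM ler_pM//; first by rewrite (le_trans (a_norm t x e)) ?ler_norm.
by rewrite (le_trans (ler_normB _ _))// !normr_nat; case: eqP; case: eqP => /=; lra.
Qed.

Lemma divform_exists (y0 : G -> R) r :
  exists y : R -> G -> R, y 0 = y0 /\ solves_divform (fun t => a (r + t)) y.
Proof.
have [B B0 AB] := Abnd.
have [||y [y0E cy Dy]] := @linear_ode R G (fun t => A (r + t)) B y0 B0.
- move=> x y t; apply: (@continuous_comp _ _ _ (fun t => r + t) (fun t => A t x y)).
    by apply: cvgD; [exact: cvg_cst|exact: cvg_id].
  exact: cA.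
- by move=> t x y; exact: AB.
exists y; split; first exact/funext.
split => // t x t0; apply: is_derive_eq (Dy t x t0) _.
by rewrite -divform_matrix.
Qed.

Lemma divform_norm (y : R -> G -> R) (B : R) : solves_divform a y -> (forall x, `|y 0 x| <= B) ->
  forall t x, 0 <= t -> `|y t x| <= B.
Proof.
move=> [cy Dy] yB.
have half (c : R) : (c = 1 \/ c = -1) -> forall t x, 0 <= t -> c * y t x - B <= 0.
  move=> c1; apply: (@maximum_principle R G D (fun x e => x + d e)
    (fun t x e => N ^+ 2 * a t x e) (fun t x => c * y t x - B) (fun t x => c * divform a t (y t) x)).
  - move=> x t; apply: cvgB; last exact: cvg_cst.
    by apply: cvgM; [exact: cvg_cst|exact: cy].
  - move=> t x t0.
    apply: is_derive_eq (is_derive_subf (is_derive_cmulf c (Dy t x t0)) (is_derive_cstf B t)) _.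
    by rewrite subr0.
  - move=> t x t0; rewrite /divform mulrCA !mulr_sumr le_eqVlt; apply/orP; left; apply/eqP.
    by apply: eq_bigr => e _; ring.
  - move=> t x e t0; rewrite mulr_ge0 ?sqr_ge0//.
    by have /andP[c2 _] := a_bnd t x e; rewrite (le_trans (ltW cm0)).
  - move=> x; rewrite subr_le0; have := yB x; rewrite ler_norml => /andP[y1 y2].
    by case: c1 => ->; rewrite ?mul1r ?mulN1r//; lra.
move=> t x t0; rewrite ler_norml; apply/andP; split.
  by have := half (-1) (or_intror erefl) t x t0; lra.
by have := half 1 (or_introl erefl) t x t0; lra.
Qed.

(* [w s y] is the transition density from [y] at time [t - s] to [x] at time [t] *)
Definition backward_kernel t x (w : R -> G -> R) :=
  [/\ forall y, w 0 y = (y == x)%:R, forall y, continuous (w^~ y) &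
   forall s y, 0 < s -> is_derive s 1 (w^~ y) (\sum_z A (t - s) z y * w s z)].

Lemma backward_kernel_exists t x : exists w, backward_kernel t x w.
Proof.
have [B B0 AB] := Abnd.
have [||w [w0 cw Dw]] := @linear_ode R G (fun s y z => A (t - s) z y) B
  (fun y => (y == x)%:R) B0.
- move=> y z s; apply: (@continuous_comp _ _ _ (fun s => t - s) (fun s => A s z y)).
    by apply: cvgB; [exact: cvg_cst|exact: cvg_id].
  exact: cA.
- by move=> s y z; exact: AB.
by exists w; split.
Qed.

(** The kernel evolves by the transposed matrix at reversed time, so its evolution passes to [v] as
    [divform]. *)
Lemma is_derive_backward t x w (v : R -> G -> R) (dv : G -> R) s :
  backward_kernel t x w -> 0 < s ->
  (forall y, is_derive s 1 (v^~ y) (dv y)) ->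
  is_derive s 1 (fun s => \sum_y w s y * v s y)
    (\sum_y w s y * (divform a (t - s) (v s) y + dv y)).
Proof.
move=> [_ cw Dw] s0 Dv.
have H := is_derive_sumf (index_enum G) xpredT (t := s)
  (f := fun y s => w s y * v s y)
  (df := fun y _ => (\sum_z A (t - s) z y * w s z) * v s y + w s y * dv y)
  (fun y => is_derive_mulf (Dw s y s0) (Dv y)).
apply: is_derive_eq H _; rewrite big_split/=.
under [RHS]eq_bigr do rewrite mulrDr.
rewrite [RHS]big_split/=; congr (_ + _).
under [RHS]eq_bigr do rewrite divform_matrix mulr_sumr.
rewrite [RHS]exchange_big/=; apply: eq_bigr => y _.
rewrite mulr_suml; apply: eq_bigr => z _; ring.
Qed.

(** Duality: the pairing of [w r] with the solution at elapsed time [s - r] is constant in [r]. An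
    estimate stated for solutions thereby becomes one for the kernel tested against any datum. *)
Lemma backward_kernelE t x w s (h : G -> R) (y : R -> G -> R) : backward_kernel t x w -> 0 <= s ->
  y 0 = h -> solves_divform (fun r => a (t - s + r)) y ->
  \sum_z w s z * h z = y s x.
Proof.
move=> bw s0 <- [cy Dy]; have [w0 cw _] := bw.
pose v r z := y (s - r) z.
have cv z : continuous (v^~ z).
  move=> r; apply: (@continuous_comp _ _ _ (fun r => s - r) (y^~ z)); last exact: cy.
  by apply: cvgB; [exact: cvg_cst|exact: cvg_id].
have : `|\sum_z w s z * v s z - \sum_z w 0 z * v 0 z| <= 0 - 0 :> R.
  apply: (@dominated_increment R (fun r => \sum_z w r z * v r z) (fun=> 0)
     (fun=> 0) (fun=> 0) 0 s s0) => [||r /andP[r0 rs]|r _].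
  - apply: continuous_subspaceT => r; apply: continuous_sumf => z.
    by apply: cvgM; [exact: cw|exact: cv].
  - by apply: continuous_subspaceT => ?; exact: cst_continuous.
  - have sr : 0 < s - r by rewrite subr_gt0.
    have Ds : is_derive r 1 (fun r => s - r) (-1).
      by have := is_derive_subf (is_derive_cstf s r) (is_derive_id r (1 : R)); rewrite sub0r.
    have Dv z : is_derive r 1 (v^~ z) (- divform a (t - r) (v r) z).
      have H := is_derive_compf (g := fun r => s - r) (Dy (s - r) z sr) Ds.
      apply: is_derive_eq H _; rewrite mulrN1 /divform; congr (- _).
      by rewrite (_ : t - s + (s - r) = t - r)//; ring.
    apply: is_derive_eq (is_derive_backward bw r0 Dv) _.
    by rewrite big1// => z _; rewrite subrr mulr0.
  - by rewrite normr0.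
rewrite subrr normr_le0 subr_eq0 /v subrr subr0 => /eqP ->.
rewrite (bigD1 x)//= w0 eqxx mul1r big1 ?addr0// => z /negPf zx.
by rewrite w0 zx mul0r.
Qed.

End DivergenceForm.

Section NashHolder.
Variables (R : realType) (G : finZmodType) (D : finType) (o : D -> D) (d : D -> G) (N : R).
Implicit Types (e : D) (x y z : G) (t s r : R).
Variables (q : G -> R) (cm cp sigma CN : R).
Hypotheses (q_ge0 : forall x, 0 <= q x) (cm0 : 0 < cm) (sigma01 : 0 < sigma < 1) (CN0 : 0 <= CN).
Local Notation divform := (divform d N).

(** Squared distances replace the parabolic maximum by a sum and the exponent [sigma] by
    [sigma / 2]. *)
Definition nash_on_torus := forall (a : R -> G -> D -> R) (y : R -> G -> R) (B : R),
  (forall x e, continuous (fun t => a t x e)) ->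
  (forall t x e, a t x e = a t (x + d e) (o e)) ->
  (forall t x e, cm <= a t x e <= cp) ->
  solves_divform d N a y ->
  (forall x, `|y 0 x| <= B) ->
  forall t s x x', 0 < t -> 0 < s ->
    `|y t x - y s x'| <= CN * B * ((`|t - s| + q (x - x')) / Num.min t s) `^ (sigma / 2).

(* The solution is prolonged to [-1 < t < 0], which moves the degeneracy of the
   Nash estimate at the initial time away from [0 <= t <= T]. *)
Hypothesis nash : nash_on_torus.
Variables (a : R -> G -> D -> R) (u g : R -> G -> R) (T U Kg : R).
Hypothesis ca : forall x e, continuous (fun t => a t x e).
Hypothesis a_sym : forall t x e, a t x e = a t (x + d e) (o e).
Hypothesis a_bnd : forall t x e, cm <= a t x e <= cp.
Hypothesis cu : forall x, continuous (u^~ x).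
Hypothesis Du : forall t x, (-1 < t < 0) || (0 < t < T) ->
  is_derive t 1 (u^~ x) (divform a t (u t) x + g t x).
Hypothesis gK : forall t x, (-1 < t < 0) || (0 < t < T) -> `|g t x| <= Kg.
Hypothesis uU : forall x, `|u (-1) x| <= U.
Hypotheses (U0 : 0 <= U) (Kg0 : 0 <= Kg).

Let is_derive_duhamel t x w r : backward_kernel d N a t x w -> 0 < r ->
  (-1 < t - r < 0) || (0 < t - r < T) ->
  is_derive r 1 (fun r => \sum_y w r y * u (t - r) y) (- \sum_y w r y * g (t - r) y).
Proof.
move=> bw r0 tr.
have Ds : is_derive r 1 (fun r => t - r) (-1).
  by have := is_derive_subf (is_derive_cstf t r) (is_derive_id r (1 : R)); rewrite sub0r.
have Dv y := is_derive_compf (g := fun r => t - r) (Du y tr) Ds.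
apply: is_derive_eq (is_derive_backward bw r0 Dv) _.
rewrite -sumrN; apply: eq_bigr => y _; ring.
Qed.

Let continuous_duhamel t x w : backward_kernel d N a t x w ->
  continuous (fun r => \sum_y w r y * u (t - r) y).
Proof.
move=> [_ cw _] r; apply: continuous_sumf => y; apply: cvgM; first exact: cw.
apply: (@continuous_comp _ _ _ (fun r => t - r) (u^~ y)); last exact: cu.
by apply: cvgB; [exact: cvg_cst|exact: cvg_id].
Qed.

Let shift_coeff r := fun t => a (r + t).

Let kernel_bound t x w s (h : G -> R) (B : R) : backward_kernel d N a t x w -> 0 <= s ->
  (forall y, `|h y| <= B) -> `|\sum_y w s y * h y| <= B.
Proof.
move=> bw s0 hB.
have [Y [Y0 Ys]] := divform_exists d N ca a_bnd cm0 h (t - s).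
rewrite (backward_kernelE bw s0 Y0 Ys).
apply: (@divform_norm R G D d N (shift_coeff (t - s)) cm cp) => //.
- by move=> r y e; exact: a_bnd.
- by move=> y; rewrite Y0.
Qed.

(** Both pairings are values of one solution [Y], started from [h] at the common time [t' - s]; the
    elapsed times are [t - t' + s] and [s]. *)
Let kernel_holder t t' x x' w w' s (h : G -> R) (B : R) :
  backward_kernel d N a t x w -> backward_kernel d N a t' x' w' ->
  t' <= t -> 0 < s -> (forall y, `|h y| <= B) ->
  `|\sum_y w (t - t' + s) y * h y - \sum_y w' s y * h y| <=
     CN * B * (t - t' + q (x - x')) `^ (sigma / 2) * s `^ (- (sigma / 2)).
Proof.
move=> bw bw' tt s0 hB; have d0 : 0 <= t - t' by rewrite subr_ge0.
have [Y [Y0 Ys]] := divform_exists d N ca a_bnd cm0 h (t' - s).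
have ds0 : 0 <= t - t' + s by rewrite addr_ge0// ltW.
have ds1 : 0 < t - t' + s by rewrite ltr_wpDl.
have E : t - (t - t' + s) = t' - s by ring.
have Ys' : solves_divform d N (fun r => a (t - (t - t' + s) + r)) Y by rewrite E.
rewrite (backward_kernelE bw ds0 Y0 Ys') (backward_kernelE bw' (ltW s0) Y0 Ys).
have := @nash (shift_coeff (t' - s)) Y B _ _ _ Ys _ (t - t' + s) s x x' ds1 s0.
move=> H; apply: (le_trans (H _ _ _ _)) => {H}.
- move=> y e r; apply: (@continuous_comp _ _ _ (fun r => t' - s + r) (fun t => a t y e)).
    by apply: cvgD; [exact: cvg_cst|exact: cvg_id].
  exact: ca.
- by move=> r y e; exact: a_sym.
- by move=> r y e; exact: a_bnd.
- by move=> y; rewrite Y0.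
rewrite addrK (ger0_norm d0) (min_r (_ : s <= t - t' + s)) ?lerDr//.
rewrite powRM ?(addr_ge0 d0) ?invr_ge0 ?(ltW s0)//.
by rewrite -(powR_inv1 (ltW s0)) -powRrM mulN1r mulrA.
Qed.

(** [CN * U] comes from the datum at time [-1], the summand [1] from the source between [t'] and
    [t], and the fraction from integrating [s^(-sigma/2)] over the two sides of time [0]. *)
Definition nash_cst : R :=
  CN * U + (1 + 2 * CN / (1 - sigma / 2)) * Kg * (T + 1) `^ (1 - sigma / 2).

Lemma nash_inhomogeneous t t' x x' : 0 <= t' <= t -> t <= T ->
  `|u t x - u t' x'| <= nash_cst * (t - t' + q (x - x')) `^ (sigma / 2).
Proof.
move=> /andP[t'0 t't] tT; have /andP[s0 s1] := sigma01.
have t't0 : 0 <= t - t' by rewrite subr_ge0.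
pose p := 1 - sigma / 2; have p0 : 0 < p by rewrite /p; lra.
have T0 : 0 <= T by rewrite (le_trans t'0)// (le_trans t't).
set W := _ `^ (sigma / 2); have W0 : 0 <= W by exact: powR_ge0.
have [w bw] := backward_kernel_exists d N ca a_bnd cm0 t x.
have [w' bw'] := backward_kernel_exists d N ca a_bnd cm0 t' x'.
pose Phi r := \sum_y w r y * u (t - r) y.
pose Phi' r := \sum_y w' r y * u (t' - r) y.
have Phi0 : Phi 0 = u t x.
  have [w0 _ _] := bw; rewrite /Phi subr0 (bigD1 x)//= w0 eqxx mul1r big1 ?addr0// => z /negPf zx.
  by rewrite w0 zx mul0r.
have Phi'0 : Phi' 0 = u t' x'.
  have [w0 _ _] := bw'; rewrite /Phi' subr0 (bigD1 x')//= w0 eqxx mul1r big1 ?addr0// => z /negPf zx.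
  by rewrite w0 zx mul0r.
set del := t - t' in t't0 W W0 *.
pose c := CN * Kg * W.
have c0 : 0 <= c by rewrite mulr_ge0// mulr_ge0.
(* Both pairings are read at the same absolute time [t' - s]: they test the same function and differ
   through the kernels alone. *)
pose Psi s := Phi (1 * s + del) - Phi' s.
have cPsi : continuous Psi.
  move=> s; apply: cvgB; last exact: (continuous_duhamel bw').
  apply: (@continuous_comp _ _ _ (fun s => 1 * s + del) Phi); last exact: (continuous_duhamel bw).
  by apply: cvgD; [apply: cvgM; [exact: cvg_cst|exact: cvg_id]|exact: cvg_cst].
have good s : 0 < s -> (-1 < t' - s < 0) || (0 < t' - s < T) ->
    is_derive s 1 Psi (- \sum_y w (1 * s + del) y * g (t' - s) y + \sum_y w' s y * g (t' - s) y) /\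
    `|- \sum_y w (1 * s + del) y * g (t' - s) y + \sum_y w' s y * g (t' - s) y| <= c * s `^ (p - 1).
  move=> sp gs; have E : t - (1 * s + del) = t' - s by rewrite /del; ring.
  have ds : 0 < 1 * s + del by rewrite mul1r ltr_wpDr.
  split.
    have D1 := is_derive_duhamel bw ds; rewrite E in D1.
    have D2 := is_derive_comp_affine (D1 gs).
    have D3 := is_derive_duhamel bw' sp gs.
    apply: is_derive_eq (is_derive_subf D2 D3) _.
    by rewrite mul1r opprK.
  have := kernel_holder bw bw' t't sp (fun y => gK y gs).
  rewrite -/del mul1r (addrC s) -normrN opprB [X in `|X|]addrC /c (_ : p - 1 = - (sigma / 2)) /p; last by ring.
  by [].
have step a1 b1 : 0 <= a1 -> a1 <= b1 -> b1 <= T + 1 ->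
   (forall s, a1 < s < b1 -> (-1 < t' - s < 0) || (0 < t' - s < T)) ->
   `|Psi b1 - Psi a1| <= c / p * (T + 1) `^ p.
  move=> a10 ab bT gd.
  apply: (@le_trans _ _ (c / p * b1 `^ p)).
    apply: (@powR_increment R Psi (fun s => - \sum_y w (1 * s + del) y * g (t' - s) y + \sum_y w' s y * g (t' - s) y) c p a1 b1) => //.
    - exact: continuous_subspaceT.
    - move=> s sab; have /andP[as_ _] := sab.
      exact: (good s (le_lt_trans a10 as_) (gd s sab)).1.
    - move=> s sab; have /andP[as_ _] := sab.
      exact: (good s (le_lt_trans a10 as_) (gd s sab)).2.
  rewrite ler_wpM2l ?divr_ge0 ?(ltW p0)//.
  by apply: ge0_ler_powR; rewrite ?nnegrE ?(ltW p0) ?(le_trans a10 ab)// addr_ge0.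
(* The value [s = t'] is the absolute time [0], where the prolonged [u] may have a corner;
   increments are taken separately on either side. *)
have S1 : `|Psi t' - Psi 0| <= c / p * (T + 1) `^ p.
  apply: step => //.
    by rewrite (le_trans t't)// (le_trans tT)// lerDl.
  move=> s /andP[sp st]; apply/orP; right; rewrite subr_gt0 st/=.
  by rewrite (lt_le_trans _ tT)// (lt_le_trans _ t't)// gtrBl.
have S2 : `|Psi (t' + 1) - Psi t'| <= c / p * (T + 1) `^ p.
  apply: step => //.
  - by rewrite lerDl.
  - by rewrite lerD2r (le_trans t't).
  - by move=> s /andP[sp st]; apply/orP; left; lra.
have S3 : `|Psi (t' + 1)| <= CN * U * W.
  have t1 : 0 < t' + 1 by rewrite ltr_wpDl.
  have := kernel_holder bw bw' t't t1 uU; rewrite -/del => H.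
  rewrite /Psi /Phi /Phi' mul1r (addrC (t' + 1)).
  rewrite (_ : t - (del + (t' + 1)) = -1); last by rewrite /del; ring.
  rewrite (_ : t' - (t' + 1) = -1); last by ring.
  apply: (le_trans H); rewrite -/W ler_piMr ?mulr_ge0//.
  by rewrite powRN invf_le1 ?powR_gt0// -[leLHS](powRr0 (t' + 1)) ler_powR ?lerDr// divr_ge0// ltW.
(* Between the times [t'] and [t] the maximum principle is enough: it gives [Kg * del], and [del] is
   at most [(T + 1)^p * del^(sigma/2)]. *)
have S4 : `|Phi del - Phi 0| <= Kg * del - Kg * 0.
  apply: (@dominated_increment R Phi (fun s => Kg * s) (fun r => - \sum_y w r y * g (t - r) y)
    (fun=> Kg) 0 del t't0) => [||s|s _|s].
  - by apply: continuous_subspaceT; exact: (continuous_duhamel bw).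
  - by apply: continuous_subspaceT => y; apply: cvgM; [exact: cvg_cst|exact: cvg_id].
  - move=> /andP[sp sd]; apply: (is_derive_duhamel bw sp).
    by apply/orP; right; rewrite /del in sd; lra.
  - by apply: is_derive_eq (is_derive_cmulf Kg (is_derive_id s (1 : R))) _; rewrite mulr1.
  - move=> /andP[sp sd]; rewrite normrN.
    apply: (kernel_bound bw (ltW sp)) => y; apply: gK.
    by apply/orP; right; rewrite /del in sd; lra.
have delW : Kg * del <= Kg * (T + 1) `^ p * W.
  rewrite -mulrA ler_wpM2l//.
  have [->|del0] := eqVneq del 0; first by rewrite mulr_ge0// powR_ge0.
  have dl0 : 0 < del by rewrite lt_neqAle eq_sym del0.
  have -> : del = del `^ p * del `^ (sigma / 2).
    by rewrite -powRD ?(gt_eqF dl0) ?implybT// /p subrK powRr1.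
  apply: ler_pM; rewrite ?powR_ge0//.
    apply: ge0_ler_powR; rewrite ?nnegrE ?(ltW p0) ?(addr_ge0 T0)//.
    by rewrite /del; lra.
  by rewrite /W; apply: ge0_ler_powR; rewrite ?nnegrE ?(addr_ge0 t't0) ?divr_ge0 ?(ltW s0)// lerDl.
have -> : u t x - u t' x' = - (Phi del - Phi 0) - (Psi t' - Psi 0) - (Psi (t' + 1) - Psi t')
    + Psi (t' + 1).
  by rewrite (_ : Psi 0 = Phi del - u t' x') ?Phi0; [ring|rewrite /Psi mulr0 add0r Phi'0].
have N1 (r1 r2 : R) : `|r1 - r2| <= `|r1| + `|r2| by exact: ler_normB.
apply: (le_trans (ler_normD _ _)).
apply: (le_trans (lerD (N1 _ _) (lexx _))).
apply: (le_trans (lerD (lerD (N1 _ _) (lexx _)) (lexx _))).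
rewrite normrN.
have -> : nash_cst * W = Kg * (T + 1) `^ p * W + c / p * (T + 1) `^ p + c / p * (T + 1) `^ p + CN * U * W.
  by rewrite /nash_cst /c -/p; ring.
apply: lerD => //; apply: lerD => //; apply: lerD => //.
by apply: le_trans delW; move: S4; rewrite mulr0 subr0.
Qed.

End NashHolder.

Section DividedDifference.
Variables (R : realType) (um up cm cp L : R) (phi dphi : R -> R).
Local Notation I v := (um <= v <= up).
Hypothesis dphi_bnd : forall v, I v -> cm <= dphi v <= cp.
Hypothesis dphi_lip : forall v w, I v -> I w -> `|dphi v - dphi w| <= L * `|v - w|.
Hypothesis phi_taylor : forall v w z, I v -> I w -> I z ->
  `|phi w - phi v - dphi z * (w - v)| <= L * (`|v - z| + `|w - z|) * `|w - v|.
Hypothesis phi_secant : forall v w, I v -> I w -> v < w ->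
  cm <= (phi w - phi v) / (w - v) <= cp.
Hypothesis cphi : continuous phi.

Definition divdiff (v w : R) : R :=
  if v == w then dphi v else (phi w - phi v) / (w - v).

Lemma divdiffC v w : divdiff v w = divdiff w v.
Proof.
rewrite /divdiff [w == v]eq_sym; case: eqVneq => [->//|vw].
by rewrite -opprB -[X in _ / X]opprB invrN mulrNN.
Qed.

Lemma divdiffE v w : divdiff v w * (w - v) = phi w - phi v.
Proof.
rewrite /divdiff; case: eqVneq => [->|vw]; first by rewrite !subrr mulr0.
by rewrite divfK// subr_eq0 eq_sym.
Qed.

Lemma divdiff_bnd v w : I v -> I w -> cm <= divdiff v w <= cp.
Proof.
move=> Iv Iw; have [vw|wv|<-] := ltgtP v w.
- by rewrite /divdiff lt_eqF// phi_secant.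
- by rewrite divdiffC /divdiff lt_eqF// phi_secant.
- by rewrite /divdiff eqxx dphi_bnd.
Qed.

(** Only times with [v t = w t] are delicate. There the Taylor bound, divided by [w s - v s],
    compares every nearby secant slope with the derivative. *)
Lemma continuous_divdiff (v w : R -> R) : continuous v -> continuous w ->
  (forall t, I (v t)) -> (forall t, I (w t)) ->
  continuous (fun t => divdiff (v t) (w t)).
Proof.
move=> cv cw Iv Iw t.
have [vw|vw] := eqVneq (v t) (w t); last first.
  have wv0 : w t - v t != 0 by rewrite subr_eq0 eq_sym.
  have cq : {for t, continuous (fun t => (phi (w t) - phi (v t)) / (w t - v t))}.
    apply: cvgM.
      apply: cvgB.
        by apply: (@continuous_comp _ _ _ w phi); [exact: cw|exact: cphi].
      by apply: (@continuous_comp _ _ _ v phi); [exact: cv|exact: cphi].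
    by apply: cvgV => //; apply: cvgB; [exact: cw|exact: cv].
  rewrite /continuous_at {2}/divdiff (negPf vw); apply: cvg_trans cq.
  apply: near_eq_cvg.
  have c0 : {for t, continuous (fun t => w t - v t)} by apply: cvgB; [exact: cw|exact: cv].
  have : \forall s \near t, w s - v s != 0 by exact: (cvgr_neq0 _ c0).
  by apply: filterS => s; rewrite subr_eq0 /divdiff eq_sym => /negPf ->.
have E0 : divdiff (v t) (w t) = dphi (w t) by rewrite /divdiff vw eqxx.
rewrite /continuous_at E0; apply/cvgrPdist_le => e e0.
have key s : `|dphi (w t) - divdiff (v s) (w s)| <= `|L| * (`|v s - v t| + `|w s - w t|).
  rewrite vw /divdiff; case: eqVneq => [E|vs].
    rewrite distrC (le_trans (dphi_lip (Iv s) (Iw t)))//.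
    apply: (@le_trans _ _ (`|L| * `|v s - w t|)); first by rewrite ler_wpM2r// ler_norm.
    by rewrite ler_wpM2l// lerDl.
  have ws0 : w s - v s != 0 by rewrite subr_eq0 eq_sym.
  have := phi_taylor (Iv s) (Iw s) (Iw t).
  have -> : phi (w s) - phi (v s) - dphi (w t) * (w s - v s) =
     - ((dphi (w t) - (phi (w s) - phi (v s)) / (w s - v s)) * (w s - v s)).
    by field.
  rewrite normrN normrM ler_pM2r ?normr_gt0// => /le_trans; apply.
  by rewrite ler_wpM2r ?addr_ge0// ler_norm.
have L1 : 0 < `|L| + 1 by rewrite ltr_wpDl.
have e2 : 0 < e / (`|L| + 1) / 2 by rewrite !divr_gt0.
have /cvgrPdist_le /(_ _ e2) H1 := cv t.
have /cvgrPdist_le /(_ _ e2) H2 := cw t.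
near=> s; apply: (le_trans (key s)).
have h1 : `|v t - v s| <= e / (`|L| + 1) / 2 by near: s.
have h2 : `|w t - w s| <= e / (`|L| + 1) / 2 by near: s.
rewrite (distrC (v s)) (distrC (w s)).
apply: (@le_trans _ _ ((`|L| + 1) * (e / (`|L| + 1)))).
  apply: ler_pM; rewrite ?addr_ge0// ?lerDl//.
  by rewrite [leRHS]splitr lerD.
by rewrite mulrC divfK// gt_eqF.
Unshelve. all: by end_near. Qed.

End DividedDifference.

(** * Interpolation of the gradient between a function and its Laplacian *)

Section Landau.
Variables (R : realType) (G : finZmodType) (D : finType) (o : D -> D) (d : D -> G) (N : R).
Hypotheses (oK : involutive o) (dN : forall e, d (o e) = - d e).
Implicit Types (e : D) (x y z : G) (t s r : R) (g : G -> R).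
Local Notation fdiff := (fdiff d N).
Local Notation flap := (flap d N).
Local Notation heat := (heat d N).

Lemma fdiff_heat_le e t g x (B : R) : 0 < t -> 0 <= B -> (forall y, `|g y| <= B) ->
  `|fdiff e (heat t g) x| <= B * t `^ (- 2^-1).
Proof.
move=> t0 B0 gB.
have H : t * fdiff e (heat t g) x ^+ 2 <= B ^+ 2.
  apply: (le_trans (heat_bernstein N oK dN e g x (ltW t0))).
  apply: (le_trans (ler_norm _)); apply: (heat_bound N oK dN) => [|y]; first exact: ltW.
  by rewrite normrX lerXn2r ?nnegrE.
have p0 : 0 <= B * t `^ (- 2^-1) by rewrite mulr_ge0 ?powR_ge0.
rewrite -ler_sqr ?nnegrE// real_normK ?num_real// [leRHS]exprMn.
have -> : (t `^ (- 2^-1)) ^+ 2 = t^-1.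
  rewrite -(powR_mulrn 2) ?powR_ge0// -powRrM (_ : - 2^-1 * 2%:R = -1); last by field.
  by rewrite powR_inv1// ltW.
by rewrite ler_pdivlMr// mulrC.
Qed.

Lemma flap_le g (B : R) : (forall e e' x, `|fdiff e (fdiff e' g) x| <= B) ->
  forall x, `|flap g x| <= #|D|%:R * B.
Proof.
move=> gB x; rewrite (flapE N oK dN) normrM normrN (@ger0_norm _ 2^-1) ?invr_ge0//.
apply: (@le_trans _ _ (2^-1 * (#|D|%:R * B))).
  rewrite ler_wpM2l ?invr_ge0// (le_trans (ler_norm_sum _ _ _))//.
  rewrite mulr_natl -sumr_const; exact: ler_sum.
have [D0|/card_gt0P[e _]] := posnP #|D|; first by rewrite D0 !mul0r mulr0.
have B0 : 0 <= B by exact: le_trans (gB e e x).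
rewrite ler_piMl ?mulr_ge0// invf_le1//; lra.
Qed.

(** The gradient is that of [heat t g] plus an increment in time of the smoothed gradient;
    Bernstein's inequality bounds the first by [U * t^(-1/2)] and the second by
    [2 * B * M * t^(1/2)]. *)
Lemma landau g (U B M : R) : 1 <= M -> 0 <= U -> 0 <= B ->
  (forall x, `|g x| <= U) -> (forall x, `|flap g x| <= B * M) ->
  forall e x, fdiff e g x ^+ 2 <= (U + 2 * B) ^+ 2 * M.
Proof.
move=> M1 U0 B0 gU gB e x.
have M0 : 0 < M by exact: lt_le_trans M1.
have BM0 : 0 <= B * M by rewrite mulr_ge0// ltW.
(* This time gives both contributions the order [M^(1/2)]. *)
pose t := M^-1; have t0 : 0 < t by rewrite invr_gt0.
have H1 := fdiff_heat_le e x t0 U0 gU.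
have H2 : `|heat t (fdiff e g) x - heat 0 (fdiff e g) x| <= B * M / 2^-1 * t `^ 2^-1.
  have two : 0 < 2^-1 :> R by rewrite invr_gt0.
  apply: (@powR_increment R (fun r => heat r (fdiff e g) x)
    (fun r => heat r (flap (fdiff e g)) x) (B * M) 2^-1 0 t (lexx _) (ltW t0) two BM0).
  - apply: continuous_subspaceT; apply: (@continuous_heat _ _ _ _ _ id (fun _ => fdiff e g)) => [y|z y].
      exact: cvg_id.
    exact: cst_continuous.
  - by move=> r /andP[r0 _]; exact: is_derive_heat_time.
  move=> r /andP[r0 _]; rewrite -fdiff_flap -fdiff_heat.
  rewrite (_ : 2^-1 - 1 = - 2^-1); last by field.
  exact: fdiff_heat_le.
rewrite heat0 in H2.
have tM : t `^ 2^-1 * M = M `^ 2^-1.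
  rewrite /t -powR_inv1 ?(ltW M0)// -powRrM -[X in _ * X](powRr1 (ltW M0)) -powRD ?(gt_eqF M0) ?implybT//.
  by congr (_ `^ _); field.
have tM' : t `^ (- 2^-1) = M `^ 2^-1.
  by rewrite /t -(powR_inv1 (ltW M0)) -powRrM; congr (_ `^ _); field.
have H : `|fdiff e g x| <= (U + 2 * B) * M `^ 2^-1.
  have -> : fdiff e g x = fdiff e (heat t g) x - (heat t (fdiff e g) x - fdiff e g x).
    by rewrite fdiff_heat subKr.
  apply: (le_trans (ler_normB _ _)); rewrite mulrDl -{1}tM'.
  apply: lerD => //; apply: (le_trans H2); rewrite invrK -tM.
  by rewrite le_eqVlt; apply/orP; left; apply/eqP; ring.
rewrite -real_normK ?num_real//.
apply: (@le_trans _ _ (((U + 2 * B) * M `^ 2^-1) ^+ 2)).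
  by rewrite lerXn2r ?nnegrE ?mulr_ge0 ?powR_ge0 ?addr_ge0 ?mulr_ge0.
rewrite exprMn -(powR_mulrn 2 (powR_ge0 _ _)) -powRrM mulVf// powRr1//; exact: ltW.
Qed.

End Landau.

(** The summand [C1] lets the same constant bound the genuine source [b]; the others bound the
    source at negative times. *)
Definition initial_force_cst (R : realType) (D : finType) (cp L C1 : R) : R :=
  C1 + cp * (#|D|%:R * C1) + #|D|%:R * L * (C1 + 2 * (#|D|%:R * C1)) ^+ 2.

Definition holder_cst (R : realType) (D : finType) (cp L sigma T CN C1 : R) : R :=
  CN * C1 + (1 + 2 * CN / (1 - sigma / 2)) * initial_force_cst D cp L C1
    * (T + 1) `^ (1 - sigma / 2).

Section QuasilinearHolder.
Variables (R : realType) (G : finZmodType) (D : finType) (o : D -> D) (d : D -> G) (N : R).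
Hypotheses (oK : involutive o) (dN : forall e, d (o e) = - d e).
Implicit Types (e : D) (x y z : G) (t s r : R).
Local Notation fdiff := (fdiff d N).
Local Notation flap := (flap d N).
Variables (q : G -> R) (T um up cm cp L sigma CN Kf C0 C1 M : R).
Hypotheses (q_ge0 : forall x, 0 <= q x) (qN : forall x, q (- x) = q x).
Hypotheses (T0 : 0 < T) (cm0 : 0 < cm) (sigma01 : 0 < sigma < 1) (CN0 : 0 <= CN).
Hypotheses (L0 : 0 <= L).
Hypothesis nash : nash_on_torus o d N q cm cp sigma CN.
Variables (phi dphi : R -> R) (u b : R -> G -> R).
Local Notation I v := (um <= v <= up).
Hypothesis dphi_bnd : forall v, I v -> cm <= dphi v <= cp.
Hypothesis dphi_lip : forall v w, I v -> I w -> `|dphi v - dphi w| <= L * `|v - w|.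
Hypothesis phi_taylor : forall v w z : R, I v -> I w -> I z ->
  `|phi w - phi v - dphi z * (w - v)| <= L * (`|v - z| + `|w - z|) * `|w - v|.
Hypothesis phi_secant : forall v w, I v -> I w -> v < w ->
  cm <= (phi w - phi v) / (w - v) <= cp.
Hypothesis cphi : continuous phi.
Hypothesis uI : forall t x, I (u t x).
Hypothesis cu : forall x, continuous (u^~ x).
Hypothesis u_neg : forall t, t <= 0 -> u t = u 0.
Hypothesis Du : forall t x, 0 < t < T ->
  is_derive t 1 (u^~ x) (flap (fun y => phi (u t y)) x + b t x).
Hypothesis bK : forall t x, 0 <= t <= T -> `|b t x| <= Kf.
Hypothesis u0_hess : forall e e' x, `|fdiff e (fdiff e' (u 0)) x| <= C0.
Hypothesis u_bound : forall t x, `|u t x| <= C1.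
Hypotheses (M1 : 1 <= M) (KM : Kf <= C1 * M) (CM : C0 <= C1 * M) (C11 : 1 <= C1).

Let M0 : 0 < M. Proof. exact: lt_le_trans M1. Qed.
Let C10 : 0 <= C1. Proof. exact: le_trans C11. Qed.
Let cp0 : 0 <= cp.
Proof.
have /andP[c1 c2] := dphi_bnd (uI 0 0).
by rewrite (le_trans (ltW cm0))// (le_trans c1).
Qed.

(** Expansion of [phi] at [u 0 x]: the linear part is a multiple of the Laplacian, and the remainder
    is at most [L] times squared differences, which [landau] bounds linearly in [M]. *)
Lemma initial_force_le x :
  `|flap (fun y => phi (u 0 y)) x| <= initial_force_cst D cp L C1 * M.
Proof.
have lap0 y : `|flap (u 0) y| <= #|D|%:R * C1 * M.
  rewrite (le_trans (flap_le oK dN u0_hess _))// -mulrA ler_wpM2l//.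
have DC0 : 0 <= #|D|%:R * C1 by rewrite mulr_ge0.
have land := landau oK dN M1 C10 DC0 (u_bound 0) lap0.
have -> : flap (fun y => phi (u 0 y)) x = dphi (u 0 x) * flap (u 0) x +
   \sum_e N ^+ 2 * (phi (u 0 (x + d e)) - phi (u 0 x) - dphi (u 0 x) * (u 0 (x + d e) - u 0 x)).
  rewrite -mulr_sumr /flap mulrCA -(mulrDr (N ^+ 2)); congr (_ * _).
  rewrite mulr_sumr -big_split/=.
  by apply: eq_bigr => e _; ring.
have B1 : `|dphi (u 0 x) * flap (u 0) x| <= cp * (#|D|%:R * C1) * M.
  have /andP[c1 c2] := dphi_bnd (uI 0 x).
  rewrite normrM -mulrA ler_pM// ger0_norm// (le_trans (ltW cm0))//.
have B2 : `|\sum_e N ^+ 2 * (phi (u 0 (x + d e)) - phi (u 0 x)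
     - dphi (u 0 x) * (u 0 (x + d e) - u 0 x))| <=
   #|D|%:R * L * (C1 + 2 * (#|D|%:R * C1)) ^+ 2 * M.
  rewrite (le_trans (ler_norm_sum _ _ _))//.
  have -> : #|D|%:R * L * (C1 + 2 * (#|D|%:R * C1)) ^+ 2 * M =
      \sum_(e : D) L * ((C1 + 2 * (#|D|%:R * C1)) ^+ 2 * M).
    by rewrite sumr_const -(mulr_natl _ #|D|); ring.
  apply: ler_sum => e _; rewrite normrM ger0_norm ?sqr_ge0//.
  apply: (@le_trans _ _ (L * fdiff e (u 0) x ^+ 2)); last by rewrite ler_wpM2l.
  rewrite /fdiff exprMn mulrCA ler_wpM2l ?sqr_ge0//.
  apply: (le_trans (phi_taylor (uI 0 x) (uI 0 (x + d e)) (uI 0 x))).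
  by rewrite subrr normr0 add0r -mulrA -expr2 real_normK ?num_real.
rewrite (le_trans (ler_normD _ _))//.
have -> : initial_force_cst D cp L C1 * M = C1 * M + (cp * (#|D|%:R * C1) * M
    + #|D|%:R * L * (C1 + 2 * (#|D|%:R * C1)) ^+ 2 * M) by rewrite /initial_force_cst; ring.
by rewrite (le_trans (lerD B1 B2))// lerDr mulr_ge0// ltW.
Qed.

(* The divided differences of [phi] along [u] turn the equation into divergence
   form; for [t < 0], where [u t = u 0], the source is [- flap (phi \o u 0)]. *)
Lemma quasilinear_holder t s x y : 0 <= t <= T -> 0 <= s <= T ->
  `|u t x - u s y| <= holder_cst D cp L sigma T CN C1 * M *
     (`|t - s| + q (x - y)) `^ (sigma / 2).
Proof.
wlog st : t s x y / s <= t.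
  move=> H tT sT; have [st|/ltW ts] := leP s t; first exact: H.
  by rewrite distrC (distrC t) -(opprB y x) qN; exact: H.
move=> /andP[t0 tT] /andP[s0 sT].
pose a t x e := divdiff phi dphi (u t x) (u t (x + d e)).
pose g t x := if t < 0 then - flap (fun y => phi (u 0 y)) x else b t x.
pose Kg := initial_force_cst D cp L C1 * M.
have KfKg : Kf <= Kg.
  rewrite (le_trans KM)// /Kg /initial_force_cst ler_wpM2r ?(ltW M0)// -addrA lerDl.
  by rewrite addr_ge0// mulr_ge0 ?sqr_ge0// mulr_ge0.
have Kg0 : 0 <= Kg.
  by apply: le_trans KfKg; apply: le_trans (bK 0 (_ : 0 <= 0 <= T)); rewrite ?lexx//= ltW.
have aE t' x' : divform d N a t' (u t') x' = flap (fun y => phi (u t' y)) x'.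
  by rewrite /divform /flap; congr (_ * _); apply: eq_bigr => e _; rewrite /a divdiffE.
have := @nash_inhomogeneous R G D o d N q cm cp sigma CN q_ge0 cm0 sigma01 CN0 nash
  a u g T C1 Kg _ _ _ cu _ _ _ C10 Kg0 t s x y _ tT.
move=> H; rewrite (@ger0_norm _ (t - s)) ?subr_ge0//.
apply: (le_trans (H _ _ _ _ _ _ _)) => {H}.
- by move=> z e; apply: (continuous_divdiff dphi_lip phi_taylor cphi).
- by move=> r z e; rewrite /a dN addrK divdiffC.
- by move=> r z e; apply: (divdiff_bnd dphi_bnd phi_secant).
- move=> r z; have [r0|r0] := ltP r 0; last first.
    rewrite andbF/= => rT; rewrite aE /g ltNge r0/=; exact: Du.
  move=> _; rewrite aE /g r0 (u_neg (ltW r0)) subrr.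
  have c0 : is_derive r 1 (fun=> u 0 z) (0 : R) by exact: is_derive_cstf.
  apply: near_eq_is_derive c0; near=> r'.
  by rewrite (u_neg (t := r'))//; apply: ltW; near: r'; exact: lt_nbhsl.
- move=> r z; rewrite /g; case: ifP => r0.
    by move=> _; rewrite normrN; exact: initial_force_le.
  by rewrite andbF/= => /andP[r1 r2]; rewrite (le_trans (bK _ _))// !ltW.
- by move=> z; exact: u_bound.
- by rewrite s0.
rewrite ler_wpM2r ?powR_ge0// /nash_cst.
have -> : holder_cst D cp L sigma T CN C1 * M = CN * C1 * M
    + (1 + 2 * CN / (1 - sigma / 2)) * Kg * (T + 1) `^ (1 - sigma / 2).
  by rewrite /holder_cst /Kg; ring.
by rewrite lerD2r ler_peMr// mulr_ge0.
Unshelve. all: by end_near. Qed.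

End QuasilinearHolder.

(** * Polylinear interpolation *)

Section LinearInterpolation.
Variable R : realType.

Definition lin_interp (h : int -> R) (b : R) : R :=
  (1 - (b - (Num.floor b)%:~R)) * h (Num.floor b)
  + (b - (Num.floor b)%:~R) * h (Num.floor b + 1).

(** The factor 3 counts the pieces from [b] to the next integer, between integers, and from the last
    integer to [c]. On the outer pieces the length is at most [1], hence at most its own power
    [s]. *)
Lemma lin_interp_holder (h : int -> R) (A s b c : R) : 0 <= A -> 0 < s <= 1 ->
  (forall (k : int) (j : nat), `|h (k + j%:Z) - h k| <= A * j%:R `^ s) ->
  `|lin_interp h b - lin_interp h c| <= 3 * A * `|b - c| `^ s.
Proof.
move=> A0 /andP[s0 s1] hA.
wlog bc : b c / b <= c.
  by move=> H; have [|/ltW] := leP b c => /H//; rewrite distrC (distrC b).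
have hA1 (k : int) : `|h (k + 1) - h k| <= A.
  by have := hA k 1%N; rewrite powR1 mulr1.
have mono (r : R) : 0 <= r <= c - b -> r `^ s <= (c - b) `^ s.
  move=> /andP[r0 rcb].
  by apply: (ge0_ler_powR (ltW s0)); rewrite ?nnegrE ?(le_trans r0).
have small (r : R) : 0 <= r <= c - b -> r <= 1 -> r <= (c - b) `^ s.
  move=> rcb r1; have /andP[r0 _] := rcb.
  have [->|rn0] := eqVneq r 0; first exact: powR_ge0.
  have rpos : 0 < r by rewrite lt_neqAle eq_sym rn0.
  by rewrite (@le_trans _ _ (r `^ s)) ?mono// ger1_powR// rpos.
rewrite (distrC b c) (@ger0_norm _ (c - b)) ?subr_ge0//.
set W := (c - b) `^ s in mono small *.
have W0 : 0 <= W by exact: powR_ge0.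
have AW0 : 0 <= A * W by rewrite mulr_ge0.
rewrite /lin_interp.
have /andP[b1 b2] := floor_itv b; have /andP[c1 c2] := floor_itv c.
have jk : Num.floor b <= Num.floor c by exact: le_floor.
move: (Num.floor b) (Num.floor c) b1 b2 c1 c2 jk => j k; rewrite !intrD => b1 b2 c1 c2.
rewrite le_eqVlt => /predU1P[jk|jk].
  rewrite -{}jk in c1 c2 *.
  have -> : (1 - (b - j%:~R)) * h j + (b - j%:~R) * h (j + 1) -
     ((1 - (c - j%:~R)) * h j + (c - j%:~R) * h (j + 1)) =
     (b - c) * (h (j + 1) - h j) by ring.
  rewrite normrM (distrC b) (@ger0_norm _ (c - b)) ?subr_ge0//.
  apply: (@le_trans _ _ (W * A)); last by lra.
  by apply: ler_pM => //; [rewrite subr_ge0|apply: small; lra].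
have [m km] : exists m : nat, k = j + 1 + m%:Z.
  exists `|(k - (j + 1))%R|%N; rewrite gez0_abs; first by rewrite addrC subrK.
  by rewrite subr_ge0 -ltzD1 ltrD2r.
have kR : k%:~R = j%:~R + 1 + m%:R :> R by rewrite km !intrD.
have -> : (1 - (b - j%:~R)) * h j + (b - j%:~R) * h (j + 1) -
   ((1 - (c - k%:~R)) * h k + (c - k%:~R) * h (k + 1)) =
   - ((j%:~R + 1 - b) * (h (j + 1) - h j)) - (h k - h (j + 1))
    - (c - k%:~R) * (h (k + 1) - h k) by ring.
have m0 : 0 <= m%:R :> R by [].
have H1 : `|(j%:~R + 1 - b) * (h (j + 1) - h j)| <= W * A.
  rewrite normrM ger0_norm; last by lra.
  by apply: ler_pM => //; [lra|apply: small; lra].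
have H2 : `|h k - h (j + 1)| <= W * A.
  rewrite km (le_trans (hA _ _))// mulrC ler_wpM2r//; apply: mono; lra.
have H3 : `|(c - k%:~R) * (h (k + 1) - h k)| <= W * A.
  rewrite normrM ger0_norm; last by lra.
  by apply: ler_pM => //; [lra|apply: small; lra].
rewrite (le_trans (ler_normB _ _))//.
apply: (le_trans (lerD (ler_normB _ _) (lexx _))).
by rewrite normrN; lra.
Qed.

End LinearInterpolation.

Section Interpolation.
Variables (R : realType) (n N : nat).
Hypothesis N0 : (0 < N)%N.
Implicit Types (g : 'rV[int]_n -> R) (z : 'rV[R]_n) (i : 'I_n).

Definition pinterp g z : R := \sum_(v : {ffun 'I_n -> bool})
    (\prod_(i < n) theta N (v i) (z 0 i)) *
    g (\row_i (Num.floor (N%:R * z 0 i) + (v i : nat)%:Z)).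

Lemma theta_ge0 v (b : R) : 0 <= theta N v b.
Proof.
have /andP[] := floor_itv (N%:R * b); rewrite intrD /theta.
by case: v; lra.
Qed.

Lemma sum_prod_theta z :
  \sum_(v : {ffun 'I_n -> bool}) \prod_(i < n) theta N (v i) (z 0 i) = 1.
Proof.
rewrite -(bigA_distr_bigA (fun i b => theta N b (z 0 i))) big1// => i _.
by rewrite big_bool /theta/=; ring.
Qed.

Lemma pinterp_bound g z (B : R) : (forall x, `|g x| <= B) -> `|pinterp g z| <= B.
Proof.
move=> gB; rewrite -[B]mulr1 -(sum_prod_theta z) mulr_sumr.
rewrite (le_trans (ler_norm_sum _ _ _))//; apply: ler_sum => v _.
have p0 : 0 <= \prod_(i < n) theta N (v i) (z 0 i).
  by apply: prodr_ge0 => i _; exact: theta_ge0.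
by rewrite normrM ger0_norm// mulrC ler_wpM2r.
Qed.

Lemma pinterp_lin (a b : R) g g' z :
  pinterp (fun x => a * g x + b * g' x) z = a * pinterp g z + b * pinterp g' z.
Proof.
by rewrite /pinterp !mulr_sumr -big_split/=; apply: eq_bigr => v _; ring.
Qed.

Lemma floor_latpt (x : 'rV[int]_n) z i :
  Num.floor (N%:R * (z + latpt R N x) 0 i) = Num.floor (N%:R * z 0 i) + x 0 i.
Proof.
rewrite !mxE mulrDr mulrA mulfV ?pnatr_eq0 -?lt0n// mul1r.
by rewrite floorDrz ?intrKfloor// rpred_int_num.
Qed.

Lemma theta_latpt v (x : 'rV[int]_n) z i :
  theta N v ((z + latpt R N x) 0 i) = theta N v (z 0 i).
Proof.
rewrite /theta floor_latpt !mxE mulrDr mulrA mulfV ?pnatr_eq0 -?lt0n// mul1r.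
by rewrite intrD; case: v; ring.
Qed.

Lemma pinterp_latpt g (x : 'rV[int]_n) z :
  pinterp g (z + latpt R N x) = pinterp (fun y => g (y + x)) z.
Proof.
rewrite /pinterp; apply: eq_bigr => v _; congr (_ * _).
  by apply: eq_bigr => i _; rewrite theta_latpt.
by congr (g _); apply/rowP => i; rewrite mxE floor_latpt !mxE addrAC.
Qed.

Definition flip i (v : {ffun 'I_n -> bool}) : {ffun 'I_n -> bool} :=
  [ffun j => if j == i then ~~ v j else v j].

Lemma flipK i : involutive (flip i).
Proof.
by move=> v; apply/ffunP => j; rewrite !ffunE; case: eqP => // _; rewrite negbK.
Qed.

Definition weight i (v : {ffun 'I_n -> bool}) z : R :=
  \prod_(j < n | j != i) theta N (v j) (z 0 j).

Definition section i (v : {ffun 'I_n -> bool}) z g (k : int) : R :=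
  g (\row_j (if j == i then k else Num.floor (N%:R * z 0 j) + (v j : nat)%:Z)).

(** [flip i] pairs the vertices of a cell along the [i]th axis. The interpolation becomes a convex
    combination of one-dimensional ones, whose weights do not involve [z 0 i]. *)
Lemma pinterp_section i g z : pinterp g z =
  \sum_(v : {ffun 'I_n -> bool} | ~~ v i) weight i v z * lin_interp (section i v z g) (N%:R * z 0 i).
Proof.
rewrite /pinterp (bigID (fun v : {ffun 'I_n -> bool} => ~~ v i))/=.
rewrite [X in _ + X](reindex_inj (inv_inj (flipK i)))/=.
rewrite [X in _ + X](eq_bigl (fun v : {ffun 'I_n -> bool} => ~~ v i)); last first.
  by move=> v; rewrite ffunE eqxx negbK.
rewrite -big_split/=; apply: eq_bigr => v /negPf vi.
rewrite (bigD1 i)//= [X in _ + X * _](bigD1 i)//= ffunE eqxx vi /=.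
rewrite (_ : \prod_(j < n | j != i) theta N (flip i v j) (z 0 j) = weight i v z); last first.
  by apply: eq_bigr => j /negPf ji; rewrite ffunE ji.
rewrite -/(weight i v z) /lin_interp /section /theta.
rewrite (_ : \row_j (Num.floor (N%:R * z 0 j) + (v j : nat)%:Z) =
  \row_j (if j == i then Num.floor (N%:R * z 0 i) else Num.floor (N%:R * z 0 j) + (v j : nat)%:Z)); last first.
  by apply/rowP => j; rewrite !mxE; case: eqP => [->|//]; rewrite vi addr0.
rewrite (_ : \row_j (Num.floor (N%:R * z 0 j) + (flip i v j : nat)%:Z) =
  \row_j (if j == i then Num.floor (N%:R * z 0 i) + 1 else Num.floor (N%:R * z 0 j) + (v j : nat)%:Z)); last first.
  by apply/rowP => j; rewrite !mxE ffunE; case: eqP => [->|//]; rewrite vi.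
by ring.
Qed.

Lemma sum_weight i z : \sum_(v : {ffun 'I_n -> bool} | ~~ v i) weight i v z = 1.
Proof.
rewrite -(sum_prod_theta z); transitivity (pinterp (fun=> 1) z); last first.
  by apply: eq_bigr => v _; rewrite mulr1.
rewrite (pinterp_section i); apply: eq_bigr => v _.
by rewrite /lin_interp /section; ring.
Qed.

Lemma pinterp_coord g z z' i (A s : R) : 0 <= A -> 0 < s <= 1 ->
  (forall j, j != i -> z 0 j = z' 0 j) ->
  (forall x (k : nat), `|g (x + k%:Z *: delta_mx 0 i) - g x| <= A * k%:R `^ s) ->
  `|pinterp g z - pinterp g z'| <= 3 * A * (N%:R * `|z 0 i - z' 0 i|) `^ s.
Proof.
move=> A0 s01 zz' gA; rewrite !(pinterp_section i).
set W := 3 * A * _.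
have -> : W = \sum_(v : {ffun 'I_n -> bool} | ~~ v i) weight i v z * W.
  by rewrite -mulr_suml sum_weight mul1r.
have wE v : weight i v z' = weight i v z by apply: eq_bigr => j /zz' ->.
have sE v : section i v z' g = section i v z g.
  apply/funext => k; rewrite /section; congr (g _); apply/rowP => j; rewrite !mxE.
  by case: eqP => // /eqP /zz' ->.
rewrite -sumrB (le_trans (ler_norm_sum _ _ _))//; apply: ler_sum => v _.
rewrite wE sE -mulrBr normrM ger0_norm; last first.
  by apply: prodr_ge0 => j _; exact: theta_ge0.
rewrite ler_wpM2l//; first by apply: prodr_ge0 => j _; exact: theta_ge0.
apply: (le_trans (@lin_interp_holder R _ A s _ _ A0 s01 _)) => [k j|].
  rewrite /section; set x := \row_j _.
  have := gA (\row_j (if j == i then k else Num.floor (N%:R * z 0 j) + (v j : nat)%:Z)) j.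
  rewrite (_ : _ + _ = x)//; apply/rowP => l; rewrite !mxE/=.
  by case: eqP => _; rewrite ?mulr1 ?mulr0 ?addr0.
by rewrite /W -mulrBr normrM ger0_norm.
Qed.

(** Coordinates are changed one at a time through the points [zk k], whence the factor [n]. *)
Lemma pinterp_holder g (A s : R) : 0 <= A -> 0 < s <= 1 ->
  (forall i x (k : nat), `|g (x + k%:Z *: delta_mx 0 i) - g x| <= A * (k%:R / N%:R) `^ s) ->
  forall z z', `|pinterp g z - pinterp g z'| <= 3 * n%:R * A * enorm (z - z') `^ s.
Proof.
move=> A0 s01 gA z z'.
have N0R : 0 < N%:R :> R by rewrite ltr0n.
have /andP[s0 s1] := s01.
pose zk (k : nat) : 'rV[R]_n := \row_j (if (j < k)%N then z' 0 j else z 0 j).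
have coord_le i : `|z 0 i - z' 0 i| <= enorm (z - z').
  rewrite -sqrtr_sqr /enorm ler_wsqrtr// (bigD1 i)//= !mxE lerDl.
  by apply: sumr_ge0 => j _; rewrite sqr_ge0.
pose E := enorm (z - z') `^ s.
suff H k : (k <= n)%N -> `|pinterp g z - pinterp g (zk k)| <= 3 * k%:R * A * E.
  have := H n (leqnn n); rewrite (_ : zk n = z')//.
  by apply/rowP => j; rewrite mxE ltn_ord.
elim: k => [_|k IH kn].
  rewrite (_ : zk 0%N = z); last by apply/rowP => j; rewrite mxE.
  by rewrite subrr normr0 mulr0 !mul0r.
pose i := Ordinal kn.
have step : `|pinterp g (zk k) - pinterp g (zk k.+1)| <= 3 * A * E.
  have A0' : 0 <= A / N%:R `^ s by rewrite divr_ge0// powR_ge0.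
  apply: (le_trans (@pinterp_coord g (zk k) (zk k.+1) i (A / N%:R `^ s) s A0' s01 _ _)).
  - move=> j ji; rewrite !mxE ltnS (leq_eqVlt j k) (_ : (j == k :> nat) = false)//.
    by apply/negbTE; apply: contra ji => /eqP jk; apply/eqP/val_inj.
  - move=> x m; apply: (le_trans (gA i x m)).
    rewrite powRM ?invr_ge0 ?ler0n// -powR_inv1 ?ler0n// -powRrM mulN1r powRN.
    by rewrite -mulrA ler_wpM2l// mulrC.
  rewrite !mxE/= ltnn ltnS leqnn powRM ?ler0n//.
  have -> : 3 * (A / N%:R `^ s) * (N%:R `^ s * `|z 0 i - z' 0 i| `^ s) = 3 * A * `|z 0 i - z' 0 i| `^ s.
    by field; rewrite gt_eqF// powR_gt0.
  rewrite ler_wpM2l ?mulr_ge0//.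
  by apply: (ge0_ler_powR (ltW s0)); rewrite ?nnegrE// sqrtr_ge0.
have split3 (r1 r2 r3 : R) : r1 - r3 = (r1 - r2) + (r2 - r3) by ring.
rewrite (split3 _ (pinterp g (zk k))) (le_trans (ler_normD _ _))//.
have := IH (ltnW kn); have : k.+1%:R = k%:R + 1 :> R by rewrite natr1.
by move=> ->; lra.
Qed.

(* The infimum in [torus_dist] need not be known to be attained: a power bound
   for every lift passes to the infimum. *)
Lemma pinterp_torus g (A s : R) : 0 <= A -> 0 < s <= 1 ->
  (forall x k : 'rV[int]_n, g (x + N%:Z *: k) = g x) ->
  (forall i x (k : nat), `|g (x + k%:Z *: delta_mx 0 i) - g x| <= A * (k%:R / N%:R) `^ s) ->
  forall z z', `|pinterp g z - pinterp g z'| <= 3 * n%:R * A * torus_dist z z' `^ s.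
Proof.
move=> A0 s01 gper gA z z'; have /andP[s0 s1] := s01.
have N0R : 0 < N%:R :> R by rewrite ltr0n.
set B := 3 * n%:R * A; have B0 : 0 <= B by rewrite !mulr_ge0.
have lift (k : 'rV[int]_n) :
    `|pinterp g z - pinterp g z'| <= B * enorm (z - z' + map_mx intr k) `^ s.
  have -> : pinterp g z = pinterp g (z + map_mx intr k).
    rewrite (_ : map_mx intr k = latpt R N (N%:Z *: k)); last first.
      apply/rowP => j; rewrite !mxE intrM mulrA mulVf ?mul1r// gt_eqF//.
    rewrite pinterp_latpt; apply: eq_bigr => v _; congr (_ * _).
    by rewrite gper.
  by rewrite [z - z' + _]addrAC; exact: pinterp_holder.
rewrite /torus_dist; set S := (X in inf X).
have SN : S !=set0 by exists (enorm (z - z' + map_mx intr (0 : 'rV[int]_n))), 0.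
have S0 : lbound S 0 by move=> _ [k _ <-]; exact: sqrtr_ge0.
have [->|D0] := eqVneq `|pinterp g z - pinterp g z'| 0.
  by rewrite mulr_ge0// powR_ge0.
have Dpos : 0 < `|pinterp g z - pinterp g z'| by rewrite lt_neqAle eq_sym D0 normr_ge0.
have Bpos : 0 < B.
  rewrite lt_neqAle B0 andbT; apply: contraTneq Dpos => B_0.
  by rewrite -leNgt; have := lift 0; rewrite -B_0 mul0r.
set Dl := `|_| in Dpos lift *.
rewrite -ler_pdivrMl// mulrC.
have q0 : 0 <= Dl / B by rewrite divr_ge0// ltW.
apply: (@le_trans _ _ (((Dl / B) `^ s^-1) `^ s)).
  by rewrite -powRrM mulVf ?gt_eqF// powRr1.
apply: (ge0_ler_powR (ltW s0)); rewrite ?nnegrE ?powR_ge0//.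
  exact: lb_le_inf.
apply: lb_le_inf => // _ [k _ <-].
have e0 : 0 <= enorm (z - z' + map_mx intr k) by exact: sqrtr_ge0.
have -> : enorm (z - z' + map_mx intr k) = (enorm (z - z' + map_mx intr k) `^ s) `^ s^-1.
  by rewrite -powRrM mulfV ?gt_eqF// powRr1.
apply: ge0_ler_powR; rewrite ?nnegrE ?invr_ge0 ?(ltW s0) ?powR_ge0//.
by rewrite ler_pdivrMr// mulrC.
Qed.

End Interpolation.

(** * The discrete torus *)

Section DiscreteTorus.
Variables (n N' : nat).
Local Notation N := N'.+1.
Local Notation G := 'rV['I_N]_n.
Implicit Types (v w : 'rV[int]_n) (g h : G) (e : dir n).

(** The group ['I_N] is correct for [N = 1] too. Only its addition is used, so an integer is reduced
    as a multiple of [Zp1]. *)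
Definition proj v : G := \row_i (Zp1 *~ v 0 i).
Definition lift g : 'rV[int]_n := \row_i (g 0 i : nat)%:Z.
Definition step e : G := proj (dvec e).

Lemma projD v w : proj (v + w) = proj v + proj w.
Proof. by apply/rowP => i; rewrite !mxE mulrzDr. Qed.

Lemma projN v : proj (- v) = - proj v.
Proof. by apply/rowP => i; rewrite !mxE mulrNz. Qed.

Lemma projMn v j : proj (v *+ j) = proj v *+ j.
Proof.
elim: j => [|j IH]; last by rewrite !mulrS projD IH.
by apply/rowP => i; rewrite !mxE mulr0z.
Qed.

Lemma proj_sum (I : Type) (r : seq I) (F : I -> 'rV[int]_n) :
  proj (\sum_(i <- r) F i) = \sum_(i <- r) proj (F i).
Proof.
apply: (big_morph proj projD); by apply/rowP => i; rewrite !mxE mulr0z.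
Qed.

Lemma Zp1_mulrn (m : nat) : (Zp1 : 'I_N) *+ m = inZp m.
Proof. by rewrite Zp_mulrn; apply: val_inj => /=; rewrite modnMml mul1n. Qed.

Lemma proj_lift g : proj (lift g) = g.
Proof.
by apply/rowP => i; rewrite !mxE -pmulrn Zp1_mulrn valZpK.
Qed.

Lemma Zp1_mulrz (k : int) : exists j : int, k = ((Zp1 : 'I_N) *~ k : nat)%:Z + N%:Z * j.
Proof.
have [r rN kr] : exists2 r : nat, (r < N)%N & k = r%:Z + N%:Z * (k %/ N%:Z)%Z.
  have : (0 <= (k %% N%:Z)%Z) by rewrite modz_ge0.
  have := ltz_pmod k (isT : 0 < N%:Z).
  have := divz_eq k N%:Z; case: (k %% N%:Z)%Z => // r kE rN _.
  by exists r => //; rewrite {1}kE addrC mulrC.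
exists (k %/ N%:Z)%Z; rewrite {1}kr; congr (_%:Z + _).
rewrite kr mulrzDr mulrzA -!pmulrn !Zp1_mulrn.
have -> : inZp N = 0 :> 'I_N by apply: val_inj; rewrite /= modnn.
by rewrite mul0rz addr0/= modn_small.
Qed.

Lemma lift_proj v : exists k : 'rV[int]_n, v = lift (proj v) + N%:Z *: k.
Proof.
exists (\row_i (sval (cid (Zp1_mulrz (v 0 i))))); apply/rowP => i; rewrite !mxE.
by case: cid => /= j.
Qed.

Lemma stepN e : step (dirN e) = - step e.
Proof.
rewrite /step -projN; congr proj; rewrite /dvec/= -scaleNr.
by case: e.2; rewrite ?expr1 ?expr0 ?opprK.
Qed.

Lemma dirNK : involutive (@dirN n).
Proof. by case=> i b; rewrite /dirN/= negbK. Qed.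

Variable R : realType.

Definition sqdist v : R := \sum_i ((v 0 i)%:~R / N%:R) ^+ 2.

Lemma enorm_latpt v : enorm (latpt R N v) = Num.sqrt (sqdist v).
Proof. by congr Num.sqrt; apply: eq_bigr => i _; rewrite !mxE mulrC. Qed.

(* The squared distance to [0] on the torus: the minimum of [sqdist] over the
   lifts. *)
Definition tdist g : R := \sum_i ((minn (g 0 i) (N - g 0 i))%:R / N%:R) ^+ 2.

Lemma tdist_ge0 g : 0 <= tdist g.
Proof. by apply: sumr_ge0 => i _; rewrite sqr_ge0. Qed.

(** Write a coordinate as [m + N * j] with [0 <= m < N]: its absolute value is at least [m] if
    [j >= 0] and at least [N - m] if [j < 0]. *)
Lemma tdist_proj v : tdist (proj v) <= sqdist v.
Proof.
apply: ler_sum => i _; rewrite !mxE !exprMn ler_wpM2r ?sqr_ge0//.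
have [j kj] := Zp1_mulrz (v 0 i).
have mN := ltn_ord ((Zp1 : 'I_N) *~ v 0 i).
rewrite -[leRHS]real_normK ?num_real// -intr_norm -abszE -pmulrn ler_pXn2r ?nnegrE//.
rewrite ler_nat; move: kj mN; set m := nat_of_ord _; move: (v 0 i) => k -> mN.
have [j0|j0] := lerP 0 j.
  rewrite geq_min; apply/orP; left; rewrite -lez_nat gez0_abs ?addr_ge0 ?mulr_ge0//.
  by rewrite lerDl mulr_ge0.
rewrite geq_min; apply/orP; right; rewrite -lez_nat abszE.
rewrite -subzn; last exact: ltnW.
rewrite ler_normr; apply/orP; right.
have : N%:Z * j <= N%:Z * -1 by rewrite ler_wpM2l// -ltzD1.
by lra.
Qed.

(** Together with [tdist_proj] this reduces the properties of [tdist] to those of [sqdist]: choose a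
    minimal lift, compute in [Z^n], project back. *)
Lemma tdist_attained g : exists2 v, proj v = g & tdist g = sqdist v.
Proof.
pose v : 'rV[int]_n := \row_i (if (g 0%R i <= N - g 0%R i)%N then (g 0 i : nat)%:Z
   else (g 0 i : nat)%:Z - N%:Z).
exists v.
  apply/rowP => i; rewrite !mxE; have gE : Zp1 *~ (g 0 i : nat)%:Z = g 0 i.
    by rewrite -pmulrn Zp1_mulrn valZpK.
  case: ifP => _ //; rewrite mulrzBr gE -pmulrn Zp1_mulrn.
  have -> : inZp N = 0 :> 'I_N by apply: val_inj; rewrite /= modnn.
  by rewrite subr0.
apply: eq_bigr => i _; rewrite mxE /minn; have gN := ltnW (ltn_ord (g 0 i)).
case: ifPn => H1; case: ifPn => H2; rewrite ?intrB -?pmulrn ?natrB //.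
- by rewrite (ltnW H1) in H2.
- have E : nat_of_ord (g 0 i) = (N - g 0%R i)%N.
    by apply/eqP; rewrite eqn_leq H2/= leqNgt.
  by rewrite -natrB// -E.
- by field; rewrite nat1r pnatr_eq0.
Qed.

Lemma sqdistD v w : sqdist (v + w) <= 2 * (sqdist v + sqdist w).
Proof.
rewrite /sqdist -big_split mulr_sumr/=; apply: ler_sum => i _; rewrite !mxE intrD.
set a := _%:~R; set b := _%:~R; rewrite mulrDl.
set a' := a / _; set b' := b / _; have := sqr_ge0 (a' - b'); lra.
Qed.

Lemma tdistD g h : tdist (g + h) <= 2 * (tdist g + tdist h).
Proof.
have [v <- ->] := tdist_attained g; have [w <- ->] := tdist_attained h.
by rewrite -projD (le_trans (tdist_proj _)) ?sqdistD.
Qed.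

Lemma tdistN g : tdist (- g) = tdist g.
Proof.
have le h : tdist (- h) <= tdist h.
  have [v <- ->] := tdist_attained h; rewrite -projN (le_trans (tdist_proj _))//.
  by apply: ler_sum => i _; rewrite !mxE mulrNz mulNr sqrrN.
by apply/eqP; rewrite eq_le le/= -{1}[g]opprK le.
Qed.

Lemma tdist0 : tdist 0 = 0.
Proof. by rewrite /tdist big1// => i _; rewrite mxE min0n mul0r expr0n. Qed.

Lemma sqdist_step e j : sqdist (dvec e *+ j) = (j%:R / N%:R) ^+ 2.
Proof.
rewrite /sqdist (bigD1 e.1)//= big1 ?addr0 => [|i ie]; rewrite mulmxnE !mxE !eqxx/=.
  rewrite mulr1 rmorphMn rmorphXn/= rmorphN1.
  by rewrite -(mulr_natr (_ ^+ _) j) -mulrA exprMn sqrr_sign mul1r.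
by rewrite (negPf ie) mulr0 mul0rn mul0r expr0n.
Qed.

Lemma tdist_step e j : tdist (step e *+ j) <= (j%:R / N%:R) ^+ 2.
Proof. by rewrite -projMn (le_trans (tdist_proj _))// sqdist_step. Qed.

(** One segment for each coordinate of a minimal lift. *)
Lemma tdist_path g : exists s : seq (dir n * nat), [/\ (size s <= n)%N,
  g = \sum_(p <- s) step p.1 *+ p.2 & all (fun p => (p.2%:R / N%:R) ^+ 2 <= tdist g) s].
Proof.
have [v vg ->] := tdist_attained g.
exists [seq ((i, v 0 i < 0), `|(v 0 i)%R|%N) | i <- enum 'I_n]; split.
- by rewrite size_map size_enum_ord.
- rewrite big_map -vg {1}(_ : v = \sum_(i <- enum 'I_n) v 0 i *: delta_mx 0 i).
    rewrite proj_sum; apply: eq_bigr => i _; rewrite -projMn; congr proj.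
    rewrite /dvec/= -scaler_nat scalerA {1}[v 0 i]intEsign.
    by rewrite mulrC natz.
  by rewrite [LHS]row_sum_delta big_enum.
- apply/allP => p /mapP[i _ ->] /=.
  rewrite /sqdist (bigD1 i)//= natr_absz intr_norm.
  have -> : (`|(v 0 i)%:~R| / N%:R) ^+ 2 = ((v 0 i)%:~R / N%:R) ^+ 2 :> R.
    by rewrite !exprMn real_normK ?num_real.
  by rewrite lerDl sumr_ge0// => k _; rewrite sqr_ge0.
Qed.

Lemma sum_sqdist_step v :
  N%:R ^+ 2 * \sum_(e : dir n) (sqdist (v + dvec e) - sqdist v) = 2 * n%:R.
Proof.
have NR : N%:R != 0 :> R by rewrite pnatr_eq0.
have E e : sqdist (v + dvec e) - sqdist v = (2 * (-1) ^+ e.2 * (v 0 e.1)%:~R + 1) / N%:R ^+ 2.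
  rewrite /sqdist -sumrB (bigD1 e.1)//= big1 ?addr0 => [|i ie].
    rewrite !mxE !eqxx/= mulr1 intrD rmorphXn/= rmorphN1.
    by case: e.2; rewrite ?expr1 ?expr0; field.
  by rewrite !mxE (negPf ie) mulr0 addr0 subrr.
under eq_bigr do rewrite E.
rewrite -(pair_bigA _ (fun i (b : bool) => (2 * (-1) ^+ b * (v 0 i)%:~R + 1) / N%:R ^+ 2 : R))/=.
rewrite (eq_bigr (fun=> 2 / N%:R ^+ 2)); last first.
  by move=> i _; rewrite big_bool /= expr1 expr0; field.
by rewrite sumr_const card_ord -[_ *+ n]mulr_natr; field.
Qed.

(** At a minimal lift [sqdist] touches [tdist] from above, with equality at the centre, so its
    Laplacian [2 * n] dominates. *)
Lemma tdist_flap g : flap step N%:R tdist g <= 2 * n%:R.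
Proof.
have [v <- vE] := tdist_attained g.
rewrite /flap vE -(sum_sqdist_step v) ler_wpM2l ?sqr_ge0//; apply: ler_sum => e _.
by rewrite lerD2r -projD tdist_proj.
Qed.

(** Coefficients and solution are pulled back to [Z^n]. The points [lift x' + v] and [lift x'], with
    [v] a minimal lift of [x - x'], turn the Euclidean distance into the torus distance. The
    absolute value is there because the sign of [C] is unknown. *)
Lemma nash_transfer (cm cp sigma C : R) : 0 < cm -> 0 < sigma ->
  (forall (a : R -> 'rV[int]_n -> dir n -> R) (u : R -> 'rV[int]_n -> R),
    nash_coeff cm cp a ->
    (exists M : R, forall x, `|u 0 x| <= M) ->
    (exists M : R, forall t x, 0 <= t -> `|u t x| <= M) ->
    solves_on `[0, +oo[ u (fun t x =>
      N%:R ^+ 2 * \sum_(e : dir n) a t x e * (u t (x + dvec e) - u t x)) ->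
    forall (t s : R) (x y : 'rV[int]_n), 0 < t -> 0 < s ->
      `|u t x - u s y| <= C * sup (range (fun w => `|u 0 w|)) *
        (Num.max (Num.sqrt `|t - s|) (enorm (latpt R N x - latpt R N y)) /
           Num.sqrt (Num.min t s)) `^ sigma) ->
  nash_on_torus (@dirN n) step N%:R tdist cm cp sigma `|C|.
Proof.
move=> cm0 sg0 nash a y B ca asym abnd sy yB t s x x' t0 s0.
have B0 : 0 <= B by rewrite (le_trans _ (yB 0)).
have ybnd := divform_norm abnd cm0 sy yB; have [cy Dy] := sy.
have [v vx vE] := tdist_attained (x - x').
pose A t v e := a t (proj v) e; pose Y t v := y t (proj v).
have := nash A Y _ _ _ _ t s (lift x' + v) (lift x') t0 s0.
rewrite /Y projD proj_lift vx (addrC x') subrK => H; apply: (le_trans (H _ _ _ _)) => {H}.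
- split.
  + by move=> w e; apply: continuous_subspaceT => r; exact: ca.
  + by move=> r w e _; rewrite /A projD -asym.
  + by move=> r w e _; exact: abnd.
- by exists B => w; exact: yB.
- by exists B => r w r0; exact: ybnd.
- move=> w; split; first by apply: continuous_subspaceT => r; exact: cy.
  move=> r; rewrite interior_itv/= in_itv/= andbT => r0.
  apply: is_derive_eq (Dy r (proj w) r0) _; rewrite /divform; congr (_ * _).
  by apply: eq_bigr => e _; rewrite projD.
have S0 : 0 <= sup (range (fun w => `|y 0 (proj w)|)) <= B.
  apply/andP; split.
    apply: (@le_trans _ _ `|y 0 (proj 0)|) => //; apply: ub_le_sup; last by exists 0.
    by exists B => _ [w _ <-]; exact: yB.
  by apply: ge_sup; [exists `|y 0 (proj 0)|, 0|move=> _ [w _ <-]; exact: yB].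
have /andP[S1 S2] := S0.
rewrite (_ : latpt R N (lift x' + v) - latpt R N (lift x') = latpt R N v); last first.
  by apply/rowP => i; rewrite !mxE intrD; ring.
rewrite enorm_latpt -vE.
have m0 : 0 < Num.min t s by rewrite lt_min t0.
have q0 := tdist_ge0 (x - x').
have CS : C * sup (range (fun w => `|y 0 (proj w)|)) <= `|C| * B.
  apply: (@le_trans _ _ (`|C| * sup (range (fun w => `|y 0 (proj w)|)))).
    by apply: (ler_wpM2r S1); exact: ler_norm.
  by rewrite ler_wpM2l.
apply: (le_trans (ler_wpM2r (powR_ge0 _ _) CS)).
rewrite ler_wpM2l ?mulr_ge0//.
set r := _ / Num.sqrt _; have r0 : 0 <= r.
  by rewrite divr_ge0 ?sqrtr_ge0// le_max sqrtr_ge0.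
have -> : r `^ sigma = (r ^+ 2) `^ (sigma / 2).
  by rewrite -(powR_mulrn 2)// -powRrM; congr (_ `^ _); field.
have sg2 : 0 <= sigma / 2 by rewrite divr_ge0// ltW.
apply: (ge0_ler_powR sg2); rewrite ?nnegrE ?exprn_ge0 ?divr_ge0 ?addr_ge0 ?(ltW m0)//.
rewrite /r expr_div_n (sqr_sqrtr (ltW m0)) ler_pM2r ?invr_gt0//.
by rewrite /Num.max; case: ifP => _; rewrite sqr_sqrtr ?lerDl ?lerDr.
Qed.

End DiscreteTorus.

(** * The quasilinear equation on the lattice *)

Section Nonlinearity.
Variables (R : realType) (um up : R).
Hypothesis ump : um < up.
Local Notation I v := (um <= v <= up).

(** The supremum is an upper bound only for a bounded set; boundedness comes from the extreme value
    theorem. *)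
Lemma le_supnorm (h : R -> R) (v : R) : continuous h -> I v -> `|h v| <= supnorm um up h.
Proof.
move=> ch Iv.
have cn : {within `[um, up], continuous (fun v => `|h v|)}.
  apply: continuous_subspaceT => x.
  by apply: (@continuous_comp _ _ _ h Num.norm); [exact: ch|exact: norm_continuous].
have [c _ hc] := EVT_max (ltW ump) cn.
apply: ub_le_sup; last by exists v => //=; rewrite in_itv/=.
by exists `|h c| => _ [w wI <-]; apply: hc.
Qed.

Lemma Ck_is_derive k (h : R -> R) j (v : R) : Ck k h -> (j < k)%N ->
  is_derive v 1 (derive1n j h) (derive1n j.+1 h v).
Proof.
by move=> [Dh _] jk; have /derivableP := Dh j v jk; rewrite -derive1E.
Qed.

Lemma Ck_continuous k (h : R -> R) j : Ck k h -> (j <= k)%N -> continuous (derive1n j h).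
Proof.
move=> Ch; rewrite leq_eqVlt => /predU1P[->|jk]; first exact: Ch.2.
by move=> v; exact: is_derive_continuous (Ck_is_derive v Ch jk).
Qed.

Variables (cm cp : R) (phi : R -> R).
Hypothesis Cphi : Ck 5 phi.
Local Notation dphi := (derive1 phi).
Local Notation L := (supnorm um up (derive1n 2 phi)).

Lemma supnorm_ge0 : 0 <= L.
Proof.
have c2 := @Ck_continuous 5 phi 2 Cphi isT.
by apply: le_trans (normr_ge0 _) (le_supnorm (v := um) c2 _); rewrite lexx ltW.
Qed.

Let itv_sub (v w r : R) : I v -> I w -> v < r < w -> I r.
Proof. by move=> /andP[? ?] /andP[? ?] /andP[? ?]; apply/andP; split; lra. Qed.

Let increment_le (h dh : R -> R) (B v w : R) : I v -> I w ->
  (forall r : R, is_derive r 1 h (dh r)) ->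
  (forall r, Num.min v w <= r <= Num.max v w -> `|dh r| <= B) ->
  `|h w - h v| <= B * `|w - v|.
Proof.
wlog vw : v w / v <= w.
  move=> H Iv Iw Dh hB; have [vw|/ltW wv] := leP v w; first exact: H.
  by rewrite distrC (distrC w); apply: H => //; rewrite minC maxC.
move=> Iv Iw Dh; rewrite min_l// max_r// => hB.
rewrite (@ger0_norm _ (w - v)) ?subr_ge0// mulrBr.
apply: (@dominated_increment R h (fun r => B * r) dh (fun=> B)) => //.
- by apply: continuous_subspaceT => r; exact: is_derive_continuous (Dh r).
- by apply: continuous_subspaceT => r; apply: cvgM; [exact: cvg_cst|exact: cvg_id].
- move=> r _; apply: is_derive_eq (is_derive_cmulf B (is_derive_id r (1 : R))) _.
  by rewrite mulr1.
- by move=> r /andP[vr rw]; apply: hB; rewrite !ltW.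
Qed.

Let Dphi (v : R) : is_derive v 1 phi (dphi v).
Proof. exact: (@Ck_is_derive 5 phi 0 v Cphi). Qed.

Lemma dphi_lipschitz v w : I v -> I w -> `|dphi v - dphi w| <= L * `|v - w|.
Proof.
move=> Iv Iw; have D2 r := @Ck_is_derive 5 phi 1 r Cphi isT.
apply: (increment_le Iw Iv D2) => r rvw; apply: (le_supnorm (@Ck_continuous 5 phi 2 Cphi isT)).
move: Iv Iw rvw => /andP[v1 v2] /andP[w1 w2]; rewrite ge_min le_max.
by move=> /andP[/orP[]? /orP[]?]; apply/andP; split; lra.
Qed.

(** [phi r - dphi z * r] has derivative at most [L * |r - z|], and [|r - z| <= |v - z| + |w - z|]
    for [r] between [v] and [w]. *)
Lemma phi_taylor_le v w z : I v -> I w -> I z ->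
  `|phi w - phi v - dphi z * (w - v)| <= L * (`|v - z| + `|w - z|) * `|w - v|.
Proof.
move=> Iv Iw Iz.
rewrite (_ : _ - _ = (phi w - dphi z * w) - (phi v - dphi z * v)); last by ring.
apply: (@increment_le (fun r => phi r - dphi z * r) (fun r => dphi r - dphi z)) => //.
  move=> r; apply: is_derive_eq (is_derive_subf (Dphi r) (is_derive_cmulf (dphi z) (is_derive_id r (1 : R)))) _.
  by rewrite mulr1.
move=> r rvw; have Ir : I r.
  move: Iv Iw rvw => /andP[v1 v2] /andP[w1 w2]; rewrite ge_min le_max.
  by move=> /andP[/orP[]? /orP[]?]; apply/andP; split; lra.
apply: (le_trans (dphi_lipschitz Ir Iz)); rewrite ler_wpM2l ?supnorm_ge0//.
move: rvw; rewrite ge_min le_max => rvw.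
have := ler_norm (v - z); have := ler_norm (w - z).
have := ler_norm (- (v - z)); have := ler_norm (- (w - z)); rewrite !normrN => *.
by rewrite ler_norml; case/andP: rvw => /orP[]? /orP[]?; apply/andP; split; lra.
Qed.

Hypothesis cm_min : is_min (dphi @` `[um, up]) cm.
Hypothesis cp_max : is_max (dphi @` `[um, up]) cp.

Lemma dphi_bounds v : I v -> cm <= dphi v <= cp.
Proof.
move=> Iv; have vI : (dphi @` `[um, up]) (dphi v) by exists v => //=; rewrite in_itv.
by rewrite cm_min.2// cp_max.2.
Qed.

Lemma phi_secant_bounds v w : I v -> I w -> v < w ->
  cm <= (phi w - phi v) / (w - v) <= cp.
Proof.
move=> Iv Iw vw; have wv0 : 0 < w - v by rewrite subr_gt0.
have cphi (r : R) : {for r, continuous phi} by exact: is_derive_continuous (Dphi r).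
have clin c : {within `[v, w], continuous (fun r : R => c * r)}.
  by apply: continuous_subspaceT => r; apply: cvgM; [exact: cvg_cst|exact: cvg_id].
have Dlin c (r : R) : is_derive r 1 (fun r : R => c * r) c.
  by apply: is_derive_eq (is_derive_cmulf c (is_derive_id r (1 : R))) _; rewrite mulr1.
rewrite ler_pdivlMr// ler_pdivrMr// !mulrBr; apply/andP; split.
  apply: (@le_increment R (fun r => cm * r) phi (fun=> cm) dphi) => //.
  - exact: ltW.
  - by apply: continuous_subspaceT => r; exact: cphi.
  - by move=> r vrw; have /andP[] := dphi_bounds (itv_sub Iv Iw vrw).
apply: (@le_increment R phi (fun r => cp * r) dphi (fun=> cp)) => //.
- exact: ltW.
- by apply: continuous_subspaceT => r; exact: cphi.
- by move=> r vrw; have /andP[] := dphi_bounds (itv_sub Iv Iw vrw).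
Qed.

End Nonlinearity.

Section DiscreteNorms.
Variables (R : realType) (n N' : nat).
Local Notation N := N'.+1.
Implicit Types (g : 'rV[int]_n -> R) (x : 'rV[int]_n) (e : dir n).

Lemma periodic_lift g x : lattice_periodic N g -> g x = g (lift (proj N' x)).
Proof. by move=> gP; have [k kE] := lift_proj N' x; rewrite [in LHS]kE gP. Qed.

Lemma lmax_ge0 g : 0 <= lmax N g.
Proof. exact: bigmax_ge_id. Qed.

Lemma lmax_ge g x : lattice_periodic N g -> `|g x| <= lmax N g.
Proof.
move=> gP; have [k ->] := lift_proj N' x; rewrite gP.
pose F : {ffun 'I_n -> 'I_N} := [ffun i => proj N' x 0 i].
rewrite (_ : lift _ = \row_i (F i : nat)%:Z); last first.
  by apply/rowP => i; rewrite !mxE ffunE !mxE.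
exact: (@le_bigmax _ _ _ 0 (fun x : {ffun 'I_n -> 'I_N} => `|g (\row_i (x i : nat)%:Z)|) F).
Qed.

Lemma lattice_periodic_lgrad e g : lattice_periodic N g -> lattice_periodic N (lgrad N e g).
Proof. by move=> gP x k; rewrite /lgrad addrAC !gP. Qed.

Lemma normCkN_ge k g (es : seq (dir n)) x : (size es <= k)%N -> lattice_periodic N g ->
  `|foldr (lgrad N) g es x| <= normCkN N k g.
Proof.
move=> es_k gP; have esP : lattice_periodic N (foldr (lgrad N) g es).
  by elim: es {es_k} => //= e es; exact: lattice_periodic_lgrad.
apply: (le_trans (lmax_ge x esP)); rewrite /normCkN.
have sk : (size es < k.+1)%N by [].
rewrite (bigD1 (Ordinal sk))//= (bigD1 (in_tuple es))//= -addrA lerDl addr_ge0//.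
  by apply: sumr_ge0 => *; exact: lmax_ge0.
by apply: sumr_ge0 => i _; apply: sumr_ge0 => *; exact: lmax_ge0.
Qed.

End DiscreteNorms.

Definition base_cst (R : realType) (um up normf : R) : R := 1 + `|normf| + `|um| + `|up|.

(** The Schauder part wants one constant [C1] with [H], [Kf], [C0] all at most [C1 * M]. As [H] is
    itself computed from [base_cst], its constant is added in a second stage. *)
Definition data_cst (R : realType) (n : nat) (T um up cp L sigma normf CN : R) : R :=
  base_cst um up normf +
  `|holder_cst (dir n) cp L sigma T CN (base_cst um up normf)|.

Section LatticeEstimates.
Variables (R : realType) (n N' : nat).
Local Notation N := N'.+1.
Local Notation G := 'rV['I_N]_n.
Variables (T um up cm cp sigma CN : R).
Hypotheses (T0 : 0 < T) (ump : um < up) (cm0 : 0 < cm) (sigma01 : 0 < sigma < 1).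
Hypothesis CN0 : 0 <= CN.
Hypothesis nash : nash_on_torus (@dirN n) (@step n N') N%:R (@tdist n N' R) cm cp sigma CN.
Variables (phi f : R -> R) (K C0 : R) (u : R -> 'rV[int]_n -> R).
Hypotheses (Cphi : Ck 5 phi) (Cf : Ck 1 f) (K0 : 0 < K).
Hypothesis cm_min : is_min (derive1 phi @` `[um, up]) cm.
Hypothesis cp_max : is_max (derive1 phi @` `[um, up]) cp.
Hypothesis uP : forall t, 0 <= t <= T -> lattice_periodic N (u t).
Hypothesis u_solves : solves_on `[0, T] u
  (fun t x => llap N (fun y => phi (u t y)) x + K * f (u t x)).
Hypothesis uI : forall t x, 0 <= t <= T -> um <= u t x <= up.
Hypothesis u0C : normCkN N 2 (u 0) <= C0.

Local Notation normf := (supnorm um up f).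
Local Notation L := (supnorm um up (derive1n 2 phi)).
Local Notation M := (K + C0 + 1).
Local Notation C1 := (base_cst um up normf).
Local Notation C1' := (data_cst n T um up cp L sigma normf CN).

(** Clamping time defines [U] for all times with values in [[um, up]], as the coefficients of the
    Nash estimate require, and gives the prolongation by [u 0] to [t < 0]. *)
Let U (t : R) (g : G) : R := u (clamp 0 T t) (lift g).

Let TT : 0 <= (0 : R) <= T. Proof. by rewrite lexx ltW. Qed.

Let clampT t : 0 <= clamp 0 T t <= T. Proof. exact: clamp_itv (ltW T0). Qed.

Let UE t x : 0 <= t <= T -> u t x = U t (proj N' x).
Proof. by move=> tT; rewrite /U clamp_id// -periodic_lift//; exact: uP. Qed.

Let fdiffE t e (g : G) : fdiff (@step n N') N%:R e (U t) g = lgrad N e (u (clamp 0 T t)) (lift g).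
Proof.
by rewrite /fdiff /lgrad (UE (lift g + dvec e) (clampT t)) projD proj_lift /U (clamp_id (clampT t)).
Qed.

Let lgradE t e x : 0 <= t <= T -> lgrad N e (u t) x = fdiff (@step n N') N%:R e (U t) (proj N' x).
Proof. by move=> tT; rewrite /fdiff /lgrad !(UE _ tT) projD. Qed.

Let lgrad2E e e' g : fdiff (@step n N') N%:R e (fdiff (@step n N') N%:R e' (U 0)) g =
  lgrad N e (lgrad N e' (u 0)) (lift g).
Proof.
rewrite -[RHS]/(N%:R * (lgrad N e' (u 0) (lift g + dvec e) - lgrad N e' (u 0) (lift g))).
by rewrite !(lgradE e' _ TT) projD proj_lift.
Qed.

Let cU g : continuous (U^~ g).
Proof. exact: continuous_comp_clamp (ltW T0) (u_solves (lift g)).1. Qed.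

Let DU t g : 0 < t < T -> is_derive t 1 (U^~ g)
  (flap (@step n N') N%:R (fun y => phi (U t y)) g + K * f (U t g)).
Proof.
move=> tT; have tT' : 0 <= t <= T by case/andP: tT => *; rewrite !ltW.
have tI : (`[0, T]° : set R) t by rewrite interior_itv/= in_itv.
have D := (u_solves (lift g)).2 t tI.
have D' : is_derive t 1 (U^~ g) (llap N (fun y => phi (u t y)) (lift g) + K * f (u t (lift g))).
  have tN : \forall r \near t, r \in `]0, T[%R.
    by apply: near_in_itvoo; rewrite in_itv.
  apply: near_eq_is_derive D; apply: filterS tN => r; rewrite in_itv/= => /andP[r0 rT].
  by rewrite /U clamp_id// !ltW.
apply: is_derive_eq D' _; rewrite (UE _ tT') proj_lift; congr (_ + _).
rewrite /llap /flap; congr (_ * _); apply: eq_bigr => e _.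
by rewrite !(UE _ tT') projD proj_lift.
Qed.

Let U0P : lattice_periodic N (u 0). Proof. exact: uP TT. Qed.

Let C00 : 0 <= C0.
Proof.
exact: le_trans (le_trans (normr_ge0 _) (@normCkN_ge R n N' 2 (u 0) [::] 0 isT U0P)) u0C.
Qed.

Let U0_grad e g : `|fdiff (@step n N') N%:R e (U 0) g| <= C0.
Proof.
rewrite fdiffE (clamp_id TT).
exact: le_trans (@normCkN_ge R n N' 2 (u 0) [:: e] _ isT U0P) u0C.
Qed.

Let U0_hess e e' g :
  `|fdiff (@step n N') N%:R e (fdiff (@step n N') N%:R e' (U 0)) g| <= C0.
Proof.
rewrite lgrad2E.
exact: le_trans (@normCkN_ge R n N' 2 (u 0) [:: e; e'] _ isT U0P) u0C.
Qed.

Let UI t g : um <= U t g <= up. Proof. exact: uI. Qed.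

Let C11 : 1 <= C1.
Proof. by rewrite /base_cst -!addrA lerDl !addr_ge0. Qed.

Let normf0 : 0 <= normf.
Proof.
have cf := @Ck_continuous R 1 f 0 Cf isT.
by apply: le_trans (normr_ge0 _) (le_supnorm (v := um) ump cf _); rewrite lexx ltW.
Qed.

Let bK t g : 0 <= t <= T -> `|K * f (U t g)| <= K * normf.
Proof.
have cf := @Ck_continuous R 1 f 0 Cf isT.
by move=> _; rewrite normrM gtr0_norm// ler_wpM2l ?(ltW K0)//; exact: (le_supnorm ump cf).
Qed.

Let U_bound t g : `|U t g| <= C1.
Proof.
have /andP[U1 U2] := UI t g; rewrite /base_cst.
have := ler_norm um; have := ler_norm (- um); have := ler_norm up; have := ler_norm (- up).
rewrite !normrN => *; have := normr_ge0 normf.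
by rewrite ler_norml => ?; apply/andP; split; lra.
Qed.

Let M1 : 1 <= M. Proof. by rewrite lerDr addr_ge0// ltW. Qed.

Let KM : K * normf <= C1 * M.
Proof.
rewrite mulrC ler_pM// ?(ltW K0)//.
  by rewrite /base_cst (ger0_norm normf0); have := normr_ge0 um; have := normr_ge0 up; lra.
by have := C00; lra.
Qed.

Let CM : C0 <= C1 * M.
Proof.
apply: (@le_trans _ _ M); first by have := K0; lra.
by rewrite ler_peMl// (le_trans _ M1).
Qed.

Let L0 : 0 <= L. Proof. exact: supnorm_ge0 Cphi. Qed.

Let dphi_lip := dphi_lipschitz ump Cphi.
Let taylor := phi_taylor_le ump Cphi.
Let UI' t g : 0 <= t <= T -> um <= U t g <= up. Proof. by []. Qed.
Let U_bound' t g : 0 <= t <= T -> `|U t g| <= C1. Proof. by []. Qed.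

Local Notation H := (holder_cst (dir n) cp L sigma T CN C1 * M).

Let U_holder t s g h : 0 <= t <= T -> 0 <= s <= T ->
  `|U t g - U s h| <= `|H| * (`|t - s| + tdist R (g - h)) `^ (sigma / 2).
Proof.
move=> tT sT.
have cphi : continuous phi := @Ck_continuous R 5 phi 0 Cphi isT.
have U_neg r : r <= 0 -> U r = U 0.
  move=> r0; apply/funext => x; rewrite /U (clamp_id TT); congr (u _ _).
  by rewrite /clamp min_l ?max_l// (le_trans r0) ?ltW.
have := quasilinear_holder (@dirNK n) (@stepN n N') (@tdist_ge0 n N' R) (@tdistN n N' R)
  T0 cm0 sigma01 CN0 L0 nash (dphi_bounds cm_min cp_max) dphi_lip
  taylor (phi_secant_bounds Cphi cm_min cp_max) cphi UI cU U_neg DU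
  bK U0_hess U_bound M1 KM CM C11 g h tT sT.
by move/le_trans; apply; rewrite ler_wpM2r ?powR_ge0// ler_norm.
Qed.

Let C1C1' : C1 <= C1'. Proof. by rewrite lerDl. Qed.
Let C1'1 : 1 <= C1'. Proof. exact: le_trans C1C1'. Qed.
Let M0 : 0 <= M. Proof. exact: le_trans M1. Qed.
Let HM : `|H| <= C1' * M.
Proof.
rewrite normrM (ger0_norm M0) ler_wpM2r// /data_cst lerDr.
exact: le_trans C11.
Qed.
Let KM' : K * normf <= C1' * M. Proof. by rewrite (le_trans KM)// ler_wpM2r. Qed.
Let CM' : C0 <= C1' * M. Proof. by rewrite (le_trans CM)// ler_wpM2r. Qed.
Let Kf0 : 0 <= K * normf. Proof. by rewrite mulr_ge0// ltW. Qed.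
Let C10 : 0 <= C1. Proof. exact: le_trans C11. Qed.
Let N1 : 1 <= N%:R :> R. Proof. by rewrite ler1n. Qed.
Let Cq0 : 0 <= 2 * n%:R :> R. Proof. by rewrite mulr_ge0. Qed.
Let dphi_ge v : um <= v <= up -> cm <= derive1 phi v.
Proof. by move/(dphi_bounds cm_min cp_max)/andP => []. Qed.
Let dphi_le v : um <= v <= up -> derive1 phi v <= cp.
Proof. by move/(dphi_bounds cm_min cp_max)/andP => []. Qed.

Lemma lgrad_le t e x : 0 <= t <= T -> `|lgrad N e (u t) x| <=
  2 * half_grad_cst (dir n) (2 * n%:R) cm L sigma C1' * M `^ (1 / sigma).
Proof.
move=> tT; rewrite (lgradE e x tT).
exact: (grad_le (@dirNK n) (@stepN n N') N1 (@tdist_ge0 n N' R) (tdist0 _ _ _)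
  (@tdistD n N' R) (@tdist_step n N' R) Cq0 (@tdist_flap n N' R) cm0 sigma01 L0
  (normr_ge0 H) Kf0 C00 C10 dphi_ge taylor UI' cU DU
  bK U_holder U0_grad U_bound' M1 HM KM' CM' C1C1' C1'1).
Qed.

Lemma lgrad_step_le t e i x (k : nat) : 0 <= t <= T ->
  `|lgrad N e (u t) (x + k%:Z *: delta_mx 0 i) - lgrad N e (u t) x| <=
  step_cst (dir n) (2 * n%:R) cm L sigma C1' * M `^ (1 + 1 / sigma) * (k%:R / N%:R) `^ sigma.
Proof.
move=> tT; rewrite !(lgradE e _ tT).
have -> : proj N' (x + k%:Z *: delta_mx 0 i) = proj N' x + step N' (i, false) *+ k.
  by rewrite projD -projMn /dvec/= expr0 scale1r -scaler_nat natz.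
exact: (grad_step_le (@dirNK n) (@stepN n N') N1 (@tdist_ge0 n N' R) (tdist0 _ _ _)
  (@tdistD n N' R) (@tdist_step n N' R) Cq0 (@tdist_flap n N' R) cm0 sigma01 L0
  (normr_ge0 H) Kf0 C00 C10 dphi_ge dphi_lip taylor UI' cU DU bK
  U_holder U0_grad U0_hess U_bound' M1 HM KM' CM' C1C1' C1'1).
Qed.

Lemma lgrad_time_le s t e x : 0 <= s <= T -> 0 <= t <= T ->
  `|lgrad N e (u t) x - lgrad N e (u s) x| <=
  grad_time_cst (dir n) (2 * n%:R) cm cp L sigma C1' n * M `^ (1 + 1 / sigma)
    * `|t - s| `^ (sigma / 2).
Proof.
wlog st : s t / s <= t.
  move=> W sT tT; have [st|/ltW ts] := leP s t; first exact: W.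
  by rewrite distrC (distrC t); exact: W.
move=> sT tT; rewrite (lgradE e x sT) (lgradE e x tT) (@ger0_norm _ (t - s)) ?subr_ge0//.
have /andP[s0 _] := sT; have /andP[_ t1] := tT.
have s0t : 0 <= s <= t by rewrite s0.
exact: (grad_time_le (@dirNK n) (@stepN n N') N1 (@tdist_ge0 n N' R) (tdist0 _ _ _)
  (@tdistD n N' R) (@tdist_step n N' R) (@tdist_path n N' R) Cq0 (@tdist_flap n N' R) cm0 sigma01 L0
  (normr_ge0 H) Kf0 C00 C10 dphi_ge dphi_le dphi_lip taylor UI' cU DU bK
  U_holder U0_grad U0_hess U_bound' M1 HM KM' CM' C1C1' C1'1
  e (proj N' x) s0t t1).
Qed.

Lemma lattice_time_le s t x : 0 <= s <= T -> 0 <= t <= T ->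
  `|u t x - u s x| <= u_time_cst (dir n) (2 * n%:R) cm cp L sigma C1' n * M `^ (1 + 1 / sigma)
    * `|t - s| `^ ((1 + sigma) / 2).
Proof.
wlog st : s t / s <= t.
  move=> W sT tT; have [st|/ltW ts] := leP s t; first exact: W.
  by rewrite distrC (distrC t); exact: W.
move=> sT tT; rewrite (UE x sT) (UE x tT) (@ger0_norm _ (t - s)) ?subr_ge0// (addrC 1 sigma).
have /andP[s0 _] := sT; have /andP[_ t1] := tT.
have s0t : 0 <= s <= t by rewrite s0.
exact: (u_time_le (@dirNK n) (@stepN n N') N1 (@tdist_ge0 n N' R) (tdist0 _ _ _)
  (@tdistD n N' R) (@tdist_step n N' R) (@tdist_path n N' R) Cq0 (@tdist_flap n N' R) cm0 sigma01 L0
  (normr_ge0 H) Kf0 C00 C10 dphi_ge dphi_le dphi_lip taylor UI' cU DU bK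
  U_holder U0_grad U0_hess U_bound' M1 HM KM' CM' C1C1' C1'1
  (proj N' x) s0t t1).
Qed.

Lemma lattice_le t x : 0 <= t <= T -> `|u t x| <= C1' * M `^ (1 + 1 / sigma).
Proof.
move=> tT; rewrite (UE x tT) (le_trans (U_bound _ _))// (le_trans C1C1')//.
rewrite ler_peMr ?(le_trans _ C1'1)// -[leLHS](powRr0 M) ler_powR//.
by case/andP: sigma01 => sg0 _; rewrite addr_ge0// divr_ge0// ltW.
Qed.

End LatticeEstimates.

Section InterpolationNorms.
Variables (R : realType) (n N' : nat).
Local Notation N := N'.+1.
Implicit Types (v : R -> 'rV[int]_n -> R) (z : 'rV[R]_n).

Lemma grad_interp e v t z :
  grad N e (interp N v) t z = pinterp N (lgrad N e (v t)) z.
Proof.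
rewrite /grad -[interp N v t (_ + _)]/(pinterp N (v t) (z + latpt R N (dvec e))).
rewrite -[interp N v t z]/(pinterp N (v t) z) pinterp_latpt//.
rewrite (_ : lgrad N e (v t) = fun x => N%:R * v t (x + dvec e) + - N%:R * v t x).
  by rewrite pinterp_lin; ring.
by apply/funext => x; rewrite /lgrad; ring.
Qed.

Lemma pinterp_sub g g' z (B : R) : (forall x, `|g x - g' x| <= B) ->
  `|pinterp N g z - pinterp N g' z| <= B.
Proof.
move=> gB; have := pinterp_lin N 1 (-1) g g' z.
rewrite mul1r mulN1r => <-; apply: pinterp_bound => // x.
by rewrite mul1r mulN1r.
Qed.

(** A quotient by [0] is [0], so a product bound passes to the Hölder quotients whatever the
    denominator. *)
Lemma ratio_le (a c p : R) : 0 <= p -> 0 <= c -> a <= c * p -> a / p <= c.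
Proof.
rewrite le_eqVlt => /predU1P[<- c0 _|p0 _]; first by rewrite invr0 mulr0.
by rewrite ler_pdivrMr.
Qed.

Lemma pdist_ge0 (X Y : R * 'rV[R]_n) : 0 <= pdist X Y.
Proof. by rewrite le_max sqrtr_ge0. Qed.

Lemma torus_dist_ge0 (z y : 'rV[R]_n) : 0 <= torus_dist z y.
Proof.
apply: lb_le_inf; first by exists (enorm (z - y + map_mx intr (0 : 'rV[int]_n))), 0.
by move=> _ [k _ <-]; exact: sqrtr_ge0.
Qed.

Lemma pinterp_pdist v (T A B s : R) (X Y : R * 'rV[R]_n) : 0 <= A -> 0 <= B -> 0 < s < 1 ->
  (forall t, 0 <= t <= T -> lattice_periodic N (v t)) ->
  (forall t i x (k : nat), 0 <= t <= T ->
    `|v t (x + k%:Z *: delta_mx 0 i) - v t x| <= A * (k%:R / N%:R) `^ s) ->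
  (forall r t x, 0 <= r <= T -> 0 <= t <= T -> `|v t x - v r x| <= B * `|t - r| `^ (s / 2)) ->
  0 <= X.1 <= T -> 0 <= Y.1 <= T ->
  `|pinterp N (v X.1) X.2 - pinterp N (v Y.1) Y.2| <= (3 * n%:R * A + B) * pdist X Y `^ s.
Proof.
move=> A0 B0 /andP[s0 s1] vP vA vB XT YT.
have split3 (r1 r2 r3 : R) : r1 - r3 = (r1 - r2) + (r2 - r3) by ring.
rewrite (split3 _ (pinterp N (v X.1) Y.2)) (le_trans (ler_normD _ _))// mulrDl lerD//.
  have s01 : 0 < s <= 1 by rewrite s0 ltW.
  apply: (le_trans (pinterp_torus _ A0 s01 (vP _ XT) (fun i x k => vA _ i x k XT) _ _)) => //.
  rewrite ler_wpM2l ?mulr_ge0//; apply: (ge0_ler_powR (ltW s0)); rewrite ?nnegrE ?torus_dist_ge0 ?pdist_ge0//.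
  by rewrite le_max lexx orbT.
apply: (le_trans (pinterp_sub _ (fun x => vB _ _ x YT XT))).
rewrite ler_wpM2l//.
have -> : `|X.1 - Y.1| `^ (s / 2) = Num.sqrt `|X.1 - Y.1| `^ s.
  by rewrite -powR12_sqrt// -powRrM; congr (_ `^ _); ring.
apply: (ge0_ler_powR (ltW s0)); rewrite ?nnegrE ?pdist_ge0 ?sqrtr_ge0//.
by rewrite le_max lexx.
Qed.

End InterpolationNorms.

Theorem corollary4p4 (R : realType) (n : nat)
    (T um up cm cp sigma normf normphi2 : R) :
  (0 < n)%N -> 0 < T -> um < up -> 0 < cm ->
  nash_exponent n cm cp sigma ->
  exists C : R,
    forall (phi f : R -> R) (K C0 : R) (u : nat -> R -> 'rV[int]_n -> R),
      Ck 5 phi -> {homo phi : v w / v < w} ->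
      Ck 1 f -> (exists M : R, forall v, M < `|v| -> v * f v < 0) ->
      0 < K ->
      is_min (derive1 phi @` `[um, up]) cm ->
      is_max (derive1 phi @` `[um, up]) cp ->
      supnorm um up f = normf ->
      supnorm um up (derive1n 2 phi) = normphi2 ->
      (forall N : nat, (0 < N)%N ->
        [/\ forall t, 0 <= t <= T -> lattice_periodic N (u N t),
            solves_on `[0, T] (u N) (fun t x =>
              llap N (fun y => phi (u N t y)) x + K * f (u N t x)),
            forall t x, 0 <= t <= T -> um <= u N t x <= up &
            normCkN N 2 (u N 0) <= C0]) ->
      forall N : nat, (0 < N)%N ->
        [/\ (par_norm1 T N sigma (interp N (u N))
               <= (C * (K + C0 + 1) `^ (1 + 1 / sigma))%:E)%E,
            forall (e : dir n) (t : R) (x : 'rV[int]_n), 0 <= t <= T ->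
              `|lgrad N e (u N t) x| <= C * (K + C0 + 1) `^ (1 / sigma) &
            forall e : dir n,
              (holder T sigma (grad N e (interp N (u N)))
                 <= (C * (K + C0 + 1) `^ (1 + 1 / sigma))%:E)%E].
Proof.
move=> _ T0 ump cm0 [sigma01 [CN nashC]]; have /andP[s0 s1] := sigma01.
(* All constants are formed from the parameters before [phi], [f], [K], [C0] and [u] are introduced;
   [fE] and [phiE] later identify the norms. *)
pose C1 := data_cst n T um up cp normphi2 sigma normf `|CN|.
pose E := half_grad_cst (dir n) (2 * n%:R) cm normphi2 sigma C1.
pose A := step_cst (dir n) (2 * n%:R) cm normphi2 sigma C1.
pose At := grad_time_cst (dir n) (2 * n%:R) cm cp normphi2 sigma C1 n.
pose Au := u_time_cst (dir n) (2 * n%:R) cm cp normphi2 sigma C1 n.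
pose A3 := 3 * n%:R * `|A|.
have A30 : 0 <= A3 by rewrite mulr_ge0.
have C10 : 0 <= C1 by rewrite addr_ge0// !addr_ge0.
have := normr_ge0 E; have := normr_ge0 At; have := normr_ge0 Au => Au0 At0 E0.
(* [A3] and [At] bound the gradient seminorm in space and time, [Au] the time seminorm, [C1] the
   supremum and [2 * E] the gradient. Absolute values dispense with sign checks. *)
exists (A3 + `|At| + `|Au| + C1 + 2 * `|E|) => phi f K C0 u Cphi _ Cf _ K0 cm_min cp_max fE phiE uH.
case=> // N' _; have [uP us uI uC] := uH N'.+1 isT.
have nash := @nash_transfer n N' R cm cp sigma CN cm0 s0 (fun a u => @nashC N'.+1 a u isT).
set P := _ `^ (1 / sigma); set Q := _ `^ (1 + 1 / sigma).
have P0 : 0 <= P by exact: powR_ge0.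
have Q0 : 0 <= Q by exact: powR_ge0.
have CN0 := normr_ge0 CN.
have := lgrad_le T0 ump cm0 sigma01 CN0 nash Cphi Cf K0 cm_min cp_max uP us uI uC.
have := lgrad_step_le T0 ump cm0 sigma01 CN0 nash Cphi Cf K0 cm_min cp_max uP us uI uC.
have := lgrad_time_le T0 ump cm0 sigma01 CN0 nash Cphi Cf K0 cm_min cp_max uP us uI uC.
have := lattice_time_le T0 ump cm0 sigma01 CN0 nash Cphi Cf K0 cm_min cp_max uP us uI uC.
have := lattice_le cp `|CN| T0 sigma01 phi f K0 uP uI uC.
rewrite fE phiE -/C1 -/E -/A -/At -/Au -/P -/Q => uB ut gt gs gB.
have grad_le e X Y : Omega T X -> Omega T Y ->
    `|grad N'.+1 e (interp N'.+1 (u N'.+1)) X.1 X.2 - grad N'.+1 e (interp N'.+1 (u N'.+1)) Y.1 Y.2|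
    <= (A3 + `|At|) * Q * pdist X Y `^ sigma.
  move=> [XT _] [YT _]; rewrite !grad_interp.
  have AQ0 : 0 <= `|A| * Q by rewrite mulr_ge0.
  have BQ0 : 0 <= `|At| * Q by rewrite mulr_ge0.
  have := @pinterp_pdist R n N' (fun t => lgrad N'.+1 e (u N'.+1 t)) T _ _ sigma X Y AQ0 BQ0 sigma01.
  rewrite (_ : 3 * n%:R * (`|A| * Q) + `|At| * Q = (A3 + `|At|) * Q); last by rewrite /A3; ring.
  apply=> //.
  - by move=> t tT; apply: lattice_periodic_lgrad; exact: uP.
  - move=> t i x k tT; apply: (le_trans (gs t e i x k tT)).
    by rewrite ler_wpM2r ?powR_ge0// ler_wpM2r// ler_norm.
  - move=> r t x rT tT; apply: (le_trans (gt r t e x rT tT)).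
    by rewrite ler_wpM2r ?powR_ge0// ler_wpM2r// ler_norm.
have A3Q0 : 0 <= (A3 + `|At|) * Q by rewrite mulr_ge0// addr_ge0.
split=> [|e t x tT|e].
- apply: (@le_trans _ _ (((A3 + `|At|) * Q)%:E + (`|Au| * Q)%:E + (C1 * Q)%:E)%E); last first.
    rewrite -!EFinD lee_fin -!mulrDl ler_wpM2r//; lra.
  apply: leeD; first apply: leeD; apply: ge_ereal_sup.
  + move=> _ [X [Y [XT YT _ ->]]]; rewrite lee_fin; apply: ratio_le; rewrite ?powR_ge0//.
    apply: bigmax_le => [|i _]; last exact: grad_le.
    by rewrite mulr_ge0// powR_ge0.
  + move=> _ [t [s [z [[tT _] [sT _] _ ->]]]]; rewrite lee_fin; apply: ratio_le; rewrite ?powR_ge0 ?mulr_ge0//.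
    apply: pinterp_sub => x; apply: (le_trans (ut s t x sT tT)).
    by rewrite ler_wpM2r ?powR_ge0// ler_wpM2r// ler_norm.
  + by move=> _ [X [XT _] <-]; rewrite lee_fin; apply: pinterp_bound => x; exact: uB.
- apply: (le_trans (gB t e x tT)); rewrite ler_wpM2r//.
  by have := ler_norm E; lra.
- apply: ge_ereal_sup => _ [X [Y [XT YT _ ->]]]; rewrite lee_fin.
  apply: (@le_trans _ _ ((A3 + `|At|) * Q)); last by rewrite ler_wpM2r//; lra.
  by apply: ratio_le; rewrite ?powR_ge0//; exact: grad_le.
Qed.
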